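(* Let $M(g,\varrho)$ be a simple $\mathfrak{D}(G)$-module, let $\mathsf{S}(g,\varrho)$ be the socle of the Verma module $\mathsf{M}(g,\varrho)$ as a $\mathfrak{D}$-module, and let $M(\hat g^*,\hat\varrho^* )$ denote the dual $\mathfrak{D}(G)$-module of $M(\hat g,\hat\varrho)\simeq\mathfrak{B}^{n_{top}}(V)\otimes M(g,\varrho)$, where $n_{top}$ is the maximum degree of $\mathfrak{B}(V)$. Then the dual $\mathfrak{D}$-module $\bigl(\mathsf{S}(g,\varrho)\bigr)^*$ is a highest-weight module of weight $(\hat g^*,\hat\varrho^* )$. Therefore $\bigl(\mathsf{S}(g,\varrho)\bigr)^*\simeq\mathsf{L}(\hat g^*,\hat\varrho^* )$ as $\mathfrak{D}$-modules.
   Context: Throughout, $\Bbbk$ is an algebraically closed field of characteristic zero, $G$ is a finite non-abelian group, and $V$ is a (left-left) Yetter–Drinfeld module over $\Bbbk G$ whose Nichols algebra $\mathfrak{B}(V)=\bigoplus_{n\ge 0}\mathfrak{B}^n(V)$ is finite-dimensional (then $\mathfrak{B}^{n_{top}}(V)$ is one-dimensional). Modules are left modules; the dual of a module over a Hopf algebra is a module via the antipode, $\langle h\cdot f,m\rangle=\langle f,\mathcal{S}(h)m\rangle$. For a finite-dimensional Hopf algebra $H$, the Drinfeld double is $H\otimes H^*$ as a coalgebra, with multiplication $(h\otimes f)(h'\otimes f')=\langle f_{(1)},h'_{(1)}\rangle\langle f_{(3)},\mathcal{S}(h'_{(3)})\rangle\,(hh'_{(2)}\otimes f'f_{(2)})$;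 it contains $H$ and $H^{*op}$ as Hopf subalgebras. $\mathfrak{D}(G)$ is the Drinfeld double of $\Bbbk G$, and $\mathfrak{D}$ is the Drinfeld double of the bosonization $\mathfrak{B}(V)\#\Bbbk G$. Let $\Bbbk^G=(\Bbbk G)^*$ with basis $\{\delta_h\}$ dual to $G$. Let $\overline V$ be $V^*$ with the Yetter–Drinfeld structure over $\Bbbk^G$ given by $\langle f\cdot y,x\rangle=\langle f,\mathcal{S}(x_{(-1)})\rangle\langle y,x_{(0)}\rangle$ and $\langle y,g\cdot x\rangle=\langle y_{(-1)},g\rangle\langle y_{(0)},x\rangle$. One identifies $(\mathfrak{B}(V)\#\Bbbk G)^{*op}$ with $\mathfrak{B}(\overline V)\#\Bbbk^G$ (as graded Hopf algebras; $f\in\Bbbk^G$ acts as a functional on $\mathfrak{B}^0(V)\#\Bbbk G$ by $\langle f,g\rangle$ and vanishes in other degrees; $y\in\overline V$ acts by $x\#g\mapsto\langle y,x\rangle$ on $V\#\Bbbk G$ and vanishes in other degrees). Inside $\mathfrak{D}$, the subalgebra generated by $\Bbbk G$ and $\Bbbk^G$ is $\mathfrak{D}(G)$, and multiplication gives a linear isomorphism $\mathfrak{B}(V)\otimes\mathfrak{D}(G)\otimes\mathfrak{B}(\overline V)\to\mathfrak{D}$. $\mathfrak{D}^{\geq0}$ is the subalgebra generated by $\mathfrak{D}(G)$ and $\overline V$. $\mathfrak{D}(G)$ acts on $\mathfrak{B}(V)$ by the adjoint action in $\mathfrak{D}$, $\mathrm{ad}(h)x=h_{(1)}x\mathcal{S}(h_{(2)})$.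 Simple $\mathfrak{D}(G)$-modules: for $g\in G$ with centralizer $\mathcal{C}_g$ and an irreducible representation $(U,\varrho)$ of $\mathcal{C}_g$, $M(g,\varrho)=\Bbbk G\otimes_{\Bbbk\mathcal{C}_g}U$ with $f\cdot(x\otimes u)=\langle f,xgx^{-1}\rangle x\otimes u$ for $f\in\Bbbk^G$; every simple $\mathfrak{D}(G)$-module has this form. A $\mathfrak{D}(G)$-module is of weight $(g,\varrho)$ if it is isomorphic to $M(g,\varrho)$. $M(g,\varrho)$ is a $\mathfrak{D}^{\geq 0}$-module with $\overline V$ acting by zero. The Verma module is $\mathsf{M}(g,\varrho)=\mathfrak{D}\otimes_{\mathfrak{D}^{\geq 0}}M(g,\varrho)$; it has a unique maximal $\mathfrak{D}$-submodule, and $\mathsf{L}(g,\varrho)$ denotes the corresponding simple quotient (the head). A $\mathfrak{D}$-module $N$ is a highest-weight module of weight $(g,\varrho)$ if it is generated as a $\mathfrak{D}$-module by a simple $\mathfrak{D}(G)$-submodule $M\subseteq N$ of weight $(g,\varrho)$ with $\overline V M=0$. *)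

(* Defs.v *)
From HB Require Import structures.
From mathcomp Require Import all_boot all_order all_algebra.
From mathcomp Require Import all_fingroup all_solvable all_field all_character.
From Stdlib Require Import Classical ClassicalEpsilon.

Set Implicit Arguments.
Unset Strict Implicit.
Unset Printing Implicit Defensive.

Import GRing.Theory.
Local Open Scope ring_scope.

(* All spaces are finite-dimensional (vectType).  The structures hopf_data and
   operators below carry operations without laws: they are only used for
   explicit constructions (group algebra, bosonization, dual, double and their
   modules) for which the laws are consequences.  The objects over which the
   theory quantifies (yd_struct, nichols_algebra) do carry their axioms. *)

Section LinearAlgebra.
Variable k : fieldType.

Definition meets_to (W : vectType k) (C : {vspace W} -> Prop)
    (U : {vspace W}) : Prop :=
  forall x, x \in U <-> (forall X : {vspace W}, C X -> x \in X).

(* The intersection of all subspaces satisfying C (see bigmeetP). *)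
Definition bigmeet (W : vectType k) (C : {vspace W} -> Prop) : {vspace W} :=
  epsilon (inhabits fullv) (meets_to C).

Lemma meets_to_ex (W : vectType k) (C : {vspace W} -> Prop) :
  exists U, meets_to C U.
Proof.
pose I (U : {vspace W}) := exists2 s : seq {vspace W},
  (forall X, X \in s -> C X) & U = (\bigcap_(X <- s) X)%VS.
have I0 : I fullv by exists [::] => //; rewrite big_nil.
have H m : forall U, I U -> (\dim U < m)%N -> exists U, meets_to C U.
  2: exact: H I0 (leqnn _).
elim: m => // m IHm U IU; rewrite ltnS => dU.
case: (classic (forall X, C X -> (U <= X)%VS)) => [leU|].
  exists U => x; split=> [xU X CX | h]; first exact: (subvP (leU X CX)).
  case: IU => s Cs ->; elim: s Cs => [|Y s IHs] Cs.
    by rewrite big_nil memvf.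
  rewrite big_cons memv_cap h /=; last by apply: Cs; rewrite mem_head.
  by apply: IHs => X Xs; apply: Cs; rewrite inE Xs orbT.
move=> /not_all_ex_not nle; case: nle => X nle.
have [CX /negP nUX] := imply_to_and _ _ nle.
apply: (IHm (X :&: U)%VS); last first.
  apply: leq_trans dU; rewrite ltnNge; apply: contra nUX => dle.
  have <- : (X :&: U)%VS = U; last by apply: capvSl.
  by apply/eqP; rewrite eqEdim capvSr.
case: IU => s Cs ->; exists (X :: s); last by rewrite big_cons.
by move=> Y; rewrite inE => /orP[/eqP-> //|]; apply: Cs.
Qed.

Lemma bigmeetP (W : vectType k) (C : {vspace W} -> Prop) x :
  x \in bigmeet C <-> (forall X : {vspace W}, C X -> x \in X).
Proof. exact: (epsilon_spec (inhabits fullv) _ (meets_to_ex C)). Qed.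

Definition spanned (W : vectType k) (P : W -> Prop) : {vspace W} :=
  bigmeet (fun U => forall w, P w -> w \in U).

(* U (x) W, realized as matrices in the coordinates given by the canonical bases
   of U and W (see tlift_pure for the universal property). *)
Definition tens (U W : vectType k) : vectType k :=
  'M[k]_(\dim {:U}, \dim {:W}).

Definition ccoord (U : vectType k) (i : 'I_(\dim {:U})) (u : U) : k :=
  coord (vbasis fullv) i u.

Definition cbasis (U : vectType k) (i : 'I_(\dim {:U})) : U :=
  (vbasis fullv)`_i.

Definition tpure (U W : vectType k) (u : U) (w : W) : tens U W :=
  \matrix_(i, j) (ccoord i u * ccoord j w).

(* The linear map on U (x) W induced by a bilinear map F. *)
Definition tlift (U W X : vectType k) (F : U -> W -> X) (t : tens U W) : X :=
  \sum_i \sum_j t i j *: F (cbasis i) (cbasis j).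

Lemma tlift_pure (U W X : vectType k) (F : U -> W -> X) u w :
  (forall w, linear (F^~ w)) -> (forall u, linear (F u)) ->
  tlift F (tpure u w) = F u w.
Proof.
move=> lF1 lF2.
pose L1 b := GRing.isLinear.Build k U X *:%R (F^~ b) (lF1 b).
pose L2 a := GRing.isLinear.Build k W X *:%R (F a) (lF2 a).
pose F1 b : {linear U -> X} := HB.pack (F^~ b) (L1 b).
pose F2 a : {linear W -> X} := HB.pack (F a) (L2 a).
have dec (Z : vectType k) (z : Z) : z = \sum_i ccoord i z *: cbasis i.
  exact: coord_vbasis (memvf z).
rewrite [in RHS](dec _ u) -[F _ w]/(F1 w _) linear_sum /tlift.
apply: eq_bigr => i _; rewrite linearZ /= [in RHS](dec _ w).
rewrite -[F (cbasis i) _]/(F2 (cbasis i) _) linear_sum scaler_sumr.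
apply: eq_bigr => j _; rewrite linearZ /= scalerA; congr (_ *: _).
by rewrite mxE.
Qed.

Lemma tlift_is_linear (U W X : vectType k) (F : U -> W -> X) :
  linear (tlift F).
Proof.
move=> a s t; rewrite /tlift scaler_sumr -big_split; apply: eq_bigr => i _.
rewrite scaler_sumr -big_split; apply: eq_bigr => j _ /=.
by rewrite !mxE scalerDl scalerA.
Qed.

Lemma tpure_linl (U W : vectType k) (w : W) : linear (fun u : U => tpure u w).
Proof.
by move=> a u v; apply/matrixP=> i j; rewrite !mxE /ccoord linearP mulrDl mulrA.
Qed.

Lemma tpure_linr (U W : vectType k) (u : U) : linear (@tpure U W u).
Proof.
by move=> a v w; apply/matrixP=> i j; rewrite !mxE /ccoord linearP mulrDr mulrCA.
Qed.

Lemma tens_pureE (U W : vectType k) (t : tens U W) : t = tlift (@tpure U W) t.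
Proof.
apply/matrixP=> i j; rewrite /tlift summxE (bigD1 i) //= summxE (bigD1 j) //=.
have cE (Z : vectType k) (a b : 'I_(\dim {:Z})) :
    ccoord a (cbasis b) = (a == b)%:R.
  by rewrite /ccoord /cbasis coord_free ?(basis_free (vbasisP _)) // eq_sym.
rewrite !mxE !cE !eqxx !mulr1 !big1 ?addr0 // => [a nai | b nbj].
  by rewrite summxE big1 // => b _; rewrite !mxE !cE eq_sym (negPf nai) mul0r mulr0.
by rewrite !mxE !cE [j == b]eq_sym (negPf nbj) !mulr0.
Qed.

Definition tensv (U W : vectType k) (A : {vspace U}) (B : {vspace W}) :
    {vspace tens U W} :=
  spanned (fun t => exists a b, [/\ a \in A, b \in B & t = tpure a b]).

Definition dualv (U : vectType k) : vectType k := 'Hom(U, k^o).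

(* The functional given by a formula which is linear in its argument. *)
Definition functional (U : vectType k) (f : U -> k) : dualv U :=
  linfun (f : U -> k^o).

Lemma functionalE (U : vectType k) (f : U -> k) :
  linear (f : U -> k^o) -> forall u, functional f u = f u.
Proof.
move=> lf u; pose L := GRing.isLinear.Build k U k^o *:%R (f : U -> k^o) lf.
exact: (lfunE (HB.pack (f : U -> k^o) L : {linear U -> k^o})).
Qed.

Definition dual_cbasis (U : vectType k) (i : 'I_(\dim {:U})) : dualv U :=
  functional (ccoord i).

(* W / R, realized on the chosen complement R^C of R. *)
Definition quotv (W : vectType k) (R : {vspace W}) : vectType k :=
  subvs_of (R^C)%VS.

Definition qproj (W : vectType k) (R : {vspace W}) (w : W) : quotv R :=
  vsproj (R^C)%VS (w - projv R w).

Lemma qproj_linear (W : vectType k) (R : {vspace W}) : linear (qproj R).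
Proof.
move=> a u v; rewrite /qproj -linearP /=; congr (vsproj _ _).
by rewrite linearP scalerBr opprD addrACA.
Qed.

Lemma qproj_eq0 (W : vectType k) (R : {vspace W}) w :
  (qproj R w == 0) = (w \in R).
Proof.
apply/eqP/idP => [h | wR]; last by rewrite /qproj projv_id // subrr linear0.
have := vsprojK (memv_projC R w); rewrite -/(qproj R w) h linear0.
by move/esym/subr0_eq ->; apply: memv_proj.
Qed.

Lemma qproj_surj (W : vectType k) (R : {vspace W}) (q : quotv R) :
  exists w, qproj R w = q.
Proof.
exists (vsval q); rewrite /qproj.
suff -> : projv R (vsval q) = 0 by rewrite subr0 vsvalK.
have : projv R (vsval q) \in (R :&: R^C)%VS.
  rewrite memv_cap memv_proj /=.
  have -> : projv R (vsval q) = vsval q - (vsval q - projv R (vsval q)).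
    by rewrite opprB addrC subrK.
  by rewrite rpredB ?subvsP ?memv_projC.
by rewrite capv_compl memv0 => /eqP.
Qed.

End LinearAlgebra.

Section Hopf.
Variable k : fieldType.

Record hopf_data := HopfData {
  hsort :> vectType k;
  hmul : hsort -> hsort -> hsort;
  hone : hsort;
  hcop : hsort -> tens hsort hsort;
  hcou : hsort -> k;
  hant : hsort -> hsort }.

(* Sweedler notation: sw2 x F = F x_(1) x_(2) and sw3 x F = F x_(1) x_(2) x_(3)
   for multilinear F. *)
Definition sw2 (H : hopf_data) (X : vectType k) (x : H) (F : H -> H -> X) : X :=
  tlift F (hcop x).

Definition sw3 (H : hopf_data) (X : vectType k) (x : H)
    (F : H -> H -> H -> X) : X :=
  sw2 x (fun x1 x23 => sw2 x23 (fun x2 x3 => F x1 x2 x3)).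

Definition hantV (H : hopf_data) (x : H) : H :=
  ((linfun (@hant H))^-1)%VF x.

Definition dual_hopf (H : hopf_data) : hopf_data :=
  @HopfData (dualv H)
    (fun f f' => functional (fun x : H => sw2 x (fun a b => f a * f' b)))
    (functional (@hcou H))
    (fun f => \sum_i \sum_j f (hmul (cbasis i) (cbasis j))
                *: tpure (dual_cbasis i) (dual_cbasis j))
    (fun f => f (hone H))
    (fun f => functional (fun x : H => f (hant x))).

Definition double_mul (H : hopf_data) (s t : tens H (dualv H)) :
    tens H (dualv H) :=
  tlift (fun (h : H) (f : dual_hopf H) =>
    tlift (fun (h' : H) (f' : dual_hopf H) =>
      sw3 f (fun f1 f2 f3 : dual_hopf H =>
        sw3 h' (fun h1 h2 h3 : H =>
          ((f1 : dualv H) h1 * (f3 : dualv H) (hant h3)) *: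
            tpure (hmul h h2) (hmul f' f2 : dualv H)))) t) s.

(* The antipode is forced by H and H^{*op} being Hopf subalgebras:
   S (h f) = S (f) S (h), where the antipode of H^{*op} is f |-> f \o S^{-1}. *)
Definition drinfeld_double (H : hopf_data) : hopf_data :=
  @HopfData (tens H (dualv H))
    (@double_mul H)
    (tpure (hone H) (hone (dual_hopf H)))
    (tlift (fun (h : H) (f : dual_hopf H) =>
      sw2 h (fun h1 h2 : H => sw2 f (fun f1 f2 : dual_hopf H =>
        tpure (tpure h1 (f1 : dualv H)) (tpure h2 (f2 : dualv H))))))
    (fun t => tlift (fun (h : H) (f : dual_hopf H) => hcou h * hcou f : k^o) t)
    (tlift (fun (h : H) (f : dualv H) =>
      double_mul (tpure (hone H) (functional (fun x => f (hantV x))))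
                 (tpure (hant h) (hone (dual_hopf H))))).

Definition gen_subalgebra (H : hopf_data) (P : H -> Prop) : {vspace H} :=
  bigmeet (fun U => [/\ hone H \in U,
    forall a b, a \in U -> b \in U -> hmul a b \in U &
    forall a, P a -> a \in U]).

End Hopf.

Section Modules.
Variables (k : fieldType) (A : hopf_data k).

Record operators := Operators {
  msort :> vectType k;
  mact : A -> msort -> msort }.

Definition submodule (M : operators) (U : {vspace M}) : Prop :=
  forall a u, u \in U -> mact a u \in U.

Definition simple_submodule (M : operators) (U : {vspace M}) : Prop :=
  [/\ submodule U, U != 0%VS &
      forall X : {vspace M}, submodule X -> (X <= U)%VS -> X = 0%VS \/ X = U].

Definition maximal_submodule (M : operators) (U : {vspace M}) : Prop :=
  [/\ submodule U, U != fullv &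
      forall X : {vspace M}, submodule X -> (U <= X)%VS -> X = U \/ X = fullv].

Definition gen_submodule (M : operators) (U : {vspace M}) : {vspace M} :=
  bigmeet (fun X => submodule X /\ (U <= X)%VS).

(* The sum of all simple submodules. *)
Definition socle (M : operators) : {vspace M} :=
  bigmeet (fun X => forall U, simple_submodule U -> (U <= X)%VS).

(* The intersection of all maximal submodules; it is the maximal submodule when
   there is only one. *)
Definition radical (M : operators) : {vspace M} :=
  bigmeet (@maximal_submodule M).

Definition sub_mod (M : operators) (U : {vspace M}) : operators :=
  @Operators (subvs_of U) (fun a u => vsproj U (mact a (vsval u))).

Definition quot_mod (M : operators) (R : {vspace M}) : operators :=
  @Operators (quotv R) (fun a u => qproj R (mact a (vsval u))).

Definition head_mod (M : operators) : operators := quot_mod (radical M).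

Definition dual_mod (M : operators) : operators :=
  @Operators (dualv M)
    (fun a f => functional (fun m => f (mact (hant a) m))).

Definition tens_mod (M N : operators) : operators :=
  @Operators (tens M N)
    (fun a => tlift (fun (m : M) (n : N) =>
       sw2 a (fun a1 a2 => tpure (mact a1 m) (mact a2 n)))).

Definition mod_iso (M N : operators) : Prop :=
  exists f : 'Hom(M, N),
    [/\ lker f = 0%VS, limg f = fullv & forall a m, f (mact a m) = mact a (f m)].

End Modules.

Definition restrict (k : fieldType) (A A' : hopf_data k) (j : A' -> A)
    (M : operators A) : operators A' :=
  @Operators k A' M (fun a => mact (j a)).

Section GroupAlgebra.
Variables (k : fieldType) (gT : finGroupType).

(* w # g, supported at g. *)
Definition at_grp (W : vectType k) (w : W) (g : gT) : {ffun gT -> W} :=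
  [ffun x => if x == g then w else 0].

Definition grp (g : gT) : {ffun gT -> k^o} := at_grp (1 : k^o) g.

Definition group_hopf : hopf_data k :=
  @HopfData k ({ffun gT -> k^o} : vectType k)
    (fun a b => \sum_x \sum_y (a x * b y : k) *: grp (x * y)%g)
    (grp 1%g)
    (fun a => \sum_x (a x : k) *: tpure (grp x) (grp x))
    (fun a => \sum_x a x)
    (fun a => \sum_x (a x : k) *: grp x^-1%g).

Definition dbl_group : hopf_data k := drinfeld_double group_hopf.

(* The coaction v |-> v_(-1) (x) v_(0) is encoded by its components:
   v |-> \sum_g g (x) yd_co g v. *)
Record yd_struct (W : vectType k) := YDStruct {
  yd_act : gT -> 'End(W);
  yd_co : gT -> 'End(W);
  yd_act1 : forall w, yd_act 1%g w = w;
  yd_actM : forall g h w, yd_act (g * h)%g w = yd_act g (yd_act h w);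
  yd_coassoc : forall g h w,
    yd_co g (yd_co h w) = if g == h then yd_co h w else 0;
  yd_counit : forall w, \sum_g yd_co g w = w;
  yd_compat : forall g h w,
    yd_act g (yd_co h w) = yd_co (g * h * g^-1)%g (yd_act g w) }.

(* N is the Nichols algebra of V: a graded connected braided Hopf algebra in the
   category of Yetter-Drinfeld modules whose degree-one part is V, coincides
   with the space of primitive elements and generates N. *)
Record nichols_algebra (V : vectType k) (Y : yd_struct V) := NicholsAlgebra {
  nsort :> falgType k;
  nyd : yd_struct nsort;
  ngr : nat -> {vspace nsort};
  ncop : 'Hom(nsort, tens nsort nsort);
  ncou : 'Hom(nsort, k^o);
  nant : 'End(nsort);
  nincl : 'Hom(V, nsort);
  nact_one : forall g, yd_act nyd g 1 = 1;
  nact_mul : forall g a b,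
    yd_act nyd g (a * b) = yd_act nyd g a * yd_act nyd g b;
  nco_one : forall g, yd_co nyd g 1 = if g == 1%g then 1 else 0;
  nco_mul : forall g a b,
    yd_co nyd g (a * b) = \sum_h yd_co nyd h a * yd_co nyd (h^-1 * g)%g b;
  nact_cop : forall g a, ncop (yd_act nyd g a) =
    tlift (fun b c => tpure (yd_act nyd g b) (yd_act nyd g c)) (ncop a);
  nco_cop : forall g a, ncop (yd_co nyd g a) =
    tlift (fun b c =>
      \sum_h tpure (yd_co nyd h b) (yd_co nyd (h^-1 * g)%g c)) (ncop a);
  nact_cou : forall g a, ncou (yd_act nyd g a) = ncou a;
  nco_cou : forall g a, ncou (yd_co nyd g a) = if g == 1%g then ncou a else 0;
  nact_ant : forall g a, nant (yd_act nyd g a) = yd_act nyd g (nant a);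
  nco_ant : forall g a, nant (yd_co nyd g a) = yd_co nyd g (nant a);
  (* coalgebra; coassociativity is stated in N (x) (N (x) N) *)
  ncoassoc : forall a,
    tlift (fun b c => tlift (fun x y => tpure x (tpure y c)) (ncop b)) (ncop a) =
    tlift (fun b c => tlift (fun y z => tpure b (tpure y z)) (ncop c)) (ncop a);
  ncou_l : forall a, tlift (fun b c => (ncou b : k) *: c) (ncop a) = a;
  ncou_r : forall a, tlift (fun b c => (ncou c : k) *: b) (ncop a) = a;
  (* bialgebra, for the product (a (x) b)(c (x) d) = a (b_(-1).c) (x) b_(0) d *)
  ncop_one : ncop 1 = tpure 1 1;
  ncop_mul : forall a b, ncop (a * b) =
    tlift (fun a1 a2 => tlift (fun b1 b2 =>
      \sum_h tpure (a1 * yd_act nyd h b1) (yd_co nyd h a2 * b2))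
      (ncop b)) (ncop a);
  ncou_one : ncou 1 = 1;
  ncou_mul : forall a b, ncou (a * b) = ncou a * ncou b;
  nant_l : forall a, tlift (fun b c => nant b * c) (ncop a) = (ncou a : k) *: 1;
  nant_r : forall a, tlift (fun b c => b * nant c) (ncop a) = (ncou a : k) *: 1;
  ngr_sum : exists m, [/\ forall n, (m <= n)%N -> ngr n = 0%VS,
    directv (\sum_(n < m) ngr n) & (\sum_(n < m) ngr n)%VS = fullv];
  ngr_act : forall n g a, a \in ngr n -> yd_act nyd g a \in ngr n;
  ngr_co : forall n g a, a \in ngr n -> yd_co nyd g a \in ngr n;
  ngr_mul : forall m n a b, a \in ngr m -> b \in ngr n -> a * b \in ngr (m + n)%N;
  ngr_cop : forall n a, a \in ngr n ->
    ncop a \in (\sum_(i < n.+1) tensv (ngr i) (ngr (n - i)%N))%VS;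
  ngr0 : ngr 0 = 1%VS;
  nincl_inj : lker nincl = 0%VS;
  nincl_img : limg nincl = ngr 1;
  nincl_act : forall g v, nincl (yd_act Y g v) = yd_act nyd g (nincl v);
  nincl_co : forall g v, nincl (yd_co Y g v) = yd_co nyd g (nincl v);
  nprimitive : forall a, a \in ngr 1 <-> ncop a = tpure a 1 + tpure 1 a;
  ngenerated : agenv (ngr 1) = fullv }.

(* M(g, rho) = kG (x)_{k C_g} U, where U is the left module of column vectors
   and at_grp u x stands for x (x) u. *)
Section SimpleModules.
Variables (g : gT) (n : nat) (rho : mx_representation k 'C[g]%G n).

Definition ind_relations : {vspace {ffun gT -> 'cV[k]_n}} :=
  spanned (fun w => exists x c u, c \in 'C[g]%g /\
    w = at_grp u (x * c)%g - at_grp (rho c *m u) x).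

(* (h f).(x (x) u) = <f, x g x^-1> (h x (x) u) *)
Definition weight_mod : operators dbl_group :=
  @Operators k dbl_group (quotv ind_relations)
    (fun t q => tlift (fun (h : group_hopf) (f : dualv group_hopf) =>
       \sum_y \sum_x (h y * f (grp (x * g * x^-1)%g) : k) *:
         qproj ind_relations (at_grp ((vsval q : {ffun gT -> 'cV[k]_n}) x)
                                     (y * x)%g)) t).

End SimpleModules.

End GroupAlgebra.

Section Double.
Variables (k : fieldType) (gT : finGroupType) (V : vectType k).
Variables (Y : yd_struct gT V) (N : nichols_algebra Y).

Let act := yd_act (nyd N).
Let co := yd_co (nyd N).

Definition bos_mul (a b : {ffun gT -> N}) : {ffun gT -> N} :=
  \sum_x \sum_y at_grp (a x * act x (b y)) (x * y)%g.

(* The bosonization N # kG, with b # g encoded as at_grp b g: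
   Delta (b # g) = b^(1) # (b^(2))_(-1) g (x) (b^(2))_(0) # g,
   S (b # g) = (1 # (b_(-1) g)^-1) (S b_(0) # 1). *)
Definition bosonization : hopf_data k :=
  @HopfData k ({ffun gT -> N} : vectType k)
    bos_mul
    (at_grp 1 1%g)
    (fun a => \sum_x tlift (fun b c : N =>
       \sum_h tpure (at_grp b (h * x)%g) (at_grp (co h c) x)) (ncop N (a x)))
    (fun a => \sum_x ncou N (a x))
    (fun a => \sum_x \sum_h
       bos_mul (at_grp 1 (h * x)^-1%g) (at_grp (nant N (co h (a x))) 1%g)).

Definition dbl : hopf_data k := drinfeld_double bosonization.

Definition from_bos (a : bosonization) : dbl :=
  tpure a (hone (dual_hopf bosonization)).

Definition from_dual (f : dualv bosonization) : dbl :=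
  tpure (hone bosonization) f.

(* The Hopf inclusion of D(G): on kG it is g |-> 1 # g and on k^G it extends f
   by <f, b # g> = eps(b) <f, g>, which vanishes for b in positive degree. *)
Definition from_dbl_group : dbl_group k gT -> dbl :=
  tlift (fun (h : group_hopf k gT) (f : dualv (group_hopf k gT)) =>
    tpure (\sum_x (h x : k) *: at_grp (1 : N) x : bosonization)
      (functional (fun a : bosonization =>
         \sum_x (ncou N (a x) : k) * f (grp k x)))).

(* The elements of the copy of V^* = \overline V in (N # kG)^*. *)
Definition in_Vbar (f : dualv bosonization) : Prop :=
  exists y : dualv V,
    (forall x g, f (at_grp (nincl N x) g : bosonization) = y x) /\
    (forall n b g, n <> 1%N -> b \in ngr N n ->
       f (at_grp b g : bosonization) = 0).

Definition dbl_ge0 : {vspace dbl} :=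
  gen_subalgebra (fun d => (exists t, d = from_dbl_group t) \/
                           (exists2 f, in_Vbar f & d = from_dual f)).

(* On dbl_ge0 = kG (x) (N # kG)^*, this is the algebra map onto D(G) that is the
   identity on D(G) and kills \overline V (from_dbl_groupK, dbl_ge0_proj_Vbar);
   on functionals it is the restriction to kG.  Only its values on dbl_ge0 are
   used. *)
Definition dbl_ge0_proj : dbl -> dbl_group k gT :=
  tlift (fun (a : bosonization) (f : dualv bosonization) =>
    tpure ([ffun x => ncou N ((a : {ffun gT -> N}) x)] : group_hopf k gT)
      (functional (fun h : group_hopf k gT =>
         f (\sum_x (h x : k) *: at_grp (1 : N) x : bosonization)))).

Lemma grp_incl_linear :
  linear (fun h : group_hopf k gT =>
    \sum_x (h x : k) *: at_grp (1 : N) x : bosonization).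
Proof.
move=> c u v; rewrite scaler_sumr -big_split; apply: eq_bigr => x _ /=.
by rewrite !ffunE scalerDl scalerA.
Qed.

Lemma sum_at_grpE (W : vectType k) (c : gT -> k) (w : W) x :
  (\sum_y c y *: at_grp w y) x = c x *: w.
Proof.
rewrite sum_ffunE (bigD1 x) //= big1 ?addr0 => [|y nyx]; rewrite !ffunE.
  by rewrite eqxx.
by rewrite eq_sym (negPf nyx) scaler0.
Qed.

Lemma cou_linear :
  linear (fun a : bosonization =>
    [ffun x => ncou N ((a : {ffun gT -> N}) x)] : group_hopf k gT).
Proof. by move=> c u v; apply/ffunP=> x; rewrite !ffunE linearP. Qed.

Lemma restrict_functionalE (f : dualv bosonization) (h : group_hopf k gT) :
  functional (fun h : group_hopf k gT =>
       f (\sum_x (h x : k) *: at_grp (1 : N) x : bosonization)) h =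
  f (\sum_x (h x : k) *: at_grp (1 : N) x : bosonization).
Proof. by rewrite functionalE // => c u v; rewrite grp_incl_linear linearP. Qed.

Lemma dbl_ge0_proj_pure (a : bosonization) (f : dualv bosonization) :
  dbl_ge0_proj (tpure a f) =
  tpure ([ffun x => ncou N ((a : {ffun gT -> N}) x)] : group_hopf k gT)
    (functional (fun h : group_hopf k gT =>
       f (\sum_x (h x : k) *: at_grp (1 : N) x : bosonization))).
Proof.
apply: tlift_pure => [f' c u v | b c u v].
  by rewrite cou_linear tpure_linl.
rewrite -tpure_linr; congr (tpure _ _); apply/lfunP=> h.
by rewrite restrict_functionalE !lfunE /= !lfunE /= !restrict_functionalE.
Qed.

Lemma from_dbl_groupK : cancel from_dbl_group dbl_ge0_proj.
Proof.
have linproj := @tlift_is_linear k _ _ _ _ : linear dbl_ge0_proj.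
pose L := GRing.isLinear.Build k _ _ *:%R dbl_ge0_proj linproj.
pose P : {linear dbl -> dbl_group k gT} := HB.pack dbl_ge0_proj L.
move=> t; rewrite -[dbl_ge0_proj _]/(P _) [in RHS](tens_pureE t) /tlift.
rewrite linear_sum; apply: eq_bigr => i _.
rewrite linear_sum; apply: eq_bigr => j _; rewrite linearZ; congr (_ *: _).
rewrite -[P _]/(dbl_ge0_proj _) dbl_ge0_proj_pure; congr (tpure _ _).
  apply/ffunP=> x; rewrite ffunE sum_at_grpE linearZ /= ncou_one.
  by rewrite /GRing.scale /= mulr1.
apply/lfunP=> h; rewrite restrict_functionalE functionalE; last first.
  move=> c u v; rewrite scaler_sumr -big_split; apply: eq_bigr => x _ /=.
  rewrite !ffunE linearP /= mulrDl; congr (_ + _).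
  exact: esym (mulrA _ _ _).
have {2}-> : h = \sum_x (h x : k) *: grp k x.
  by apply/ffunP=> x; rewrite sum_at_grpE /GRing.scale /= mulr1.
rewrite linear_sum; apply: eq_bigr => x _; rewrite linearZ /= sum_at_grpE.
by rewrite linearZ /= ncou_one /GRing.scale /= mulr1.
Qed.

Lemma dbl_ge0_proj_Vbar f : in_Vbar f -> dbl_ge0_proj (from_dual f) = 0.
Proof.
case=> y [_ f0]; rewrite dbl_ge0_proj_pure.
rewrite (_ : functional _ = 0); last first.
  apply/lfunP=> h; rewrite restrict_functionalE linear_sum big1 ?lfunE //= => x _.
  rewrite linearZ /= (f0 0%N) ?scaler0 // ngr0.
  exact: memv_line.
by apply/matrixP=> i j; rewrite !mxE /ccoord linear0 mulr0.
Qed.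

Section Verma.
(* M is extended to dbl_ge0 with \overline V acting by zero. *)
Variable M : operators (dbl_group k gT).

Definition verma_relations : {vspace tens dbl M} :=
  spanned (fun w => exists d a m, a \in dbl_ge0 /\
    w = tpure (hmul d a) m - tpure d (mact (dbl_ge0_proj a) m)).

Definition verma : operators dbl :=
  @Operators k dbl (quotv verma_relations)
    (fun d q => qproj verma_relations
       (tlift (fun (d' : dbl) (m : M) => tpure (hmul d d') m) (vsval q))).

End Verma.

(* D(G) acting on the double by ad(h) x = h_(1) x S(h_(2)), and its restriction
   to the copy of the degree-n part of N. *)
Definition adjoint_mod : operators (dbl_group k gT) :=
  @Operators k (dbl_group k gT) dbl
    (fun h x => sw2 h (fun h1 h2 : dbl_group k gT =>
       hmul (hmul (from_dbl_group h1) x) (from_dbl_group (hant h2)))).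

Definition nichols_part (n : nat) : {vspace adjoint_mod} :=
  spanned (fun x : adjoint_mod => exists2 b, b \in ngr N n &
    x = from_bos (at_grp b 1%g)).

Definition nichols_mod (n : nat) : operators (dbl_group k gT) :=
  sub_mod (nichols_part n).

Definition max_degree (n : nat) : Prop :=
  ngr N n <> 0%VS /\ forall m, (n < m)%N -> ngr N m = 0%VS.

(* The weight (g, rho) enters through M = weight_mod rho. *)
Definition highest_weight (L : operators dbl)
    (M : operators (dbl_group k gT)) : Prop :=
  exists U : {vspace restrict from_dbl_group L},
    [/\ simple_submodule U, mod_iso (sub_mod U) M,
        forall f u, in_Vbar f -> u \in U -> @mact k dbl L (from_dual f) u = 0 &
        @gen_submodule k dbl L U = fullv].

End Double.

(* Main.v *)
(* As a graded vector space the Verma module of M is B(V) (x) M.  An element of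
   B(V) annihilated on the left by all positive degrees lies in degree ntop,
   because it yields a left integral of B(V) # kG and integrals are unique up to a
   scalar.  Hence every nonzero submodule meets, and so contains, the simple
   D(G)-module T = B^ntop(V) (x) M, and the socle S is the simple module generated
   by T.  Since the antipode of the double is bijective, S^* is simple.  The
   functionals on S that vanish below degree ntop form a copy of T^*, killed by
   \overline V because \overline V lowers degrees; this gives the highest weight.
   It induces a surjection from the Verma module of T^* onto S^*, and its kernel is
   the only maximal submodule, since a submodule with a nonzero component in degree
   zero is everything.

   The Nichols algebra enters through primitive elements: as they all have degree
   one, the dual of B(V) # kG is generated by \overline V and k^G, so the
   nonnegative part of the double is kG (x) (B(V) # kG)^*. *)
From HB Require Import structures.
From mathcomp Require Import all_boot all_order all_algebra.
From mathcomp Require Import all_fingroup all_solvable all_field all_character.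
From Stdlib Require Import Classical ClassicalEpsilon.
(* After mathcomp, which also has an mact. *)
Require Import Defs.

Set Implicit Arguments.
Unset Strict Implicit.
Unset Printing Implicit Defensive.

Import GRing.Theory.
Local Open Scope ring_scope.

(** * Linear maps and tensors *)

(** Write H for B(V) # kG. The Verma module is a quotient by relations indexed by [dbl_ge0], a
    subalgebra known only by generators, so its size has to be found. That [dbl_ge0] contains every
    functional on H makes the vectors b (x) m span; that its elements, viewed as endomorphisms of H,
    take values in kG makes an inverse of b (x) m |-> [ve b m] well defined. The first inclusion is
    obtained by duality. A proper subalgebra of the dual of H containing the generators would
    annihilate a nonzero element of H; hits by degree-one functionals reduce it to a nonzero
    multiple of a group element, which k^G does not annihilate. Uniqueness of integrals is applied
    with a surjective antipode of H. Surjectivity is checked on generators: for v of degree one and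
    coaction degree h, S(v) = - h^-1 v. Submodules of the Verma module are not known to be graded.
    The arguments follow the lowest nonzero component of a vector and control the higher ones by
    induction on the degree. Dual modules act through the antipode of the double, which is therefore
    shown to preserve degrees and to restrict to that of D(G). *)

Section Linear.
Variable k : fieldType.

(* A constant, unlike linear, so that hypotheses lin f can be matched by slin. *)
Definition lin (U W : lmodType k) (f : U -> W) : Prop := linear f.

Definition bil (U W X : lmodType k) (F : U -> W -> X) : Prop :=
  (forall w, lin (F^~ w)) /\ (forall u, lin (F u)).

Definition tril (U W X Z : lmodType k) (F : U -> W -> X -> Z) : Prop :=
  (forall w x, lin (fun u => F u w x)) /\ (forall u x, lin (fun w => F u w x)) /\
  (forall u w, lin (F u w)).

Section LinLmod.
Variables U W X Z : lmodType k.

Lemma lin_id : lin (fun x : U => x). Proof. by []. Qed.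

Lemma lin_comp (f : W -> X) (g : U -> W) :
  lin f -> lin g -> lin (fun x => f (g x)).
Proof. by move=> lf lg a u v; rewrite lg lf. Qed.

Lemma bil_l (F : W -> X -> Z) (g : U -> W) c :
  bil F -> lin g -> lin (fun x => F (g x) c).
Proof. by move=> [lF _] lg a u v; rewrite lg lF. Qed.

Lemma bil_r (F : W -> X -> Z) (g : U -> X) c :
  bil F -> lin g -> lin (fun x => F c (g x)).
Proof. by move=> [_ lF] lg a u v; rewrite lg lF. Qed.

Lemma tril_1 (Z' : lmodType k) (F : W -> X -> Z -> Z') (g : U -> W) b c :
  tril F -> lin g -> lin (fun x => F (g x) b c).
Proof. by move=> [lF _] lg a u v; rewrite lg lF. Qed.

Lemma tril_2 (Z' : lmodType k) (F : W -> X -> Z -> Z') (g : U -> X) b c :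
  tril F -> lin g -> lin (fun x => F b (g x) c).
Proof. by move=> [_ [lF _]] lg a u v; rewrite lg lF. Qed.

Lemma tril_3 (Z' : lmodType k) (F : W -> X -> Z -> Z') (g : U -> Z) b c :
  tril F -> lin g -> lin (fun x => F b c (g x)).
Proof. by move=> [_ [_ lF]] lg a u v; rewrite lg lF. Qed.

Lemma lin_add (f g : U -> W) : lin f -> lin g -> lin (fun x => f x + g x).
Proof. by move=> lf lg a u v; rewrite lf lg scalerDr addrACA. Qed.

Lemma lin_opp (f : U -> W) : lin f -> lin (fun x => - f x).
Proof. by move=> lf a u v; rewrite lf opprD scalerN. Qed.

Lemma lin_zero : lin (fun _ : U => 0 : W).
Proof. by move=> a u v; rewrite scaler0 addr0. Qed.

Lemma lin_scale c (f : U -> W) : lin f -> lin (fun x => c *: f x).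
Proof. by move=> lf a u v; rewrite lf scalerDr !scalerA mulrC. Qed.

Lemma lin_scalel (f : U -> k^o) (w : W) : lin f -> lin (fun x => (f x : k) *: w).
Proof. by move=> lf a u v; rewrite lf scalerDl scalerA. Qed.

Lemma lin_sum (I : Type) (r : seq I) (P : pred I) (F : I -> U -> W) :
  (forall i, lin (F i)) -> lin (fun x => \sum_(i <- r | P i) F i x).
Proof.
move=> lF a u v; rewrite scaler_sumr -big_split; apply: eq_bigr => i _.
exact: lF.
Qed.

Lemma lin_if (b : bool) (f g : U -> W) :
  lin f -> lin g -> lin (fun x => if b then f x else g x).
Proof. by case: b. Qed.

Lemma lin_linear (f : {linear W -> X}) (g : U -> W) :
  lin g -> lin (fun x => f (g x)).
Proof. by apply: lin_comp => a u v; rewrite linearP. Qed.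

Lemma lin_mulkl (f : U -> k^o) (c : k) : lin f -> lin (fun x => (f x : k) * c : k^o).
Proof. by move=> lf a u v; rewrite lf mulrDl /GRing.scale /= mulrA. Qed.

Lemma lin_mulkr (f : U -> k^o) (c : k) : lin f -> lin (fun x => c * (f x : k) : k^o).
Proof. by move=> lf a u v; rewrite lf mulrDr /GRing.scale /= mulrCA. Qed.

Lemma lin_ffun (I : finType) (i : I) (f : U -> {ffun I -> W}) :
  lin f -> lin (fun x => f x i).
Proof. by move=> lf a u v; rewrite lf !ffunE. Qed.

Lemma lin_finfun (I : finType) (F : I -> U -> W) :
  (forall i, lin (F i)) -> lin (fun x => [ffun i => F i x]).
Proof. by move=> lF a u v; apply/ffunP => i; rewrite !ffunE lF. Qed.

Lemma lin0 (f : U -> W) : lin f -> f 0 = 0.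
Proof. by move=> lf; have := lf (-1) 0 0; rewrite scaler0 addr0 scaleN1r addNr. Qed.

Lemma linD (f : U -> W) : lin f -> forall u v, f (u + v) = f u + f v.
Proof. by move=> lf u v; have := lf 1 u v; rewrite !scale1r. Qed.

Lemma linZ (f : U -> W) : lin f -> forall a u, f (a *: u) = a *: f u.
Proof. by move=> lf a u; have := lf a u 0; rewrite !addr0 (lin0 lf) addr0. Qed.

Lemma linN (f : U -> W) : lin f -> forall u, f (- u) = - f u.
Proof. by move=> lf u; rewrite -scaleN1r linZ // scaleN1r. Qed.

Lemma linB (f : U -> W) : lin f -> forall u v, f (u - v) = f u - f v.
Proof. by move=> lf u v; rewrite linD // linN. Qed.

Lemma lin_bigsum (f : U -> W) : lin f ->
  forall (I : Type) (r : seq I) (P : pred I) F, f (\sum_(i <- r | P i) F i) = \sum_(i <- r | P i) f (F i).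
Proof.
move=> lf I r P F; elim/big_rec2: _ => [|i x y _ <-]; first exact: lin0.
exact: linD.
Qed.

End LinLmod.

Lemma lin_algl (U : lmodType k) (A : algType k) (f : U -> A) c :
  lin f -> lin (fun x => f x * c).
Proof. by move=> lf a u v; rewrite lf mulrDl -scalerAl. Qed.

Lemma lin_algr (U : lmodType k) (A : algType k) (f : U -> A) c :
  lin f -> lin (fun x => c * f x).
Proof. by move=> lf a u v; rewrite lf mulrDr -scalerAr. Qed.

Section LinVect.
Variables U W X : vectType k.

Lemma lin_tlift_arg (Z : lmodType k) (F : U -> W -> X) (t : Z -> tens U W) :
  lin t -> lin (fun z => tlift F (t z)).
Proof. by move=> lt a u v; rewrite lt tlift_is_linear. Qed.

Lemma lin_tlift_fun (Z : lmodType k) (F : Z -> U -> W -> X) (t : tens U W) :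
  (forall u w, lin (fun z => F z u w)) -> lin (fun z => tlift (F z) t).
Proof.
by move=> lF; apply: lin_sum => i; apply: lin_sum => j; apply: lin_scale.
Qed.

Lemma bil_tpure : bil (@tpure k U W).
Proof. by split=> w; [apply: tpure_linl | apply: tpure_linr]. Qed.

Lemma lin_lfunl (Z : lmodType k) (f : Z -> 'Hom(U, W)) u :
  lin f -> lin (fun z => f z u).
Proof. by move=> lf a v w; rewrite lf add_lfunE scale_lfunE. Qed.

Lemma lin_lfun (f : 'Hom(U, W)) : lin f.
Proof. by move=> a u v; rewrite linearP. Qed.

Lemma linfun_lin (f : U -> W) u : lin f -> linfun f u = f u.
Proof.
move=> lf; pose L := GRing.isLinear.Build k U W *:%R f lf.
exact: (lfunE (HB.pack f L : {linear U -> W})).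
Qed.

Lemma functional_lin (f : U -> k) u : lin (f : U -> k^o) -> functional f u = f u.
Proof. by move=> lf; rewrite functionalE. Qed.

End LinVect.

Lemma lin_linfun (Z : lmodType k) (U W : vectType k) (F : Z -> U -> W) :
  (forall u, lin (fun z => F z u)) -> (forall z, lin (F z)) ->
  lin (fun z => linfun (F z)).
Proof.
move=> lF1 lF2 a u v; apply/lfunP => x.
by rewrite add_lfunE scale_lfunE !linfun_lin //; apply: lF1.
Qed.

Lemma lin_functional (Z : lmodType k) (U : vectType k) (F : Z -> U -> k) :
  (forall u, lin (fun z => F z u : k^o)) -> (forall z, lin (F z : U -> k^o)) ->
  lin (fun z => functional (F z)).
Proof. exact: lin_linfun. Qed.

Lemma lin_at_grp (gT : finGroupType) (U : lmodType k) (W : vectType k)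
    (f : U -> W) (x : gT) : lin f -> lin (fun u => at_grp (f u) x).
Proof.
move=> lf a u v; apply/ffunP => y; rewrite !ffunE lf.
by case: (y == x); rewrite ?scaler0 ?addr0.
Qed.

End Linear.

Ltac lin_hyp :=
  match goal with
  | H : bil ?F |- _ => first [apply: (bil_l _ H) | apply: (bil_r _ H)]
  | H : tril ?F |- _ =>
      first [apply: (tril_1 _ _ H) | apply: (tril_2 _ _ H) | apply: (tril_3 _ _ H)]
  | H : lin ?F |- _ => apply: (lin_comp H)
  end.
Ltac lin_base :=
  lazymatch goal with
  | |- lin (fun x => x) => apply: lin_id
  | |- lin (fun x => tlift _ _) => first [apply: lin_tlift_arg | apply: lin_tlift_fun]
  | |- lin (fun x => tpure _ _) =>
      first [apply: (bil_l _ (bil_tpure _ _)) | apply: (bil_r _ (bil_tpure _ _))]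
  | |- lin (fun x => at_grp _ _) => apply: lin_at_grp
  | |- lin (fun x => GRing.add _ _) => apply: lin_add
  | |- lin (fun x => GRing.opp _) => apply: lin_opp
  | |- lin (fun x => GRing.scale _ _) => first [apply: lin_scale | apply: lin_scalel]
  | |- lin (fun x => bigop _ _ _) => apply: lin_sum
  | |- lin (fun x => GRing.mul _ _) =>
      first [apply: lin_mulkl | apply: lin_mulkr | apply: lin_algl | apply: lin_algr]
  | |- lin (fun x => if _ then _ else _) => apply: lin_if
  | |- lin (fun x => functional _) => apply: lin_functional
  | |- lin (fun x => linfun _) => apply: lin_linfun
  | |- lin (fun x => finfun _) => apply: lin_finfun
  | |- lin (fun x => fun_of_lfun _ _) => first [apply: lin_linear | apply: lin_lfunl]
  | |- lin (fun x => fun_of_fin _ _) => apply: lin_ffun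
  | |- lin (fun x => GRing.zero) => apply: lin_zero
  | |- lin (tpure _) => apply: tpure_linr
  | |- lin (GRing.mul ?c) => first [exact (lin_algr c (@lin_id _ _)) | exact (lin_mulkr c (@lin_id _ _))]
  | |- lin (GRing.scale ?c) => exact (lin_scale c (@lin_id _ _))
  | |- lin (tlift _) => apply: tlift_is_linear
  | |- lin (fun_of_lfun _) => apply: lin_lfun
  | |- lin _ => first [apply: lin_linear | apply: lin_ffun]
  end.
(* Redefined below for each new operation. *)
Ltac lin_ext := fail.
Ltac lin_step :=
  first [solve [auto 1 with nocore] | lin_hyp | lin_ext | lin_base].
(** Sweedler notation is multilinear extension, so almost every rewriting step carries linearity
    conditions. They are settled by recursion on the outermost operation of the term; goals of any
    other kind are left over. *)
Ltac slin :=
  lazymatch goal with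
  | |- bil _ => split; slin
  | |- _ /\ _ => split; slin
  | |- tril _ => split; [|split]; slin
  | |- forall _, _ => intro; slin
  | |- lin _ => lin_step; slin
  | |- _ => idtac
  end.

Section Tensor.
Variable k : fieldType.
Implicit Types U W X Z : vectType k.

Lemma tliftp U W X (F : U -> W -> X) u w : bil F -> tlift F (tpure u w) = F u w.
Proof. by case=> lF1 lF2; apply: tlift_pure. Qed.

Lemma lin_tlift U W X Z (g : X -> Z) (F : U -> W -> X) t :
  lin g -> g (tlift F t) = tlift (fun a b => g (F a b)) t.
Proof.
move=> lg; rewrite /tlift (lin_bigsum lg); apply: eq_bigr => i _.
by rewrite (lin_bigsum lg); apply: eq_bigr => j _; rewrite linZ.
Qed.

Lemma tlift_tlift U W X Z X' (G : X -> Z -> X') (F : U -> W -> tens X Z) t :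
  tlift G (tlift F t) = tlift (fun a b => tlift G (F a b)) t.
Proof. by apply: lin_tlift; apply: tlift_is_linear. Qed.

Lemma eq_tlift U W X (F G : U -> W -> X) t :
  (forall a b, F a b = G a b) -> tlift F t = tlift G t.
Proof.
by move=> eFG; rewrite /tlift; apply: eq_bigr => i _; apply: eq_bigr => j _; rewrite eFG.
Qed.

Lemma tlift_bigsum U W X (I : Type) (r : seq I) (P : pred I)
    (F : I -> U -> W -> X) t :
  tlift (fun a b => \sum_(i <- r | P i) F i a b) t =
  \sum_(i <- r | P i) tlift (F i) t.
Proof.
rewrite /tlift [RHS]exchange_big /=; apply: eq_bigr => a _.
rewrite [RHS]exchange_big /=; apply: eq_bigr => b _.
by rewrite scaler_sumr.
Qed.

Lemma tliftZ U W X (F : U -> W -> X) c t :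
  tlift (fun a b => c *: F a b) t = c *: tlift F t.
Proof. by rewrite (lin_tlift (g := fun x => c *: x)) //; slin. Qed.

Lemma tlift_exch U W X Z X' (F : U -> W -> X -> Z -> X') s t :
  tlift (fun a b => tlift (F a b) s) t =
  tlift (fun c d => tlift (fun a b => F a b c d) t) s.
Proof.
transitivity (\sum_i \sum_j
    tlift (fun a b => s i j *: F a b (cbasis i) (cbasis j)) t).
  under eq_bigr => i _ do rewrite -tlift_bigsum.
  by rewrite -tlift_bigsum.
symmetry; rewrite {1}/tlift; apply: eq_bigr => i _; apply: eq_bigr => j _.
by rewrite tliftZ.
Qed.

Lemma tlift_eq0 U W X (F : U -> W -> X) t :
  (forall a b, F a b = 0) -> tlift F t = 0.
Proof.
by move=> F0; rewrite /tlift big1 // => i _; rewrite big1 // => j _; rewrite F0 scaler0.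
Qed.

Lemma tlift_id U W (t : tens U W) : tlift (@tpure k U W) t = t.
Proof. by rewrite -tens_pureE. Qed.

Lemma tens_ext U W (X : lmodType k) (f g : tens U W -> X) :
  lin f -> lin g -> (forall u w, f (tpure u w) = g (tpure u w)) -> f =1 g.
Proof.
move=> lf lg e t; rewrite (tens_pureE t) /tlift.
rewrite (lin_bigsum lf) (lin_bigsum lg); apply: eq_bigr => i _.
rewrite (lin_bigsum lf) (lin_bigsum lg); apply: eq_bigr => j _.
by rewrite (linZ lf) (linZ lg) e.
Qed.

(** Coassociativity is given as one identity in a triple tensor product; the universal property (the
    map [L]) transports it to every trilinear [F]. The coproduct [D] is arbitrary, so the lemma
    serves both Hopf algebras and the braided coproduct of [N]. *)
Lemma tlift_coassoc W X (D : W -> tens W W) (F : W -> W -> W -> X) t :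
  tril F ->
  tlift (fun a b => tlift (fun x y => tpure x (tpure y b)) (D a)) t =
  tlift (fun a b => tlift (fun y z => tpure a (tpure y z)) (D b)) t ->
  tlift (fun a b => tlift (fun x y => F x y b) (D a)) t =
  tlift (fun a b => tlift (F a) (D b)) t.
Proof.
move=> tF; pose L := tlift (fun a : W => tlift (F a)).
have lL : lin L by apply: tlift_is_linear.
have LE a b c : L (tpure a (tpure b c)) = F a b c.
  rewrite /L tliftp; first by rewrite tliftp //; case: tF => _ [lF2 lF3].
  by split=> u; [apply: lin_tlift_fun => *; apply: tF.1 | apply: tlift_is_linear].
move=> /(congr1 L); rewrite !(lin_tlift _ _ lL) => E.
transitivity (tlift (fun a b => L (tlift (fun x y => tpure x (tpure y b)) (D a))) t).
  apply: eq_tlift => a b; rewrite (lin_tlift _ _ lL).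
  by apply: eq_tlift => x y; rewrite LE.
rewrite E; apply: eq_tlift => a b; rewrite (lin_tlift _ _ lL).
by apply: eq_tlift => x y; rewrite LE.
Qed.

Lemma cbasisE U (u : U) : u = \sum_i ccoord i u *: cbasis i.
Proof. exact: coord_vbasis (memvf u). Qed.

Lemma ccoord_cbasis U (i j : 'I_(\dim {:U})) :
  ccoord i (cbasis j : U) = (i == j)%:R.
Proof.
by rewrite /ccoord /cbasis coord_free ?(basis_free (vbasisP _)) // eq_sym.
Qed.

Lemma lin_ccoord U (i : 'I_(\dim {:U})) : lin (@ccoord k U i : U -> k^o).
Proof. by move=> a u v; rewrite /ccoord linearP. Qed.

Lemma dual_cbasisE U (i : 'I_(\dim {:U})) u : dual_cbasis i u = ccoord i u.
Proof. by rewrite functional_lin //; apply: lin_ccoord. Qed.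

Lemma dual_sep U (u : U) : (forall f : dualv U, f u = 0) -> u = 0.
Proof.
move=> f0; rewrite (cbasisE u) big1 // => i _.
by rewrite -dual_cbasisE f0 scale0r.
Qed.

Lemma tensE U W (t : tens U W) i :
  tlift (fun a b => (ccoord i a : k) *: b) t = \sum_j t i j *: cbasis j.
Proof.
rewrite /tlift (bigD1 i) //= [X in _ + X]big1 ?addr0 => [|a nai].
  by apply: eq_bigr => j _; rewrite ccoord_cbasis eqxx scale1r.
by rewrite big1 // => j _; rewrite ccoord_cbasis eq_sym (negPf nai) scale0r scaler0.
Qed.

Lemma tens_sepl U W (t : tens U W) :
  (forall xi : dualv U, tlift (fun a b => (xi a : k) *: b) t = 0) -> t = 0.
Proof.
move=> t0; apply/matrixP => i j; rewrite mxE.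
have := t0 (dual_cbasis i).
rewrite (eq_tlift (G := fun a b => ccoord i a *: b)) => [|a b]; last first.
  by rewrite dual_cbasisE.
rewrite tensE => /(congr1 (ccoord j)); rewrite (lin0 (lin_ccoord j)).
rewrite (lin_bigsum (lin_ccoord j)) (bigD1 j) //= big1 ?addr0 => [|a naj].
  by rewrite (linZ (lin_ccoord j)) ccoord_cbasis eqxx /GRing.scale /= mulr1.
by rewrite (linZ (lin_ccoord j)) ccoord_cbasis eq_sym (negPf naj) /GRing.scale /= mulr0.
Qed.

Lemma dim_dualv U : \dim {:dualv U} = \dim {:U}.
Proof. by rewrite !dimvf /dim /= muln1. Qed.

End Tensor.

(** * Subspaces given by linear conditions *)

Section Subspaces.
Variables (k : fieldType) (W : vectType k).

Definition subspace (P : W -> Prop) : Prop :=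
  P 0 /\ forall a u v, P u -> P v -> P (a *: u + v).

(** This turns a linear condition into a [{vspace W}]. A subspace inside [P] that misses a vector of
    [P] can be enlarged by it, and the dimension bounds the number of enlargements. *)
Lemma spannedP (P : W -> Prop) : subspace P -> forall w, w \in spanned P <-> P w.
Proof.
move=> [P0 PP]; pose C (U : {vspace W}) := forall w, w \in U -> P w.
have maxC m : forall U, C U -> (\dim {:W} - \dim U < m)%N ->
    exists U : {vspace W}, forall w, w \in U <-> P w.
  elim: m => // m IHm U CU dU.
  case: (classic (forall w, P w -> w \in U)) => [PU | /not_all_ex_not[w nw]].
    by exists U => w; split; [apply: CU | apply: PU].
  have [Pw /negP nUw] := imply_to_and _ _ nw.
  apply: (IHm (U + <[w]>)%VS) => [x|].
    move=> /memv_addP[u uU [_ /vlineP[a ->] ->]].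
    by rewrite addrC; apply: PP => //; apply: CU.
  have dlt : (\dim U < \dim (U + <[w]>))%N.
    rewrite (ltn_leqif (dimv_leqif_sup (addvSl U <[w]>))).
    by rewrite subv_add subvv /= -memvE.
  by apply: leq_trans (ltn_sub2l _ dlt) dU; apply: leq_trans dlt (dimvS (subvf _)).
have [|U UP] := maxC _ 0%VS _ (ltnSn _); first by move=> w; rewrite memv0 => /eqP->.
move=> w; rewrite bigmeetP; split=> [h | Pw X CX]; last exact: CX.
by apply/UP/h => v; apply: (proj2 (UP v)).
Qed.

Lemma mem_spanned (P : W -> Prop) w : P w -> w \in spanned P.
Proof. by move=> Pw; apply/bigmeetP => X; apply. Qed.

Lemma spanned_sub (P : W -> Prop) (X : {vspace W}) :
  (forall w, P w -> w \in X) -> (spanned P <= X)%VS.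
Proof. by move=> PX; apply/subvP => w /bigmeetP; apply. Qed.

Lemma spanned_ind (P Q : W -> Prop) :
  subspace Q -> (forall w, P w -> Q w) -> forall w, w \in spanned P -> Q w.
Proof.
move=> sQ PQ w wP; apply/(spannedP sQ); move: w wP; apply/subvP.
by apply: spanned_sub => w /PQ; apply: mem_spanned.
Qed.

(* A proper subspace of the dual annihilates a nonzero vector: otherwise a basis
   f_1, ..., f_r of it gives an injection u |-> (f_i u)_i, through which every
   functional factors. *)
Lemma annihilatedP (X : {vspace dualv W}) : X != fullv ->
  exists2 u : W, u != 0 & forall f, f \in X -> f u = 0.
Proof.
move=> nX; case: (classic (exists2 u : W, u != 0 & forall f, f \in X -> f u = 0)) => //.
move=> nex; case/negP: nX; rewrite eqEsubv subvf /=; apply/subvP => f _.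
pose E := linfun (fun u : W => \row_i ((vbasis X)`_i : dualv W) u) :
  'Hom(W, 'rV[k]_(\dim X)).
have EE u : E u = \row_i ((vbasis X)`_i : dualv W) u.
  by rewrite linfun_lin // => a v w; apply/rowP=> i; rewrite !mxE linearP.
have kE : lker E == 0%VS.
  apply/lker0P => u v Euv; have : E (u - v) = 0 by rewrite linearB /= Euv subrr.
  rewrite EE => /rowP uv.
  apply/eqP; rewrite -subr_eq0; apply: contra_notT nex => nuv.
  exists (u - v) => // h /coord_vbasis ->.
  rewrite sum_lfunE big1 // => i _; rewrite scale_lfunE.
  by have := uv i; rewrite !mxE => ->; rewrite scaler0.
have -> : f = \sum_i f ((E^-1)%VF (delta_mx 0 i)) *: ((vbasis X)`_i : dualv W).
  apply/lfunP => u; rewrite -{1}(lker0_lfunK kE u).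
  rewrite (row_sum_delta (E u)) !linear_sum sum_lfunE; apply: eq_bigr => i _.
  by rewrite !linearZ scale_lfunE EE mxE /= /GRing.scale /= mulrC.
by apply: memv_suml => i _; apply: memvZ; apply: vbasis_mem; rewrite mem_nth ?size_tuple.
Qed.

End Subspaces.

Lemma lin_surj_inj (k : fieldType) (W : vectType k) (f : W -> W) :
  lin f -> (forall y, exists x, f x = y) -> injective f.
Proof.
move=> lf surj x y; rewrite -!(linfun_lin _ lf).
have : limg (linfun f) = fullv.
  apply/eqP; rewrite eqEsubv subvf /=; apply/subvP => z _.
  case: (surj z) => w <-; rewrite -(linfun_lin _ lf).
  by rewrite memv_img ?memvf.
move=> im; have := limg_ker_dim (linfun f) fullv.
rewrite im => /eqP; rewrite -[X in _ == X]add0n eqn_add2r dimv_eq0 capfv.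
by move=> /lker0P; apply.
Qed.

(** * Hopf algebras *)

(** Instances are given for the group algebra and for the bosonization. Of their doubles, the
    algebra laws are derived, and that the antipode is a surjective linear anti-homomorphism: this
    is what duals of modules rest on. *)
Class hopf_laws (k : fieldType) (H : hopf_data k) : Prop := HopfLaws {
  hmul_bil : bil (@hmul k H);
  hcop_lin : lin (@hcop k H);
  hcou_lin : lin (@hcou k H : H -> k^o);
  hant_lin : lin (@hant k H);
  hmulA : forall x y z : H, hmul x (hmul y z) = hmul (hmul x y) z;
  hmul1l : forall x : H, hmul (hone H) x = x;
  hmul1r : forall x : H, hmul x (hone H) = x;
  hcoassoc : forall x : H,
    sw2 x (fun a b => sw2 a (fun a1 a2 => tpure a1 (tpure a2 b))) =
    sw2 x (fun a b => sw2 b (fun b1 b2 => tpure a (tpure b1 b2)));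
  hcou_l : forall x : H, sw2 x (fun a b => (hcou a : k) *: b) = x;
  hcou_r : forall x : H, sw2 x (fun a b => (hcou b : k) *: a) = x;
  hcop1 : hcop (hone H) = tpure (hone H) (hone H);
  hcopM : forall x y : H, hcop (hmul x y) =
    sw2 x (fun a b => sw2 y (fun c d => tpure (hmul a c) (hmul b d)));
  hcou1 : hcou (hone H) = 1;
  hcouM : forall x y : H, hcou (hmul x y) = hcou x * hcou y;
  hant_l : forall x : H, sw2 x (fun a b => hmul (hant a) b) = hcou x *: hone H;
  hant_r : forall x : H, sw2 x (fun a b => hmul a (hant b)) = hcou x *: hone H }.

Section LinHopf.
Variables (k : fieldType) (H : hopf_data k) (HL : hopf_laws H).
Variables (U : lmodType k) (X : vectType k).

Lemma lin_mull (f : U -> H) c : lin f -> lin (fun u => hmul (f u) c).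
Proof. exact: bil_l hmul_bil. Qed.

Lemma lin_mulr (f : U -> H) c : lin f -> lin (fun u => hmul c (f u)).
Proof. exact: bil_r hmul_bil. Qed.

Lemma lin_mul_eta (x : H) : lin (hmul x).
Proof. exact: hmul_bil.2. Qed.

Lemma lin_hant (f : U -> H) : lin f -> lin (fun u => hant (f u)).
Proof. by move=> lf a u v; rewrite lf hant_lin. Qed.

Lemma lin_hcou (f : U -> H) : lin f -> lin (fun u => hcou (f u) : k^o).
Proof. by move=> lf a u v; rewrite lf hcou_lin. Qed.

Lemma lin_hcop (f : U -> H) : lin f -> lin (fun u => hcop (f u)).
Proof. by move=> lf a u v; rewrite lf hcop_lin. Qed.

Lemma lin_sw2_arg (F : H -> H -> X) (f : U -> H) :
  lin f -> lin (fun u => sw2 (f u) F).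
Proof. by move=> lf; apply/lin_tlift_arg/lin_hcop. Qed.

Lemma lin_sw2_fun (F : U -> H -> H -> X) x :
  (forall a b, lin (fun u => F u a b)) -> lin (fun u => sw2 x (F u)).
Proof. exact: lin_tlift_fun. Qed.

End LinHopf.

Ltac lin_hopf :=
  lazymatch goal with
  | |- lin (fun x => hmul _ _) => first [apply: lin_mull | apply: lin_mulr]
  | |- lin (fun x => hant _) => apply: lin_hant
  | |- lin (fun x => hcou _) => apply: lin_hcou
  | |- lin (fun x => hcop _) => apply: lin_hcop
  | |- lin (fun x => sw2 _ _) => first [apply: lin_sw2_arg | apply: lin_sw2_fun]
  | |- lin (hmul _) => apply: lin_mul_eta
  | |- lin (@hant _ _) => apply: hant_lin
  | |- lin (@hcou _ _) => apply: hcou_lin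
  | |- lin (@hcop _ _) => apply: hcop_lin
  end.
Ltac lin_ext ::= lin_hopf.

(** Lemmas are passed with explicit functions as arguments, so their instances have to be
    beta-reduced before a left-hand side can match; the linearity premises go to [slin]. *)
Ltac rwb L :=
  let E := fresh "E" in pose proof L as E; cbv beta in E; rewrite E; [clear E | by slin ..].
Ltac rwbr L :=
  let E := fresh "E" in pose proof L as E; cbv beta in E; rewrite -E; [clear E | by slin ..].

Section Hopf.
Context {k : fieldType} {H : hopf_data k} {HL : hopf_laws H}.
Implicit Types (x y z : H) (X : vectType k).

Local Infix "·" := (@hmul k H) (at level 40, left associativity).
Local Notation S := (@hant k H).
Local Notation e := (@hcou k H).

Lemma eq_sw2 X x (F G : H -> H -> X) :
  (forall a b, F a b = G a b) -> sw2 x F = sw2 x G.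
Proof. exact: eq_tlift. Qed.

Lemma sw2_lin X (Z : vectType k) (g : X -> Z) : lin g ->
  forall x (F : H -> H -> X), g (sw2 x F) = sw2 x (fun a b => g (F a b)).
Proof. by move=> lg x F; apply: lin_tlift. Qed.

Lemma sw2_exch X x y (F : H -> H -> H -> H -> X) :
  sw2 x (fun a b => sw2 y (F a b)) = sw2 y (fun c d => sw2 x (fun a b => F a b c d)).
Proof. exact: tlift_exch. Qed.

Lemma sw_assoc X (F : H -> H -> H -> X) : tril F -> forall x,
  sw2 x (fun a b => sw2 a (fun a1 a2 => F a1 a2 b)) =
  sw2 x (fun a b => sw2 b (fun b1 b2 => F a b1 b2)).
Proof. by move=> tF x; apply: (tlift_coassoc tF); apply: hcoassoc. Qed.

Lemma sw2M X (F : H -> H -> X) : bil F -> forall x y,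
  sw2 (x · y) F = sw2 x (fun a b => sw2 y (fun c d => F (a · c) (b · d))).
Proof.
move=> bF x y; rewrite {1}/sw2 hcopM /sw2 tlift_tlift; apply: eq_tlift => a b.
by rewrite tlift_tlift; apply: eq_tlift => c d; rewrite tliftp.
Qed.

Lemma sw2_1 X (F : H -> H -> X) : bil F -> sw2 (hone H) F = F (hone H) (hone H).
Proof. by move=> bF; rewrite /sw2 hcop1 tliftp. Qed.

Lemma sw2_el X (f : H -> X) : lin f -> forall x, sw2 x (fun a b => (e a : k) *: f b) = f x.
Proof.
move=> lf x; rewrite -[in RHS](hcou_l x) (sw2_lin lf).
by apply: eq_sw2 => a b; rewrite linZ.
Qed.

Lemma sw2_er X (f : H -> X) : lin f -> forall x, sw2 x (fun a b => (e b : k) *: f a) = f x.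
Proof.
move=> lf x; rewrite -[in RHS](hcou_r x) (sw2_lin lf).
by apply: eq_sw2 => a b; rewrite linZ.
Qed.

Lemma sw2_Sl X (f : H -> X) : lin f -> forall x,
  sw2 x (fun a b => f (S a · b)) = e x *: f (hone H).
Proof. by move=> lf x; rewrite -(sw2_lin lf) hant_l linZ. Qed.

Lemma sw2_Sr X (f : H -> X) : lin f -> forall x,
  sw2 x (fun a b => f (a · S b)) = e x *: f (hone H).
Proof. by move=> lf x; rewrite -(sw2_lin lf) hant_r linZ. Qed.

Lemma hant1 : S (hone H) = hone H.
Proof.
have := @hant_l _ _ HL (hone H).
rewrite sw2_1; last by slin.
by rewrite hmul1r hcou1 scale1r.
Qed.

(** Uniqueness of the convolution inverse of the product: [S y1 · S x1 · (x2 · y2) · S (x3 · y3)]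
    collapses to one side or to the other, according to which pair of neighbouring factors is
    cancelled first. *)
Lemma hantM x y : S (x · y) = S y · S x.
Proof.
transitivity (sw2 x (fun x' x3 => sw2 y (fun y' y3 =>
    sw2 x' (fun x1 x2 => sw2 y' (fun y1 y2 => S y1 · S x1 · (x2 · y2) · S (x3 · y3)))))).
  under eq_sw2 => x' x3.
    under eq_sw2 => y' y3.
      rewrite sw2_exch.
      under eq_sw2 => y1 y2.
        under eq_sw2 => x1 x2 do rewrite -!hmulA (hmulA (S x1)).
        rwb (sw2_Sl (f := fun z => S y1 · (z · (y2 · S (x3 · y3))))).
        rewrite hmul1l hmulA.
        over.
      rwbr (sw2_lin (g := fun z => e x' *: z)).
      rwb (sw2_Sl (f := fun z => z · S (x3 · y3))).
      rewrite hmul1l.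
      over.
    rwbr (sw2_lin (g := fun z => e x' *: z)).
    rwb (sw2_el (f := fun z => S (x3 · z))).
    over.
  by rwb (sw2_el (f := fun z => S (z · y))).
transitivity (sw2 x (fun x1 x' => sw2 y (fun y1 y' =>
    sw2 x' (fun x2 x3 => sw2 y' (fun y2 y3 => S y1 · S x1 · (x2 · y2) · S (x3 · y3)))))).
  under eq_sw2 => x' x3.
    rewrite sw2_exch.
    under eq_sw2 => x1 x2.
      rwb (sw_assoc (F := fun y1 y2 y3 => S y1 · S x1 · (x2 · y2) · S (x3 · y3))).
      over.
    over.
  rewrite (sw_assoc (F := fun x1 x2 x3 => sw2 y (fun a b => sw2 b (fun b1 b2 =>
    S a · S x1 · (x2 · b1) · S (x3 · b2))))); last by slin.
  by apply: eq_sw2 => x1 x'; rewrite sw2_exch.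
under eq_sw2 => x1 x'.
  under eq_sw2 => y1 y'.
    under eq_sw2 => x2 x3 do under eq_sw2 => y2 y3 do rewrite -hmulA.
    rwbr (sw2M (F := fun a b => S y1 · S x1 · (a · S b))).
    rwb (sw2_Sr (f := fun z => S y1 · S x1 · z)).
    rewrite hmul1r hcouM mulrC -scalerA.
    over.
  rwb (sw2_er (f := fun z => (e x' : k) *: (S z · S x1))).
  over.
by rwb (sw2_er (f := fun z => (S y · S z))).
Qed.

(** The two middle legs are made the coproduct of one factor [m], ready to be cancelled. *)
Lemma sw_assoc4 X (K : H -> H -> H -> H -> X) :
  (forall b c d, lin (fun a => K a b c d)) -> (forall a c d, lin (fun b => K a b c d)) ->
  (forall a b d, lin (fun c => K a b c d)) -> (forall a b c, lin (K a b c)) ->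
  forall x,
  sw2 x (fun b d => sw2 b (fun b1 b2 => sw2 d (fun d1 d2 => K b1 b2 d1 d2))) =
  sw2 x (fun b1 s => sw2 s (fun m d2 => sw2 m (fun b2 d1 => K b1 b2 d1 d2))).
Proof.
move=> l1 l2 l3 l4 x.
rwb (sw_assoc (F := fun b1 b2 d => sw2 d (fun d1 d2 => K b1 b2 d1 d2))).
apply: eq_sw2 => b1 s.
by rwb (sw_assoc (F := fun b2 d1 d2 => K b1 b2 d1 d2)).
Qed.

(** Uniqueness of the convolution inverse of the coproduct: in the product of Δ(S a), Δ(b) and S d2
    (x) S d1, cancelling the last two factors leaves Δ(S x), cancelling the first two leaves the
    flipped S (x) S. The last factor is carried by [G]. *)
Lemma sw2_S X (F : H -> H -> X) : bil F -> forall x,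
  sw2 (S x) F = sw2 x (fun a b => F (S b) (S a)).
Proof.
move=> bF x.
pose G d u v := sw2 d (fun d1 d2 => F (u · S d2) (v · S d1)).
have bG d : bil (G d) by rewrite /G; slin.
have lG u v : lin (fun d => G d u v) by rewrite /G; slin.
transitivity (sw2 x (fun a r => sw2 r (fun b d => sw2 (S a) (fun p q =>
    sw2 b (fun b1 b2 => sw2 d (fun d1 d2 => F (p · (b1 · S d2)) (q · (b2 · S d1)))))))).
  symmetry; transitivity (sw2 x (fun a r => (e r : k) *: sw2 (S a) F)).
    apply: eq_sw2 => a r; rewrite sw2_exch; rwb (sw2_lin (g := fun z : X => (e r : k) *: z)).
    apply: eq_sw2 => p q.
    rwb (sw_assoc4 (K := fun b1 b2 d1 d2 => F (p · (b1 · S d2)) (q · (b2 · S d1)))).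
    transitivity (sw2 r (fun b1 s => F (p · (b1 · S s)) q)).
      apply: eq_sw2 => b1 s.
      transitivity (sw2 s (fun m d2 => (e m : k) *: F (p · (b1 · S d2)) q)).
        apply: eq_sw2 => m d2; rwb (sw2_Sr (f := fun z => F (p · (b1 · S d2)) (q · z))).
        by rewrite hmul1r.
      by rwb (sw2_el (f := fun z => F (p · (b1 · S z)) q)).
    by rwb (sw2_Sr (f := fun z => F (p · z) q)); rewrite hmul1r.
  by rwb (sw2_er (f := fun z => sw2 (S z) F)).
transitivity (sw2 x (fun a r => sw2 r (fun b d => sw2 (S a · b) (G d)))).
  apply: eq_sw2 => a r; apply: eq_sw2 => b d.
  rewrite (sw2M (bG d)); apply: eq_sw2 => p q; apply: eq_sw2 => b1 b2.
  by apply: eq_sw2 => d1 d2; rewrite !hmulA.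
rwbr (sw_assoc (F := fun a b d => sw2 (S a · b) (G d))).
transitivity (sw2 x (fun a d => (e a : k) *: G d (hone H) (hone H))).
  apply: eq_sw2 => a d; rwb (sw2_Sl (f := fun z => sw2 z (G d))).
  by rewrite sw2_1.
rwb (sw2_el (f := fun z => G z (hone H) (hone H))).
by apply: eq_sw2 => a b; rewrite !hmul1l.
Qed.

Lemma hcouS x : e (S x) = e x.
Proof.
have le : lin (@hcou k H : H -> k^o) := hcou_lin.
transitivity (sw2 (X := k^o) x (fun a b => e (S a) * e b)).
  transitivity (sw2 (X := k^o) x (fun a b => (e b : k) *: (e (S a) : k^o))).
    by rwb (sw2_er (X := k^o) (f := fun z => (e (S z) : k^o))).
  by apply: (eq_sw2 (X := k^o)) => a b; rewrite mulrC.
transitivity (sw2 (X := k^o) x (fun a b => e (S a · b))).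
  by apply: (eq_sw2 (X := k^o)) => a b; rewrite hcouM.
by rwb (sw2_Sl (X := k^o) (f := fun z => e z : k^o)); rewrite hcou1 /GRing.scale /= mulr1.
Qed.

End Hopf.

Section Hopf.
Context {k : fieldType} {H : hopf_data k} {HL : hopf_laws H}.
Implicit Types (x y z : H) (X : vectType k).

Local Infix "·" := (@hmul k H) (at level 40, left associativity).
Local Notation S := (@hant k H).
Local Notation e := (@hcou k H).

(** * Left integrals and their uniqueness *)

Section Integrals.
Variable Lam : H.
Hypothesis LamP : forall x, x · Lam = e x *: Lam.

(** The counit of one leg of [x] is absorbed into the integral as [q · Lam]. Expanding the coproduct
    of this product puts [q1] next to [S p], where they cancel, and leaves the other leg on the
    second factor. *)
Lemma integral_move X (F : H -> H -> X) : bil F -> forall x,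
  sw2 Lam (fun a b => F (S x · a) b) = sw2 Lam (fun a b => F a (x · b)).
Proof.
move=> bF x.
transitivity (sw2 x (fun p q => sw2 (q · Lam) (fun a b => F (S p · a) b))).
  symmetry; transitivity (sw2 x (fun p q => (e q : k) *: sw2 Lam (fun a b => F (S p · a) b))).
    by apply: eq_sw2 => p q; rewrite LamP; rwb (linZ (f := fun z => sw2 z (fun a b => F (S p · a) b))).
  by rwb (sw2_er (f := fun p => sw2 Lam (fun a b => F (S p · a) b))).
transitivity (sw2 x (fun p q => sw2 q (fun q1 q2 =>
    sw2 Lam (fun a b => F (S p · (q1 · a)) (q2 · b))))).
  by apply: eq_sw2 => p q; rwb (sw2M (F := fun a b => F (S p · a) b)).
rwbr (sw_assoc (F := fun p q1 q2 => sw2 Lam (fun a b => F (S p · (q1 · a)) (q2 · b)))).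
transitivity (sw2 x (fun p q => (e p : k) *: sw2 Lam (fun a b => F a (q · b)))).
  apply: eq_sw2 => p q.
  transitivity (sw2 p (fun p1 p2 => sw2 Lam (fun a b => F ((S p1 · p2) · a) (q · b)))).
    by do 2!apply: eq_sw2 => ? ?; rewrite hmulA.
  rwb (sw2_Sl (f := fun z => sw2 Lam (fun a b => F (z · a) (q · b)))).
  by congr (_ *: _); apply: eq_sw2 => a b; rewrite hmul1l.
by rwb (sw2_el (f := fun q => sw2 Lam (fun a b => F a (q · b)))).
Qed.

(** For [xi Lam = 1], f(z) equals ξ(Λ1) f(z S(Λ2) Λ3). Once S(Λ2) is expanded in a basis, each term
    is a linear function of the first leg times f(x Λ2) for a fixed x, and [integral_move] reduces
    it to the hypothesis ([h0]). *)
Lemma integral_nondeg (f : dualv H) : Lam != 0 ->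
  sw2 Lam (fun a b => (f b : k) *: a) = 0 -> f = 0.
Proof.
move=> nL f0; have [xi xiL] : exists xi : dualv H, xi Lam = 1.
  case: (classic (exists xi : dualv H, xi Lam = 1)) => // nex.
  case/eqP: nL; apply: dual_sep => f'; apply/eqP; apply: contra_notT nex => nf'.
  by exists ((f' Lam)^-1 *: f'); rewrite scale_lfunE /GRing.scale /= mulVf.
have h0 x (g : H -> k^o) : lin g -> sw2 Lam (fun a b => (f (x · b) : k) *: g a) = 0.
  move=> lg; transitivity (sw2 Lam (fun a b => (f b : k) *: g (S x · a))).
    by rwb (integral_move (F := fun a b => (f b : k) *: g a)).
  transitivity (g (S x · sw2 Lam (fun a b => (f b : k) *: a))).
    rwb (sw2_lin (H := H) (g := fun z => g (S x · z))).
    apply: eq_sw2 => a b; rewrite (linZ (hmul_bil.2 (S x))) linZ //.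
  by rewrite f0; apply: (lin0 (f := fun z => g (S x · z))); slin.
apply/lfunP => z; rewrite zero_lfunE.
transitivity (sw2 Lam (fun a b => sw2 b (fun b1 b2 =>
    ((xi a : k) *: f (z · (S b1 · b2)) : k^o)))).
  symmetry; transitivity (sw2 Lam (fun a b => (e b : k) *: ((xi a : k) *: f z : k^o))).
    apply: eq_sw2 => a b; rwb (sw2_Sl (f := fun y => ((xi a : k) *: f (z · y) : k^o))).
    by rewrite hmul1r.
  rwb (sw2_er (f := fun a => ((xi a : k) *: f z : k^o))).
  by rewrite xiL scale1r.
rwbr (sw_assoc (F := fun a b1 b2 => ((xi a : k) *: f (z · (S b1 · b2)) : k^o))).
transitivity (\sum_i sw2 Lam (fun a b => (f (z · cbasis i · b) : k) *:
    (sw2 a (fun a1 a2 => (ccoord i (S a2) : k) *: (xi a1 : k^o)) : k^o))).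
  rewrite -tlift_bigsum; apply: eq_tlift => a b.
  transitivity (sw2 a (fun a1 a2 => \sum_i (f (z · cbasis i · b) : k) *: ((ccoord i (S a2) : k) *: (xi a1 : k^o)))).
    apply: eq_sw2 => a1 a2; rewrite {1}(cbasisE (S a2)).
    have l1 : lin (fun s => (xi a1 : k) *: f (z · (s · b)) : k^o) by slin.
    rewrite (lin_bigsum l1); apply: eq_bigr => i _.
    by rewrite (linZ l1) hmulA /GRing.scale /= [RHS]mulrC mulrA.
  etransitivity; first exact: (tlift_bigsum (X := k^o)).
  by apply: eq_bigr => i _; rewrite (tliftZ (X := k^o)).
rewrite big1 // => i _; apply: (h0 _ (fun a => sw2 a _)).
by have := @lin_ccoord k H i; slin.
Qed.

(** By nondegeneracy and a dimension count, some [lam] satisfies Λ1 lam(Λ2) = 1. Write Λ' = S(G);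
    then G is a right integral, as S reverses products, and S(G) = S(G) Λ1 lam(Λ2) = Λ1 lam(G Λ2) =
    lam(G) Λ, so the scalar is [lam G]. *)
Lemma integral_unique (Lam' : H) : Lam != 0 -> (forall y, exists x, S x = y) ->
  (forall x, x · Lam' = e x *: Lam') -> exists c : k, Lam' = c *: Lam.
Proof.
move=> nL Ssurj Lam'P.
have inj := lin_surj_inj hant_lin Ssurj.
pose B := linfun (fun f : dualv H => sw2 Lam (fun a b => (f b : k) *: a)).
have BE f : B f = sw2 Lam (fun a b => (f b : k) *: a).
  by rewrite linfun_lin //; slin.
have kB : lker B == 0%VS.
  apply/lker0P => f f' ff'; apply/eqP; rewrite -subr_eq0; apply/eqP.
  by apply: integral_nondeg => //; rewrite -BE linearB /= ff' subrr.
have [lam lamP] : exists lam : dualv H, B lam = hone H.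
  have /memv_imgP[lam _ ->] : hone H \in limg B; last by exists lam.
  have -> : limg B = fullv; last exact: memvf.
  apply/eqP; rewrite eqEdim subvf /= limg_dim_eq ?dim_dualv //.
  by rewrite (eqP kB) capv0.
case: (Ssurj Lam') => G SG; exists (lam G : k).
have GP x : G · x = e x *: G.
  by apply: inj; rewrite hantM SG Lam'P (linZ hant_lin) SG hcouS.
rewrite -SG -[S G]hmul1r -lamP BE.
transitivity (sw2 Lam (fun a b => (lam b : k) *: (S G · a))).
  rwb (sw2_lin (H := H) (g := fun z => S G · z)).
  by apply: eq_sw2 => a b; rewrite (linZ (hmul_bil.2 (S G))).
rwb (integral_move (F := fun a b => (lam b : k) *: a)).
transitivity (sw2 Lam (fun a b => (e b : k) *: ((lam G : k) *: a))).
  by apply: eq_sw2 => a b; rewrite GP linearZ /= scalerA.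
by rwb (sw2_er (f := fun z : H => (lam G : k) *: z)).
Qed.

End Integrals.

End Hopf.

(** * The cross relation of the double *)

Section CoadjointSweedler.
Context {k : fieldType} {H : hopf_data k} {HL : hopf_laws H}.
Implicit Types (x y z u v : H) (X : vectType k).

Local Infix "·" := (@hmul k H) (at level 40, left associativity).
Local Notation S := (@hant k H).
Local Notation e := (@hcou k H).

(* What results from moving u to the left past a functional evaluated at x. *)
Definition csw X u x (F : H -> H -> X) : X :=
  sw2 u (fun u1 v => sw2 v (fun u2 u3 => F (u1 · x · S u3) u2)).

Lemma eq_csw X u x (F G : H -> H -> X) :
  (forall a b, F a b = G a b) -> csw u x F = csw u x G.
Proof. by move=> FG; do 2!apply: eq_sw2 => ? ?. Qed.

Lemma csw_lin X (Z : vectType k) (g : X -> Z) : lin g ->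
  forall u x (F : H -> H -> X), g (csw u x F) = csw u x (fun a b => g (F a b)).
Proof.
move=> lg u x F; rewrite /csw sw2_lin //; apply: eq_sw2 => a b.
by rewrite sw2_lin.
Qed.

Lemma csw_argl (U : lmodType k) X (u : U -> H) x (F : H -> H -> X) :
  bil F -> lin u -> lin (fun t => csw (u t) x F).
Proof. by move=> bF lz; rewrite /csw; slin. Qed.

Lemma csw_argr (U : lmodType k) X u (x : U -> H) (F : H -> H -> X) :
  bil F -> lin x -> lin (fun t => csw u (x t) F).
Proof. by move=> bF lz; rewrite /csw; slin. Qed.

Lemma csw_fun (U : lmodType k) X u x (F : U -> H -> H -> X) :
  (forall a b, lin (fun t => F t a b)) -> lin (fun t => csw u x (F t)).
Proof. by move=> lF; rewrite /csw; slin. Qed.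

Lemma csw1 X x (F : H -> H -> X) : bil F -> csw (hone H) x F = F x (hone H).
Proof.
move=> bF; rewrite /csw sw2_1; last by slin.
by rewrite sw2_1 ?hant1 ?hmul1l ?hmul1r //; slin.
Qed.

Lemma csw_cou X (f : H -> X) : lin f -> forall u x,
  csw u x (fun y v => (e y : k) *: f v) = e x *: f u.
Proof.
move=> lf u x.
transitivity (sw2 u (fun u1 v => (e u1 : k) *: ((e x : k) *: f v))).
  apply: eq_sw2 => u1 v.
  transitivity (sw2 v (fun u2 u3 => (e u3 : k) *: ((e u1 : k) *: ((e x : k) *: f u2)))).
    apply: eq_sw2 => u2 u3; rewrite !hcouM hcouS !scalerA; congr (_ *: _).
    by rewrite mulrC mulrA.
  by rwb (sw2_er (f := fun z => (e u1 : k) *: ((e x : k) *: f z))).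
by rwb (sw2_el (f := fun z => (e x : k) *: f z)).
Qed.

(** A product passes a functional factor by factor. Together with [csw_cop], which treats a product
    of functionals, this is the compatibility behind associativity of the double. *)
Lemma cswM X (F : H -> H -> X) : bil F -> forall u v x,
  csw (u · v) x F = csw v x (fun y v' => csw u y (fun z u' => F z (u' · v'))).
Proof.
move=> bF u v x; rewrite /csw.
rwb (sw2M (F := fun u1 w => sw2 w (fun u2 u3 => F (u1 · x · S u3) u2))).
rewrite sw2_exch; apply: eq_sw2 => v1 v'.
transitivity (sw2 u (fun u1 u' => sw2 v' (fun v2 v3 => sw2 u' (fun u2 u3 =>
   F (u1 · (v1 · x · S v3) · S u3) (u2 · v2))))); last by rewrite sw2_exch.
apply: eq_sw2 => u1 u'.
rwb (sw2M (F := fun u2 u3 => F (u1 · v1 · x · S u3) u2)).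
rewrite sw2_exch; do 2!apply: eq_sw2 => ? ?.
by rewrite hantM !hmulA.
Qed.

(** The outer legs are paired: [a], [b] come from one factor and [d], [f] from another. In [csw_cop]
    the pairs arise from the coproduct of a conjugate of [x]; in [dblS_fdfb] each pair cancels. *)
Lemma sw_assoc5 X (K : H -> H -> H -> H -> H -> X) :
  (forall b c d f, lin (fun a => K a b c d f)) ->
  (forall a c d f, lin (fun b => K a b c d f)) ->
  (forall a b d f, lin (fun c => K a b c d f)) ->
  (forall a b c f, lin (fun d => K a b c d f)) ->
  (forall a b c d, lin (K a b c d)) -> forall u,
  sw2 u (fun a v => sw2 v (fun w f => sw2 w (fun b z => sw2 z (fun c d =>
    K a b c d f)))) =
  sw2 u (fun v w => sw2 w (fun c z => sw2 v (fun a b => sw2 z (fun d f =>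
    K a b c d f)))).
Proof.
move=> l1 l2 l3 l4 l5 u.
transitivity (sw2 u (fun a v => sw2 v (fun b w => sw2 w (fun c z => sw2 z (fun d f =>
    K a b c d f))))).
  apply: eq_sw2 => a v.
  rwb (sw_assoc (F := fun b z f => sw2 z (fun c d => K a b c d f))).
  apply: eq_sw2 => b w.
  by rwb (sw_assoc (F := fun c d f => K a b c d f)).
rwbr (sw_assoc (F := fun a b w => sw2 w (fun c z => sw2 z (fun d f => K a b c d f)))).
by apply: eq_sw2 => v w; rewrite sw2_exch.
Qed.

Lemma csw_cop X (F : H -> H -> H -> X) : tril F -> forall u x,
  csw u x (fun y v => sw2 y (fun y1 y2 => F y1 y2 v)) =
  sw2 x (fun x1 x2 => csw u x1 (fun y u' => csw u' x2 (fun z u'' => F y z u''))).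
Proof.
move=> tF u x; rewrite /csw.
transitivity (sw2 x (fun x1 x2 => sw2 u (fun v w => sw2 w (fun c z =>
  sw2 v (fun a b => sw2 z (fun d f => F (a · x1 · S f) (b · x2 · S d) c)))))).
  rewrite sw2_exch; apply: eq_sw2 => u1 v.
  rewrite sw2_exch; apply: eq_sw2 => u2 u3.
  rwb (sw2M (F := fun y1 y2 => F y1 y2 u2)).
  rwb (sw2M (F := fun a b => sw2 (S u3) (fun c d => F (a · c) (b · d) u2))).
  rewrite sw2_exch; apply: eq_sw2 => x1 x2; apply: eq_sw2 => a b.
  by rwb (sw2_S (F := fun c d => F (a · x1 · c) (b · x2 · d) u2)).
apply: eq_sw2 => x1 x2.
by rwb (sw_assoc5 (K := fun a b c d f => F (a · x1 · S f) (b · x2 · S d) c)).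
Qed.

End CoadjointSweedler.

Ltac lin_csw :=
  lazymatch goal with
  | |- lin (fun x => csw _ _ _) =>
      first [apply: csw_argl | apply: csw_argr | apply: csw_fun]
  end.
Ltac lin_ext ::= first [lin_hopf | lin_csw].

(** * The Drinfeld double *)

Section DoubleEval.
Context {k : fieldType} {H : hopf_data k} {HL : hopf_laws H}.
Implicit Types (x h : H) (f : dualv H) (s t : tens H (dualv H)).

(* Elements of the double are handled as endomorphisms of H, via this
   identification of H (x) H^* with End H; dev_mul gives the product. *)
Definition dev t x : H := tlift (fun h f => (f x : k) *: h) t.

Lemma dev_linl (U : lmodType k) (t : U -> tens H (dualv H)) x :
  lin t -> lin (fun u => dev (t u) x).
Proof. exact: lin_tlift_arg. Qed.

Lemma dev_linr (U : lmodType k) t (x : U -> H) :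
  lin x -> lin (fun u => dev t (x u)).
Proof. by move=> lx; rewrite /dev; slin. Qed.

Lemma dev_lin t : lin (dev t).
Proof. exact: dev_linr (@lin_id _ _). Qed.

Lemma dbl_dev_lin x : lin (fun t : drinfeld_double H => dev t x).
Proof. exact: (@dev_linl _ (fun t => t) x (@lin_id _ _)). Qed.

End DoubleEval.

Ltac lin_dev :=
  lazymatch goal with
  | |- lin (fun x => dev _ _) => first [exact (dbl_dev_lin _) | apply: dev_linl | apply: dev_linr]
  | |- lin (dev _) => apply: dev_lin
  end.
Ltac lin_ext ::= first [lin_hopf | lin_csw | lin_dev].

Section DoubleMul.
Context {k : fieldType} {H : hopf_data k} {HL : hopf_laws H}.
Implicit Types (x h : H) (f : dualv H) (s t : tens H (dualv H)).

Local Infix "·" := (@hmul k H) (at level 40, left associativity).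
Local Notation S := (@hant k H).
Local Notation e := (@hcou k H).

Lemma dev_pure h f x : dev (tpure h f) x = (f x : k) *: h.
Proof. by rewrite /dev tliftp //; slin. Qed.

Lemma dev_inj s t : (forall x, dev s x = dev t x) -> s = t.
Proof.
move=> est; apply/eqP; rewrite -subr_eq0; apply/eqP; apply/matrixP => i j.
have d0 x : dev (s - t) x = 0.
  by rwb (linB (f := fun t => dev t x)); rewrite est subrr.
have : \sum_j (s - t) i j *: (cbasis j : dualv H) = 0.
  apply/lfunP => x; rewrite sum_lfunE zero_lfunE.
  have E0 : ccoord i (dev (s - t) x) = 0 by rewrite d0 (lin0 (lin_ccoord i)).
  rewrite -[RHS]E0 /dev (lin_tlift _ _ (lin_ccoord i)) /tlift (bigD1 i) //=.
  rewrite [X in _ = _ + X]big1 ?addr0 => [|a nai].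
    apply: eq_bigr => b _; rewrite scale_lfunE (linZ (lin_ccoord i)).
    by rewrite ccoord_cbasis eqxx /GRing.scale /= mulr1.
  rewrite big1 // => b _; rewrite (linZ (lin_ccoord i)) ccoord_cbasis.
  by rewrite eq_sym (negPf nai) /GRing.scale /= !mulr0.
move=> /(congr1 (ccoord j)); rewrite (lin0 (lin_ccoord j)).
rewrite (lin_bigsum (lin_ccoord j)) (bigD1 j) //= big1 ?addr0 => [|a naj].
  by rewrite (linZ (lin_ccoord j)) ccoord_cbasis eqxx /GRing.scale /= mulr1 => ->; rewrite mxE.
by rewrite (linZ (lin_ccoord j)) ccoord_cbasis eq_sym (negPf naj) /GRing.scale /= mulr0.
Qed.

Lemma dcop_lin : lin (@hcop k (dual_hopf H)).
Proof. by rewrite /=; slin. Qed.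

Lemma dmulE (f f' : dual_hopf H) x :
  (hmul f f' : dualv H) x = sw2 (X := k^o) x (fun a b => f a * f' b).
Proof. by rewrite /= functional_lin //; slin. Qed.

Lemma dmul_bil : bil (@hmul k (dual_hopf H)).
Proof. by rewrite /=; slin. Qed.

Lemma doneE x : (hone (dual_hopf H) : dualv H) x = e x.
Proof. by rewrite /= functional_lin //; apply: hcou_lin. Qed.

Lemma sw2_dual (X : vectType k) (F : dualv H -> dualv H -> X) f :
  sw2 (H := dual_hopf H) f F =
  \sum_i \sum_j (f (cbasis i · cbasis j) : k) *: tlift F (tpure (dual_cbasis i) (dual_cbasis j)).
Proof.
rewrite /sw2 /= (lin_bigsum (tlift_is_linear F)); apply: eq_bigr => i _.
rewrite (lin_bigsum (tlift_is_linear F)); apply: eq_bigr => j _.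
by rewrite (linZ (tlift_is_linear F)).
Qed.

Lemma sw2_dualE (f : dual_hopf H) a b :
  sw2 (X := k^o) f (fun f1 f2 : dual_hopf H => (f1 : dualv H) a * (f2 : dualv H) b : k^o) =
  (f : dualv H) (a · b).
Proof.
rewrite (sw2_dual (X := k^o)) [in RHS](cbasisE a) [in RHS](cbasisE b).
have l1 b' : lin (fun z => (f : dualv H) (z · b')) by slin.
have l2 a' : lin (fun z => (f : dualv H) (a' · z)) by slin.
rewrite (lin_bigsum (l1 _)); apply: eq_bigr => i _.
rewrite (linZ (l1 _)) (lin_bigsum (l2 _)) scaler_sumr; apply: eq_bigr => j _.
rewrite (linZ (l2 _)) tliftp /=; last by slin.
by rewrite !dual_cbasisE /GRing.scale /= mulrC -mulrA.
Qed.

Lemma sw3_dualE (X : vectType k) (f : dual_hopf H) a b c (w : X) :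
  sw3 f (fun f1 f2 f3 : dual_hopf H =>
    ((f1 : dualv H) a * (f3 : dualv H) c * (f2 : dualv H) b : k) *: w) =
  ((f : dualv H) (a · (b · c)) : k) *: w.
Proof.
rewrite -sw2_dualE.
rwb (lin_tlift (g := fun z : k^o => (z : k) *: w)
   (fun f1 f2 : dual_hopf H => (f1 : dualv H) a * (f2 : dualv H) (b · c) : k^o)
   (hcop f)).
apply: eq_tlift => f1 f2; rewrite -sw2_dualE mulrC.
rwb (lin_tlift (g := fun z : k^o => (z * (f1 : dualv H) a : k) *: w)
   (fun f2 f3 : dual_hopf H => (f2 : dualv H) b * (f3 : dualv H) c : k^o)
   (hcop f2)).
apply: eq_tlift => g2 g3; congr (_ *: _).
by rewrite mulrC [X in _ * X]mulrC mulrA.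
Qed.

Lemma dmul_pure h f h' f' :
  double_mul (tpure h f) (tpure h' f') = sw3 (f : dual_hopf H) (fun f1 f2 f3 : dual_hopf H =>
        sw3 h' (fun h1 h2 h3 : H =>
          ((f1 : dualv H) h1 * (f3 : dualv H) (S h3)) *:
            tpure (h · h2) (hmul (f' : dual_hopf H) f2 : dualv H))).
Proof.
have ld := dcop_lin; have lb := dmul_bil.
rewrite /double_mul tliftp; last first.
  rewrite /sw3 /sw2; slin.
rewrite tliftp //.
by rewrite /sw3 /sw2; slin.
Qed.

Lemma sw3_exch (X : vectType k) (K K' : hopf_data k) (c : K) (d : K')
    (F : K -> K -> K -> K' -> K' -> K' -> X) :
  sw3 c (fun a1 a2 a3 => sw3 d (F a1 a2 a3)) =
  sw3 d (fun b1 b2 b3 => sw3 c (fun a1 a2 a3 => F a1 a2 a3 b1 b2 b3)).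
Proof.
transitivity (sw2 c (fun a1 a => sw3 d (fun b1 b2 b3 =>
    sw2 a (fun a2 a3 => F a1 a2 a3 b1 b2 b3)))).
  apply: eq_tlift => a1 a; rewrite /sw3 [LHS]tlift_exch.
  by apply: eq_tlift => b1 b; rewrite [LHS]tlift_exch.
rewrite /sw3 [LHS]tlift_exch.
by apply: eq_tlift => b1 b; rewrite [LHS]tlift_exch.
Qed.

(** The functional parts multiply in the opposite order, so the right factor [t] takes the first leg
    of [x]. Its value is then moved left past [s], which is thereby evaluated at a conjugate of the
    second leg. *)
Lemma dev_mul s t x : dev (double_mul s t) x =
  sw2 x (fun x1 x2 => csw (dev t x1) x2 (fun y u => dev s y · u)).
Proof.
have ld := dcop_lin; have lb := dmul_bil.
have lcsw s0 x2 : lin (fun u => csw u x2 (fun y u => dev s0 y · u)) by slin.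
move: s; apply: tens_ext; [by rewrite /double_mul; slin | by slin | move=> h f].
move: t; apply: tens_ext; [by rewrite /double_mul; slin | by slin | ].
move=> h' f'; rewrite dmul_pure.
have lx : lin (fun t => dev t x) by slin.
rewrite /sw3 (lin_tlift _ _ lx).
transitivity (sw3 (f : dual_hopf H) (fun f1 f2 f3 : dual_hopf H =>
    sw3 h' (fun h1 h2 h3 : H => sw2 x (fun x1 x2 => (f' x1 : k) *:
      (((f1 : dualv H) h1 * (f3 : dualv H) (S h3) * (f2 : dualv H) x2 : k) *: (h · h2)))))).
  apply: eq_tlift => f1 f23; rewrite (lin_tlift _ _ lx); apply: eq_tlift => f2 f3.
  rewrite (lin_tlift _ _ lx); apply: eq_tlift => h1 h23.
  rewrite (lin_tlift _ _ lx); apply: eq_tlift => h2 h3.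
  rewrite (linZ lx) dev_pure dmulE.
  rwb (lin_tlift (g := fun z : k^o => ((f1 : dualv H) h1 * (f3 : dualv H) (S h3)) *: ((z : k) *: (h · h2)))
     (fun a b => f' a * (f2 : dualv H) b : k^o) (hcop x)).
  apply: eq_tlift => a b; rewrite !scalerA; congr (_ *: _).
  by rewrite mulrCA.
rewrite sw3_exch.
transitivity (sw3 h' (fun h1 h2 h3 => sw2 x (fun x1 x2 => (f' x1 : k) *:
    ((f (h1 · (x2 · S h3)) : k) *: (h · h2))))).
  apply: eq_tlift => h1 h23; apply: eq_tlift => h2 h3.
  transitivity (sw2 x (fun x1 x2 => sw3 (f : dual_hopf H) (fun f1 f2 f3 : dual_hopf H =>
     (f' x1 : k) *: (((f1 : dualv H) h1 * (f3 : dualv H) (S h3) * (f2 : dualv H) x2 : k) *: (h · h2))))).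
    rewrite /sw3 [RHS]tlift_exch; apply: eq_tlift => f1 f23.
    by rewrite [RHS]tlift_exch.
  apply: eq_tlift => x1 x2; rewrite -sw3_dualE.
  rewrite /sw3 -tliftZ; apply: eq_tlift => f1 f23.
  by rewrite -tliftZ.
transitivity (sw2 x (fun x1 x2 => sw3 h' (fun h1 h2 h3 => (f' x1 : k) *:
    ((f (h1 · (x2 · S h3)) : k) *: (h · h2))))).
  rewrite /sw3 [RHS]tlift_exch; apply: eq_tlift => h1 h23.
  by rewrite [RHS]tlift_exch.
apply: eq_tlift => x1 x2; rewrite dev_pure (linZ (lcsw _ _)) -tliftZ.
apply: eq_tlift => h1 h23; rewrite -tliftZ; apply: eq_tlift => h2 h3.
by rewrite dev_pure hmulA (linZ (f := fun z => z · h2)) //; slin.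
Qed.

End DoubleMul.

Section DoubleAlgebra.
Context {k : fieldType} {H : hopf_data k} {HL : hopf_laws H}.
Implicit Types (x y z u v h : H) (f : dualv H).

Local Infix "·" := (@hmul k H) (at level 40, left associativity).
Local Notation e := (@hcou k H).
Local Notation D := (drinfeld_double H).
Local Notation "s ∘ t" := (hmul (h := D) s t) (at level 40, left associativity).

Lemma dbl_mul_bil : bil (@hmul k D).
Proof.
split=> [t|s] a u v; apply: dev_inj => x; rewrite /= !dev_mul.
  have l : lin (fun s => sw2 x (fun x1 x2 => csw (dev t x1) x2 (fun y u => dev s y · u))) by slin.
  rewrite (l a u v) -!dev_mul.
  by have ld : lin (fun t => dev t x) := dev_linl x (@lin_id _ _); rewrite (ld a).
have l : lin (fun t => sw2 x (fun x1 x2 => csw (dev t x1) x2 (fun y u => dev s y · u))) by slin.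
rewrite (l a u v) -!dev_mul.
by have ld : lin (fun t => dev t x) := dev_linl x (@lin_id _ _); rewrite (ld a).
Qed.

Lemma dbl_mulE (s t : D) x : dev (s ∘ t) x =
  sw2 x (fun x1 x2 => csw (dev t x1) x2 (fun y u => dev s y · u)).
Proof. exact: dev_mul. Qed.

Lemma dbl_oneE x : dev (hone D) x = e x *: hone H.
Proof. by rewrite /= dev_pure functional_lin //; apply: hcou_lin. Qed.

Lemma dbl_mul1l (t : D) : hone D ∘ t = t.
Proof.
apply: dev_inj => x; rewrite dbl_mulE.
transitivity (sw2 x (fun x1 x2 => (e x2 : k) *: dev t x1)); last first.
  by rwb (sw2_er (f := dev t)).
apply: eq_sw2 => x1 x2; rewrite -(csw_cou (f := fun u => u)); last by slin.
apply: eq_csw => y u; rewrite dbl_oneE.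
by rewrite (linZ (f := fun z => z · u)) ?hmul1l //; slin.
Qed.

Lemma dbl_mul1r (t : D) : t ∘ hone D = t.
Proof.
apply: dev_inj => x; rewrite dbl_mulE.
transitivity (sw2 x (fun x1 x2 => (e x1 : k) *: dev t x2)); last first.
  by rwb (sw2_el (f := dev t)).
apply: eq_sw2 => x1 x2; rewrite dbl_oneE.
rwb (linZ (f := fun z => csw z x2 (fun y u => dev t y · u))).
by rewrite csw1 ?hmul1r //; slin.
Qed.

Lemma dbl_mulA (s t r : D) : s ∘ (t ∘ r) = s ∘ t ∘ r.
Proof.
apply: dev_inj => x; rewrite !dbl_mulE.
transitivity (sw2 x (fun x1 x' => sw2 x' (fun x2 x3 =>
  csw (dev r x1) x2 (fun y u => csw u x3 (fun y2 v =>
    csw (dev t y) y2 (fun z w => dev s z · (w · v))))))).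
  transitivity (sw2 x (fun x' x3 => sw2 x' (fun x1 x2 =>
    csw (dev r x1) x2 (fun y u => csw (dev t y · u) x3 (fun z v => dev s z · v))))).
    apply: eq_sw2 => x' x3; rewrite dbl_mulE.
    rwb (sw2_lin (H := H) (g := fun w => csw w x3 (fun y u => dev s y · u))).
    apply: eq_sw2 => x1 x2.
    by rwb (csw_lin (H := H) (g := fun w => csw w x3 (fun y u => dev s y · u))).
  rwb (sw_assoc (F := fun x1 x2 x3 =>
    csw (dev r x1) x2 (fun y u => csw (dev t y · u) x3 (fun z v => dev s z · v)))).
  do 2!apply: eq_sw2 => ? ?; apply: eq_csw => y u.
  by rwb (cswM (F := fun z v => dev s z · v)).
apply: eq_sw2 => x1 x'.
transitivity (csw (dev r x1) x' (fun y u => sw2 y (fun y1 y2 => csw (dev t y1) y2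
    (fun z w => dev s z · w · u)))).
  rewrite (csw_cop (F := fun y1 y2 u => csw (dev t y1) y2 (fun z w => dev s z · w · u))).
    by apply: eq_sw2 => ? ?; do 3!apply: eq_csw => ? ?; rewrite hmulA.
  by slin.
apply: eq_csw => y u; rewrite dbl_mulE.
rwb (sw2_lin (H := H) (g := fun z => z · u)).
apply: eq_sw2 => y1 y2.
by rwb (csw_lin (H := H) (g := fun z => z · u)).
Qed.

(* from_bos and from_dual for an arbitrary Hopf algebra. *)
Definition fb h : D := tpure h (hone (dual_hopf H)).
Definition fd f : D := tpure (hone H) f.

Lemma dev_fb h x : dev (fb h) x = e x *: h.
Proof. by rewrite dev_pure doneE. Qed.

Lemma dev_fd f x : dev (fd f) x = f x *: hone H.
Proof. by rewrite dev_pure. Qed.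

Lemma fb_lin : lin fb. Proof. by rewrite /fb; slin. Qed.
Lemma fd_lin : lin fd. Proof. exact: tpure_linr. Qed.

Lemma fbM h h' : fb h ∘ fb h' = fb (h · h').
Proof.
apply: dev_inj => x; rewrite dbl_mulE dev_fb.
transitivity (sw2 x (fun x1 x2 => (e x1 : k) *: ((e x2 : k) *: (h · h')))).
  apply: eq_sw2 => x1 x2; rewrite dev_fb.
  rwb (linZ (f := fun z => csw z x2 (fun y u => dev (fb h) y · u))).
  congr (_ *: _); rewrite -(csw_cou (f := fun u => h · u)); last by slin.
  by apply: eq_csw => y u; rewrite dev_fb (linZ (f := fun z => z · u)) //; slin.
by rwb (sw2_el (f := fun z => (e z : k) *: (h · h'))).
Qed.

Lemma fbfd h f : fb h ∘ fd f = tpure h f.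
Proof.
apply: dev_inj => x; rewrite dbl_mulE dev_pure.
transitivity (sw2 x (fun x1 x2 => (e x2 : k) *: ((f x1 : k) *: h))).
  apply: eq_sw2 => x1 x2; rewrite dev_fd.
  rwb (linZ (f := fun z => csw z x2 (fun y u => dev (fb h) y · u))).
  rewrite csw1; last by slin.
  by rewrite dev_fb hmul1r scalerA mulrC -scalerA.
by rwb (sw2_er (f := fun z => (f z : k) *: h)).
Qed.

Lemma dev_fdfb f h x : dev (fd f ∘ fb h) x = csw h x (fun y u => (f y : k) *: u).
Proof.
rewrite dbl_mulE.
transitivity (sw2 x (fun x1 x2 => (e x1 : k) *: csw h x2 (fun y u => (f y : k) *: u))).
  apply: eq_sw2 => x1 x2; rewrite dev_fb.
  rwb (linZ (f := fun z => csw z x2 (fun y u => dev (fd f) y · u))).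
  congr (_ *: _); apply: eq_csw => y u.
  by rewrite dev_fd (linZ (f := fun z => z · u)) ?hmul1l //; slin.
by rwb (sw2_el (f := fun z => csw h z (fun y u => (f y : k) *: u))).
Qed.

Lemma fdM f f' : fd f ∘ fd f' = fd (hmul (f' : dual_hopf H) (f : dual_hopf H)).
Proof.
apply: dev_inj => x; rewrite dbl_mulE dev_fd dmulE.
rwb (lin_tlift (g := fun z : k^o => (z : k) *: hone H)
   (fun a b : H => f' a * f b : k^o) (hcop x)).
apply: eq_sw2 => x1 x2; rewrite dev_fd.
rwb (linZ (f := fun z => csw z x2 (fun y u => dev (fd f) y · u))).
rewrite csw1; last by slin.
by rewrite dev_fd hmul1r scalerA.
Qed.

Lemma fb1 : fb (hone H) = hone D. Proof. by []. Qed.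

Lemma fd1 : fd (hone (dual_hopf H)) = hone D. Proof. by []. Qed.

End DoubleAlgebra.

(** * The antipode of the double *)

Class hopf_antipode_surj (k : fieldType) (H : hopf_data k) : Prop :=
  hant_surj : forall y : H, exists x, hant x = y.

Section DoubleAntipode.
Context {k : fieldType} {H : hopf_data k} {HL : hopf_laws H}.
Context {HS : hopf_antipode_surj H}.
Implicit Types (x y z h : H) (f : dualv H).

Local Infix "·" := (@hmul k H) (at level 40, left associativity).
Local Notation S := (@hant k H).
Local Notation e := (@hcou k H).
Local Notation D := (drinfeld_double H).
Local Notation "s ∘ t" := (hmul (h := D) s t) (at level 40, left associativity).
Local Notation V := (@hantV k H).

Lemma hant_inj : injective S.
Proof. exact: lin_surj_inj hant_lin hant_surj. Qed.

Lemma hantK : cancel S V.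
Proof.
move=> x; rewrite /hantV -{1}(linfun_lin x hant_lin) lker0_lfunK //.
by apply/lker0P => y z; rewrite !(linfun_lin _ hant_lin); apply: hant_inj.
Qed.

Lemma hantVK : cancel V S.
Proof. by move=> x; have [y <-] := hant_surj x; rewrite hantK. Qed.

Lemma hantV_lin : lin V.
Proof. by move=> a u v; rewrite /hantV linearP. Qed.

Lemma hantVM x y : V (x · y) = V y · V x.
Proof. by apply: hant_inj; rewrite hantM !hantVK. Qed.

Lemma hcouV x : e (V x) = e x.
Proof. by rewrite -[in RHS](hantVK x) hcouS. Qed.

Lemma sw2_V (X : vectType k) (F : H -> H -> X) : bil F -> forall x,
  sw2 (V x) F = sw2 x (fun a b => F (V b) (V a)).
Proof.
move=> bF x; rewrite -[in RHS](hantVK x).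
have lV := hantV_lin.
rewrite (sw2_S (F := fun a b => F (V b) (V a))); last by slin.
by apply: eq_sw2 => a b; rewrite !hantK.
Qed.

Definition Vd f : dualv H := functional (fun x => f (V x)).

Lemma VdE f x : Vd f x = f (V x).
Proof. by rewrite functional_lin //; have lV := hantV_lin; slin. Qed.

Lemma Vd_lin : lin Vd.
Proof. by move=> a f f'; apply/lfunP => x; rewrite !(VdE, lfunE) /= !lfunE /= !VdE. Qed.

Lemma Vd1 : Vd (hone (dual_hopf H)) = hone (dual_hopf H).
Proof. by apply/lfunP => x; rewrite VdE !doneE hcouV. Qed.

Lemma dblS_pure h f : hant (tpure h f : D) = fd (Vd f) ∘ fb (S h).
Proof.
rewrite /= tliftp //; have [l1 l2] := @dbl_mul_bil k H HL; split=> [g|h'].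
  by move=> a u v; rewrite hant_lin tpure_linl; exact: l2.
by move=> a u v; rewrite -/(Vd _) Vd_lin tpure_linr; exact: l1.
Qed.

Lemma dblS_lin : lin (@hant k D).
Proof. exact: tlift_is_linear. Qed.

Lemma dblS_fb h : hant (fb h : D) = fb (S h).
Proof. by rewrite /fb dblS_pure Vd1 fd1 dbl_mul1l. Qed.

Lemma dblS_fd f : hant (fd f : D) = fd (Vd f).
Proof. by rewrite /fd dblS_pure hant1 fb1 dbl_mul1r. Qed.

Lemma dblS_fbfd h f : hant (fb h ∘ fd f : D) = hant (fd f : D) ∘ hant (fb h : D).
Proof. by rewrite fbfd dblS_pure dblS_fb dblS_fd. Qed.

Lemma fdfbE f h : fd f ∘ fb h =
  sw2 h (fun p v => sw2 v (fun q r => tpure q (functional (fun x => f (p · x · S r))))).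
Proof.
apply: dev_inj => x; rewrite dev_fdfb /csw.
have l : lin (fun t : tens H (dualv H) => dev t x) by slin.
rewrite (sw2_lin l); apply: eq_sw2 => p v.
rewrite (sw2_lin l); apply: eq_sw2 => q r.
by rewrite dev_pure functional_lin //; slin.
Qed.

(** Here anti-multiplicativity meets the cross relation. Straightening before and after applying the
    antipode produces five legs of [h], arranged as [f (p · S a · V x · c · S r)] times [S b]; the
    pairs [p · S a] and [c · S r] cancel. *)
Lemma dblS_fdfb f h : hant (fd f ∘ fb h : D) = hant (fb h : D) ∘ hant (fd f : D).
Proof.
have lV := hantV_lin; rewrite dblS_fb dblS_fd fbfd; apply: dev_inj => x.
rewrite fdfbE dev_pure VdE.
have l : lin (fun t : D => dev (hant t) x) by apply: dev_linl; exact: dblS_lin.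
rewrite (sw2_lin l).
transitivity (sw2 h (fun p v => sw2 v (fun w r => sw2 w (fun a z => sw2 z (fun b c =>
   (f (p · (S a · V x · c) · S r) : k) *: S b))))).
  apply: eq_sw2 => p v; rewrite (sw2_lin l); apply: eq_sw2 => q r.
  rewrite dblS_pure dev_fdfb /csw.
  rwb (sw2_S (F := fun u1 v => sw2 v (fun u2 u3 =>
     (Vd (functional (fun x0 => f (p · x0 · S r))) (u1 · x · S u3) : k) *: u2))).
  transitivity (sw2 q (fun w c => sw2 w (fun a b =>
     (f (p · (S a · V x · c) · S r) : k) *: S b))).
    apply: eq_sw2 => w c.
    rwb (sw2_S (F := fun u2 u3 =>
      (Vd (functional (fun x0 => f (p · x0 · S r))) (S c · x · S u3) : k) *: u2)).
    apply: eq_sw2 => a b; rewrite VdE functional_lin; last by slin.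
    by rewrite !hantVM !hantK !hmulA.
  by rwb (sw_assoc (F := fun a b c => (f (p · (S a · V x · c) · S r) : k) *: S b)).
rwb (sw_assoc5 (K := fun p a b c r => (f (p · (S a · V x · c) · S r) : k) *: S b)).
transitivity (sw2 h (fun v w => sw2 w (fun b z => (e v : k) *: ((e z : k) *: ((f (V x) : k) *: S b))))).
  apply: eq_sw2 => v w; apply: eq_sw2 => b z.
  transitivity (sw2 v (fun p a => sw2 z (fun c r => (f (p · S a · V x · (c · S r)) : k) *: S b))).
    by do 2!apply: eq_sw2 => ? ?; rewrite !hmulA.
  transitivity (sw2 v (fun p a => (e z : k) *: ((f (p · S a · V x) : k) *: S b))).
    apply: eq_sw2 => p a; rwb (sw2_Sr (f := fun y => (f (p · S a · V x · y) : k) *: S b)).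
    by rewrite hmul1r.
  rwb (sw2_Sr (f := fun y => (e z : k) *: ((f (y · V x) : k) *: S b))).
  by rewrite hmul1l.
transitivity (sw2 h (fun v w => (e v : k) *: ((f (V x) : k) *: S w))).
  apply: eq_sw2 => v w; transitivity (sw2 w (fun b z => (e z : k) *: ((e v : k) *: ((f (V x) : k) *: S b)))).
    by apply: eq_sw2 => b z; rewrite !scalerA; congr (_ *: _); rewrite [X in X * _]mulrC.
  by rwb (sw2_er (f := fun b => (e v : k) *: ((f (V x) : k) *: S b))).
by rwb (sw2_el (f := fun w => (f (V x) : k) *: S w)).
Qed.

Lemma dblS_fbM h h' : hant (fb h ∘ fb h' : D) = hant (fb h' : D) ∘ hant (fb h : D).
Proof. by rewrite !dblS_fb !fbM -hantM dblS_fb. Qed.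

Lemma dblS_fdM f f' : hant (fd f ∘ fd f' : D) = hant (fd f' : D) ∘ hant (fd f : D).
Proof.
rewrite !dblS_fd !fdM dblS_fd; congr fd; apply/lfunP => x.
rewrite VdE !dmulE (sw2_V (X := k^o) (F := fun a b => f' a * f b : k^o)); last by slin.
by apply: eq_sw2 => a b; rewrite !VdE mulrC.
Qed.

Lemma dblS1 : hant (hone D) = hone D.
Proof. by rewrite -[hone D]fb1 dblS_fb hant1. Qed.

Lemma dblSM (s t : D) : hant (s ∘ t) = hant t ∘ hant s.
Proof.
have lS := dblS_lin; have bm := @dbl_mul_bil k H HL.
have B1 h (r : D) : hant (fb h ∘ r) = hant r ∘ hant (fb h : D).
  move: r; apply: tens_ext; [by slin | by slin | move=> h' f'].
  by rewrite -fbfd dbl_mulA fbM !dblS_fbfd -fbM dblS_fbM dbl_mulA.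
have B2 f (r : D) : hant (r ∘ fd f) = hant (fd f : D) ∘ hant r.
  move: r; apply: tens_ext; [by slin | by slin | move=> h' f'].
  by rewrite -fbfd -dbl_mulA fdM !dblS_fbfd -fdM dblS_fdM dbl_mulA.
have B3 f (r : D) : hant (fd f ∘ r) = hant r ∘ hant (fd f : D).
  move: r; apply: tens_ext; [by slin | by slin | move=> h' f'].
  by rewrite -fbfd dbl_mulA B2 dblS_fdfb dblS_fbfd dbl_mulA.
move: s; apply: tens_ext; [by slin | by slin | move=> h f].
by rewrite -fbfd -dbl_mulA B1 B3 dblS_fbfd dbl_mulA.
Qed.

Lemma dblS_surj (t : D) : exists s : D, hant s = t.
Proof.
have lS := dblS_lin; have bm := @dbl_mul_bil k H HL.
have l1 := @fb_lin k H; have l2 := @fd_lin k H; have lV := hantV_lin.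
(* The antipode reverses this product by [dblS_fdfb] and undoes both twists, which gives back
   [fb h ∘ fd f]. *)
exists (tlift (fun h f => (fd (functional (fun x => f (S x))) ∘ fb (V h) : D)) t).
move: t; apply: tens_ext => [||h f].
- by apply: (lin_comp lS); slin.
- by slin.
rewrite tliftp; last by slin.
rewrite dblS_fdfb dblS_fb dblS_fd hantVK fbfd; congr (tpure _ _).
by apply/lfunP => x; rewrite VdE functional_lin ?hantVK //; slin.
Qed.

End DoubleAntipode.

(** * The bosonization *)

Section AtGrp.
Variables (k : fieldType) (gT : finGroupType) (W : vectType k).

Lemma at_grp_dec (a : {ffun gT -> W}) : a = \sum_x at_grp (a x) x.
Proof.
apply/ffunP => y; rewrite sum_ffunE (bigD1 y) //= big1 ?addr0 => [|z nzy].
  by rewrite ffunE eqxx.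
by rewrite ffunE eq_sym (negPf nzy).
Qed.

Lemma ffun_ext (X : lmodType k) (f g : {ffun gT -> W} -> X) :
  lin f -> lin g -> (forall w x, f (at_grp w x) = g (at_grp w x)) -> f =1 g.
Proof.
move=> lf lg fg a; rewrite (at_grp_dec a) (lin_bigsum lf) (lin_bigsum lg).
by apply: eq_bigr => x _.
Qed.

Lemma sum_at_grp (X : zmodType) (F : gT -> W -> X) w x :
  (forall y, F y 0 = 0) -> \sum_y F y (at_grp w x y) = F x w.
Proof.
move=> F0; rewrite (bigD1 x) //= big1 ?addr0 => [|y nyx]; rewrite ffunE ?eqxx //.
by rewrite (negPf nyx).
Qed.

End AtGrp.

Section Bosonization.
Variables (k : fieldType) (gT : finGroupType) (V : vectType k).
Variables (Y : yd_struct gT V) (N : nichols_algebra Y).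
Implicit Types (X : vectType k).

Local Notation act := (yd_act (nyd N)).
Local Notation co := (yd_co (nyd N)).
Local Notation H := (bosonization N).
Local Notation "b # x" := (at_grp b x : {ffun gT -> N}) (at level 38).
Local Notation cop := (ncop N).
Local Notation e := (ncou N).

Lemma tlift_cop_act X (G : N -> N -> X) : bil G -> forall g (b : N),
  tlift G (cop (act g b)) = tlift (fun b1 b2 => G (act g b1) (act g b2)) (cop b).
Proof.
move=> bG g b; rewrite nact_cop tlift_tlift; apply: eq_tlift => b1 b2.
by rewrite tliftp.
Qed.

Lemma tlift_cop_co X (G : N -> N -> X) : bil G -> forall g (b : N),
  tlift G (cop (co g b)) =
  tlift (fun b1 b2 => \sum_h G (co h b1) (co (h^-1 * g)%g b2)) (cop b).
Proof.
move=> bG g b; rewrite nco_cop tlift_tlift; apply: eq_tlift => b1 b2.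
have l : lin (tlift G) by slin.
by rewrite (lin_bigsum l); apply: eq_bigr => h _; rewrite tliftp.
Qed.

Lemma tlift_cop_mul X (G : N -> N -> X) : bil G -> forall a b : N,
  tlift G (cop (a * b)) = tlift (fun a1 a2 => tlift (fun b1 b2 =>
    \sum_h G (a1 * act h b1) (co h a2 * b2)) (cop b)) (cop a).
Proof.
move=> bG a b; rewrite ncop_mul tlift_tlift; apply: eq_tlift => a1 a2.
rewrite tlift_tlift; apply: eq_tlift => b1 b2.
have l : lin (tlift G) by slin.
by rewrite (lin_bigsum l); apply: eq_bigr => h _; rewrite tliftp.
Qed.

Lemma sum_co (X : zmodType) (G : gT -> N -> X) r (c : N) :
  (forall p, G p 0 = 0) -> \sum_p G p (co p (co r c)) = G r (co r c).
Proof.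
move=> G0; rewrite (bigD1 r) //= big1 ?addr0 => [|p npr]; rewrite yd_coassoc ?eqxx //.
by rewrite (negPf npr).
Qed.

Lemma bos_mul_bil : bil (@hmul k H).
Proof. by rewrite /= /bos_mul; slin. Qed.

Lemma bos_mul_pure (b : N) x (c : N) y : bos_mul (b # x) (c # y) = (b * act x c) # (x * y)%g.
Proof.
rewrite /bos_mul.
under eq_bigr => x' _.
  rewrite (sum_at_grp (F := fun y' c' => ((b # x) x' * act x' c') # (x' * y')%g)).
    over.
  by move=> z; rewrite linear0 mulr0; apply: (lin0 (f := fun b : N => b # _)); slin.
rewrite (sum_at_grp (F := fun x' b' => (b' * act x' c) # (x' * y)%g)) // => z.
by rewrite mul0r; apply: (lin0 (f := fun b : N => b # _)); slin.
Qed.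

Lemma bos_cop_lin : lin (@hcop k H).
Proof. by rewrite /=; slin. Qed.

Lemma bos_cop_pure (b : N) x : hcop (b # x : H) =
  tlift (fun b1 b2 => \sum_h tpure (b1 # (h * x)%g : H) (co h b2 # x : H)) (cop b).
Proof.
rewrite /= (sum_at_grp (F := fun x b => tlift (fun b1 b2 =>
  \sum_h tpure (b1 # (h * x)%g : H) (co h b2 # x : H)) (cop b))) // => y.
by rewrite linear0; apply: (lin0 (tlift_is_linear _)).
Qed.

Lemma bos_sw2 X (F : H -> H -> X) : bil F -> forall (b : N) x,
  sw2 (b # x : H) F = tlift (fun b1 b2 => \sum_h F (b1 # (h * x)%g) (co h b2 # x)) (cop b).
Proof.
move=> bF b x; rewrite /sw2 bos_cop_pure tlift_tlift; apply: eq_tlift => b1 b2.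
have l : lin (tlift F) by slin.
by rewrite (lin_bigsum l); apply: eq_bigr => h _; rewrite tliftp.
Qed.

Lemma bos_mulA (a b c : H) : hmul a (hmul b c) = hmul (hmul a b) c.
Proof.
have bm := bos_mul_bil.
move: a; apply: ffun_ext; [by slin | by slin | move=> a x].
move: b; apply: ffun_ext; [by slin | by slin | move=> b y].
move: c; apply: ffun_ext; [by slin | by slin | move=> c z].
by rewrite /= !bos_mul_pure nact_mul yd_actM mulrA mulgA.
Qed.

Lemma bos_mul1l (a : H) : hmul (hone H) a = a.
Proof.
have bm := bos_mul_bil.
move: a; apply: ffun_ext; [by slin | by slin | move=> a x].
by rewrite /= bos_mul_pure mul1r mul1g yd_act1.
Qed.

Lemma bos_mul1r (a : H) : hmul a (hone H) = a.
Proof.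
have bm := bos_mul_bil.
move: a; apply: ffun_ext; [by slin | by slin | move=> a x].
by rewrite /= bos_mul_pure nact_one mulr1 mulg1.
Qed.

Lemma bos_coassoc (a : H) :
  sw2 a (fun a b => sw2 a (fun a1 a2 => tpure a1 (tpure a2 b))) =
  sw2 a (fun a b => sw2 b (fun b1 b2 => tpure a (tpure b1 b2))).
Proof.
have lc := bos_cop_lin.
move: a; apply: ffun_ext; [by rewrite /sw2; slin | by rewrite /sw2; slin | move=> b x].
do 2!(rewrite bos_sw2; last by rewrite /sw2; slin).
pose F (a b c : H) := tpure a (tpure b c).
have tF : tril F by rewrite /F; slin.
transitivity (tlift (fun b1 b2 => tlift (fun b11 b12 => \sum_h \sum_p
  F (b11 # (p * (h * x))%g) (co p b12 # (h * x)%g) (co h b2 # x)) (cop b1)) (cop b)).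
  apply: eq_tlift => b1 b2; rewrite tlift_bigsum; apply: eq_bigr => h _.
  by rewrite bos_sw2 //; slin.
rewrite (tlift_coassoc (F := fun b11 b12 b2 => \sum_h \sum_p
  F (b11 # (p * (h * x))%g) (co p b12 # (h * x)%g) (co h b2 # x))); first last.
- exact: ncoassoc.
- by slin.
apply: eq_tlift => b1 b2; symmetry.
transitivity (\sum_h tlift (fun c1 c2 => \sum_q
    F (b1 # (h * x)%g) (co q c1 # (q^-1 * h * x)%g) (co (q^-1 * h)%g c2 # x)) (cop b2)).
  apply: eq_bigr => h _; rewrite bos_sw2; last by rewrite /sw2; slin.
  rewrite (tlift_cop_co (G := fun c1 c2 =>
    \sum_p tpure (b1 # (h * x)%g : H) (tpure (c1 # (p * x)%g : H) (co p c2 # x : H)))); last by slin.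
  apply: eq_tlift => c1 c2; apply: eq_bigr => q _.
  rewrite (sum_co (G := fun p c => tpure (b1 # (h * x)%g : H)
    (tpure (co q c1 # (p * x)%g : H) (c # x : H)))) // => p.
  by apply: (lin0 (f := fun c : N => tpure _ (tpure _ (c # x : H)))); slin.
rewrite -tlift_bigsum; apply: eq_tlift => c1 c2.
rewrite exchange_big [RHS]exchange_big; apply: eq_bigr => q _ /=.
(* On one side [h] is the joint coaction degree of the last two legs, on the other that of the last
   leg alone. *)
rewrite (reindex_inj (mulgI q)); apply: eq_bigr => h _.
by rewrite mulKg mulgA.
Qed.

Lemma bos_cou_lin : lin (@hcou k H : H -> k^o).
Proof. by rewrite /=; slin. Qed.

Lemma bos_cou_pure (b : N) x : hcou (b # x : H) = e b.
Proof. by rewrite /= (sum_at_grp (F := fun _ b => e b)) // => y; rewrite linear0. Qed.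

Lemma bos_cou_l (a : H) : sw2 a (fun a b => (hcou a : k) *: b) = a.
Proof.
have lc := bos_cop_lin; have le := bos_cou_lin.
move: a; apply: ffun_ext; [by rewrite /sw2; slin | by rewrite /sw2; slin | move=> b x].
rewrite bos_sw2; last by rewrite /sw2; slin.
rewrite -[in RHS](ncou_l b).
have l : lin (fun b : N => b # x : H) by slin.
rewrite (lin_tlift _ _ l); apply: eq_tlift => b1 b2.
rewrite -[in RHS](yd_counit (nyd N) b2) (linZ l) (lin_bigsum l) scaler_sumr.
by apply: eq_bigr => h _; cbv beta; rewrite bos_cou_pure.
Qed.

Lemma bos_cou_r (a : H) : sw2 a (fun a b => (hcou b : k) *: a) = a.
Proof.
have lc := bos_cop_lin; have le := bos_cou_lin.
move: a; apply: ffun_ext; [by rewrite /sw2; slin | by rewrite /sw2; slin | move=> b x].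
rewrite bos_sw2; last by rewrite /sw2; slin.
rewrite -[in RHS](ncou_r b).
have l : lin (fun b : N => b # x : H) by slin.
rewrite (lin_tlift _ _ l); apply: eq_tlift => b1 b2.
rewrite (linZ l) (bigD1 1%g) // big1 => [|h nh]; cbv beta.
  by rewrite bos_cou_pure nco_cou eqxx mul1g /= addr0.
by rewrite bos_cou_pure nco_cou (negPf nh) scale0r.
Qed.

Lemma bos_cop1 : hcop (hone H) = tpure (hone H) (hone H).
Proof.
rewrite bos_cop_pure ncop_one tliftp; last by slin.
rewrite (bigD1 1%g) //= big1 ?addr0 => [|h nh]; first by rewrite nco_one eqxx mul1g.
rewrite nco_one (negPf nh).
by apply: (lin0 (f := fun c : N => tpure _ (c # _ : H))); slin.
Qed.

Lemma bos_copM (a b : H) : hcop (hmul a b) =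
  sw2 a (fun a1 a2 => sw2 b (fun b1 b2 => tpure (hmul a1 b1) (hmul a2 b2))).
Proof.
have lc := bos_cop_lin; have bm := bos_mul_bil.
move: a; apply: ffun_ext; [by rewrite /sw2; slin | by rewrite /sw2; slin | move=> b1 x].
move: b; apply: ffun_ext; [by rewrite /sw2; slin | by rewrite /sw2; slin | move=> c y].
rewrite bos_sw2; last by rewrite /sw2; slin.
rewrite -[hmul _ _]/(bos_mul _ _) bos_mul_pure bos_cop_pure.
rewrite (tlift_cop_mul (G := fun b1 b2 => \sum_h
  tpure (b1 # (h * (x * y))%g : H) (co h b2 # (x * y)%g : H))); last by slin.
apply: eq_tlift => b2 b3.
rewrite (tlift_cop_act (G := fun c1 c2 => \sum_h \sum_h0
   tpure ((b2 * act h c1) # (h0 * (x * y))%g : H) (co h0 (co h b3 * c2) # (x * y)%g : H))); last by slin.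
transitivity (\sum_h tlift (fun c1 c2 => \sum_p tpure
   (hmul (b2 # (h * x)%g : H) (c1 # (p * y)%g : H))
   (hmul (co h b3 # x : H) (co p c2 # y : H))) (cop c)); last first.
  by apply: eq_bigr => h _; rewrite bos_sw2 //; slin.
rewrite -tlift_bigsum; apply: eq_tlift => c1 c2; apply: eq_bigr => h _.
(* The sum runs over the coaction degree of the product [co h b3 * act x c2]. For [c2] of degree p
   this is h x p x^-1, by the Yetter-Drinfeld condition; this matches the degree with the group part
   of the product in the bosonization. *)
rewrite (reindex_inj (mulgI (h * x)%g)) (reindex_inj (mulIg x^-1%g)).
apply: eq_bigr => p _.
rewrite -[hmul _ _]/(bos_mul _ _) -[hmul (co h b3 # x : H) _]/(bos_mul _ _) !bos_mul_pure.
rewrite -yd_actM; congr (tpure (_ # _) (_ # _)); first by rewrite !mulgA mulgKV.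
rewrite nco_mul (sum_co (G := fun q c => c * co (q^-1 * _)%g (act x c2))); last first.
  by move=> q; rewrite mul0r.
by rewrite yd_compat; congr (_ * co _ _); rewrite !mulgA mulVg mul1g.
Qed.

End Bosonization.

Section Bosonization.
Variables (k : fieldType) (gT : finGroupType) (V : vectType k).
Variables (Y : yd_struct gT V) (N : nichols_algebra Y).
Implicit Types (X : vectType k).

Local Notation act := (yd_act (nyd N)).
Local Notation co := (yd_co (nyd N)).
Local Notation H := (bosonization N).
Local Notation "b # x" := (at_grp b x : {ffun gT -> N}) (at level 38).
Local Notation cop := (ncop N).
Local Notation e := (ncou N).

Lemma bos_cou1 : hcou (hone H) = 1.
Proof. by rewrite bos_cou_pure ncou_one. Qed.

Lemma bos_couM (a b : H) : hcou (hmul a b) = hcou a * hcou b.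
Proof.
have le := @bos_cou_lin _ _ _ _ N; have bm := @bos_mul_bil _ _ _ _ N.
suff : (fun a => hcou (hmul a b) : k^o) =1 (fun a => hcou a * hcou b : k^o) by apply.
apply: ffun_ext; [by slin | by slin | move=> {a} a x].
suff : (fun b => hcou (hmul (a # x : H) b) : k^o) =1
       (fun b => hcou (a # x : H) * hcou b : k^o) by apply.
apply: ffun_ext; [by slin | by slin | move=> {b} b y].
rewrite -[hmul _ _]/(bos_mul _ _) bos_mul_pure !bos_cou_pure ncou_mul.
by rewrite nact_cou.
Qed.

Lemma bos_ant_lin : lin (@hant k H).
Proof. by have bm := @bos_mul_bil _ _ _ _ N; rewrite /= /bos_mul; slin. Qed.

Lemma bos_ant_pure (b : N) x : hant (b # x : H) =
  \sum_h hmul (1 # (h * x)^-1%g : H) (nant N (co h b) # 1%g : H).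
Proof.
have bm := @bos_mul_bil _ _ _ _ N.
rewrite /= (sum_at_grp (F := fun x b => \sum_h
  bos_mul (1 # (h * x)^-1%g) (nant N (co h b) # 1%g))) // => y.
rewrite big1 // => h _; rewrite !linear0.
by apply: (lin0 (f := fun c : N => hmul (1 # _ : H) (c # 1%g : H))); slin.
Qed.

Lemma bos_ant_l (a : H) :
  sw2 a (fun a b => hmul (hant a) b) = hcou a *: hone H.
Proof.
have lc := @bos_cop_lin _ _ _ _ N; have le := @bos_cou_lin _ _ _ _ N.
have bm := @bos_mul_bil _ _ _ _ N; have lS := bos_ant_lin.
move: a; apply: ffun_ext; [by rewrite /sw2; slin | by slin | move=> b x].
rewrite bos_sw2; last by slin.
(* Grouping by the joint coaction degree [q] of the two legs produces the antipode identity of [N]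
   at [co q b]; the counit then leaves only q = 1. *)
transitivity (tlift (fun b1 b2 => \sum_q hmul (1 # (q * x)^-1%g : H)
   ((\sum_h nant N (co h b1) * co (h^-1 * q)%g b2) # x : H)) (cop b)).
  apply: eq_tlift => b1 b2.
  have l z : lin (fun c : N => hmul (1 # z : H) (c # x : H)) by slin.
  under [RHS]eq_bigr => q _ do rewrite (lin_bigsum (l _)).
  under [LHS]eq_bigr => h _.
    rewrite bos_ant_pure (lin_bigsum (f := fun z => hmul z _)); last by slin.
    over.
  cbv beta; rewrite exchange_big [RHS]exchange_big; apply: eq_bigr => p _ /=.
  rewrite [RHS](reindex_inj (mulgI p)); apply: eq_bigr => h _.
  rewrite mulKg -[LHS]bos_mulA; congr (hmul (1 # _ : H) _); first by rewrite mulgA.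
  by rewrite /= bos_mul_pure yd_act1 mul1g.
rewrite tlift_bigsum.
transitivity (\sum_q hmul (1 # (q * x)^-1%g : H) (((e (co q b) : k) *: (1 : N)) # x : H)).
  apply: eq_bigr => q _; rewrite -nant_l.
  have l : lin (fun c : N => hmul (1 # (q * x)^-1%g : H) (c # x : H)) by slin.
  rewrite (lin_tlift _ _ l) (tlift_cop_co (G := fun b c =>
     hmul (1 # (q * x)^-1%g : H) ((nant N b * c) # x : H))); last by slin.
  by apply: eq_tlift => b1 b2; rewrite (lin_bigsum l).
rewrite (bigD1 1%g) // big1 => [|q nq]; rewrite nco_cou.
  rewrite eqxx; etransitivity; first exact: addr0.
  rewrite mul1g /= bos_mul_pure linearZ /= nact_one mul1r mulVg.
  rewrite (linZ (f := fun c : N => c # 1%g)); last by slin.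
  by rewrite -[X in _ = X *: _]/(hcou (b # x : H)) bos_cou_pure.
by rewrite (negPf nq) scale0r; apply: (lin0 (f := fun c : N => hmul (1 # _ : H) (c # x : H))); slin.
Qed.

Lemma bos_ant_r (a : H) :
  sw2 a (fun a b => hmul a (hant b)) = hcou a *: hone H.
Proof.
have lc := @bos_cop_lin _ _ _ _ N; have le := @bos_cou_lin _ _ _ _ N.
have bm := @bos_mul_bil _ _ _ _ N; have lS := bos_ant_lin.
move: a; apply: ffun_ext; [by rewrite /sw2; slin | by slin | move=> b x].
rewrite bos_sw2; last by slin.
have l : lin (fun c : N => c # 1%g : H) by slin.
transitivity (tlift (fun b1 b2 : N => (b1 * nant N b2) # 1%g : H) (cop b)).
  apply: eq_tlift => b1 b2.
  transitivity (\sum_h ((b1 * nant N (co h b2)) # 1%g : H)).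
    apply: eq_bigr => h _; rewrite bos_ant_pure.
    rewrite (sum_co (G := fun p c => hmul (1 # (p * x)^-1%g : H) (nant N c # 1%g : H))).
      rewrite bos_mulA /= !bos_mul_pure nact_one mulr1 mulgV yd_act1 mulg1 //.
    move=> p; rewrite linear0.
    by apply: (lin0 (f := fun c : N => hmul (1 # _ : H) (c # 1%g : H))); slin.
  rewrite -[in RHS](yd_counit (nyd N) b2) linear_sum mulr_sumr.
  by rewrite (lin_bigsum l).
rewrite -(lin_tlift _ _ l) nant_r.
by rewrite (linZ l) bos_cou_pure.
Qed.

Global Instance bos_laws : hopf_laws H := {|
  hmul_bil := @bos_mul_bil _ _ _ _ N;
  hcop_lin := @bos_cop_lin _ _ _ _ N;
  hcou_lin := @bos_cou_lin _ _ _ _ N;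
  hant_lin := bos_ant_lin;
  hmulA := @bos_mulA _ _ _ _ N;
  hmul1l := @bos_mul1l _ _ _ _ N;
  hmul1r := @bos_mul1r _ _ _ _ N;
  hcoassoc := @bos_coassoc _ _ _ _ N;
  hcou_l := @bos_cou_l _ _ _ _ N;
  hcou_r := @bos_cou_r _ _ _ _ N;
  hcop1 := @bos_cop1 _ _ _ _ N;
  hcopM := @bos_copM _ _ _ _ N;
  hcou1 := bos_cou1;
  hcouM := bos_couM;
  hant_l := bos_ant_l;
  hant_r := bos_ant_r |}.

Lemma bos_mulE (b : N) x (c : N) y :
  hmul (b # x : H) (c # y : H) = (b * act x c) # (x * y)%g.
Proof. exact: bos_mul_pure. Qed.

Lemma bos_antG x : hant (1 # x : H) = 1 # x^-1%g.
Proof.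
rewrite bos_ant_pure (bigD1 1%g) // big1 => [|h nh]; rewrite nco_one.
  rewrite eqxx; etransitivity; first exact: addr0.
  rewrite bos_mulE mul1r mulg1 mul1g.
  suff -> : nant N 1 = 1 by rewrite nact_one.
  have := nant_l (1 : N); rewrite ncop_one tliftp; last by slin.
  by rewrite mulr1 ncou_one scale1r.
rewrite (negPf nh) linear0.
by apply: (lin0 (f := fun c : N => hmul (1 # _ : H) (c # 1%g : H))); slin.
Qed.

Lemma ncou_deg1 (v : N) : v \in ngr N 1 -> e v = 0.
Proof.
move=> /nprimitive pv; have := ncou_l v; rewrite pv.
have l : lin (tlift (fun b c : N => (e b : k) *: c)) by slin.
rewrite (linD l) !tliftp; [ | by slin..].
rewrite ncou_one scale1r => /(canRL (addrK _)); rewrite subrr => E.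
have l2 : lin (fun b : N => e b) by slin.
by have := congr1 e E; rewrite (linZ l2) ncou_one (lin0 l2) /GRing.scale /= mulr1.
Qed.

Lemma nant_deg1 (v : N) : v \in ngr N 1 -> nant N v = - v.
Proof.
move=> vN; have /nprimitive pv := vN; have := nant_l v; rewrite pv.
have l : lin (tlift (fun b c : N => nant N b * c)) by slin.
rewrite (linD l) !tliftp; [ | by slin..].
rewrite ncou_deg1 // scale0r mulr1.
suff -> : nant N 1 = 1 by rewrite mul1r => /eqP; rewrite addr_eq0 => /eqP.
have := nant_l (1 : N); rewrite ncop_one tliftp; last by slin.
by rewrite mulr1 ncou_one scale1r.
Qed.

(* The image of the antipode is closed under products and contains the
   generators 1 # x and v # 1 with v of degree one. *)
Global Instance bos_ant_surj : hopf_antipode_surj H.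
Proof.
pose im (a : H) := exists b, hant b = a.
have imL a (b c : H) : im b -> im c -> im (a *: b + c).
  by move=> [b' <-] [c' <-]; exists (a *: b' + c'); rewrite hant_lin.
have im0 : im 0 by exists 0; rewrite (lin0 hant_lin).
have imM b c : im b -> im c -> im (hmul b c).
  by move=> [b' <-] [c' <-]; exists (hmul c' b'); rewrite hantM.
have imG x : im (1 # x) by exists (1 # x^-1%g); rewrite bos_antG invgK.
have imV v : v \in ngr N 1 -> im (v # 1%g).
  move=> vN; rewrite -[v](yd_counit (nyd N)).
  rewrite (lin_bigsum (f := fun c : N => c # 1%g)); last by slin.
  apply: big_ind => //= [b c ib ic|h _]; first by rewrite -[b]scale1r; apply: imL.
  have vhN := ngr_co h vN.
  (* Primitivity gives [nant] the value -v in degree one, so the antipode of [v # 1] is - h^-1 v in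
     coaction degree h. *)
  have -> : co h v # 1%g = - hmul (1 # h : H) (hant (co h v # 1%g : H)).
    rewrite bos_ant_pure (sum_co (G := fun p c =>
      hmul (1 # (p * 1)^-1%g : H) (nant N c # 1%g : H))); last first.
      move=> p; rewrite linear0.
      by apply: (lin0 (f := fun c : N => hmul (1 # _ : H) (c # 1%g : H))); slin.
    rewrite nant_deg1 // mulg1 hmulA !bos_mulE nact_one !mulr1 mul1r mulgV yd_act1 mulg1.
    by rewrite -(linN (f := fun c : N => c # 1%g)) ?opprK //; slin.
  rewrite -scaleN1r -[_ *: _]addr0; apply: imL => //; apply: imM => //.
  by exists (co h v # 1%g).
pose P (b : N) := im (b # 1%g).
have sP : subspace P.
  split=> [|a b c Pb Pc]; rewrite /P.
    by rewrite (lin0 (f := fun c : N => c # 1%g)) //; slin.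
  have l : lin (fun c : N => c # 1%g) by slin.
  by rewrite l; apply: imL.
have PT b : P b.
  apply/(spannedP sP); move: b (memvf b); apply/subvP.
  rewrite -(ngenerated N); apply: agenv_sub_modl.
    rewrite -memvE; apply/(spannedP sP); exact: imG.
  apply/prodvP => v b vN /(spannedP sP) Pb; apply/(spannedP sP); rewrite /P.
  have -> : (v * b) # 1%g = hmul (v # 1%g : H) (b # 1%g : H).
    by rewrite bos_mulE yd_act1 mulg1.
  by apply: imM => //; apply: imV.
move=> a; rewrite (at_grp_dec a); apply: (big_ind im) => // [b c ib ic|x _].
  by rewrite -[b]scale1r; apply: imL.
have -> : a x # x = hmul (a x # 1%g : H) (1 # x : H).
  by rewrite bos_mulE yd_act1 mulr1 mul1g.
by apply: imM; [apply: PT | apply: imG].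
Qed.

End Bosonization.

(** * The double of the group *)

Section Group.
Variables (k : fieldType) (gT : finGroupType).
Local Notation K := (group_hopf k gT).
Local Notation grp := (@Defs.grp k gT).

Lemma at_grp1E (w : k^o) (x : gT) : at_grp w x = (w : k) *: grp x.
Proof.
apply/ffunP => y; rewrite !ffunE; case: (y == x); rewrite ?scaler0 //.
by rewrite /GRing.scale /= mulr1.
Qed.

Lemma grp_dec (a : K) : a = \sum_x (a x : k) *: grp x.
Proof. by rewrite [LHS]at_grp_dec; apply: eq_bigr => x _; rewrite at_grp1E. Qed.

Lemma grp_ext (X : lmodType k) (f g : K -> X) :
  lin f -> lin g -> (forall x, f (grp x) = g (grp x)) -> f =1 g.
Proof.
move=> lf lg fg; apply: ffun_ext => // w x; rewrite at_grp1E.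
by rewrite (linZ lf) (linZ lg) fg.
Qed.

Lemma grpE x y : grp x y = (y == x)%:R.
Proof. by rewrite ffunE; case: eqP. Qed.

Lemma sum_grp (X : lmodType k) (F : gT -> X) x : \sum_y (grp x y : k) *: F y = F x.
Proof.
rewrite (bigD1 x) //= big1 ?addr0 => [|y nyx]; rewrite grpE ?eqxx ?scale1r //.
by rewrite (negPf nyx) scale0r.
Qed.

Lemma grp_mul_bil : bil (@hmul k K).
Proof.
split=> w a u v; rewrite /= scaler_sumr -big_split; apply: eq_bigr => x _ /=;
  rewrite scaler_sumr -big_split; apply: eq_bigr => y _ /=;
  rewrite scalerA -scalerDl; congr (_ *: _); rewrite !ffunE.
  by rewrite mulrDl /GRing.scale /= mulrA.
by rewrite mulrDr /GRing.scale /= mulrCA.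
Qed.

Lemma grp_mul x y : hmul (grp x : K) (grp y : K) = grp (x * y)%g.
Proof.
transitivity (\sum_x' (grp x x' : k) *: \sum_y' (grp y y' : k) *: grp (x' * y')%g).
  by apply: eq_bigr => x' _; rewrite scaler_sumr; apply: eq_bigr => y' _; rewrite scalerA.
by rewrite sum_grp sum_grp.
Qed.

Lemma grp_cop_lin : lin (@hcop k K). Proof. by rewrite /=; slin. Qed.
Lemma grp_cou_lin : lin (@hcou k K : K -> k^o). Proof. by rewrite /=; slin. Qed.
Lemma grp_ant_lin : lin (@hant k K). Proof. by rewrite /=; slin. Qed.

Lemma grp_cop x : hcop (grp x : K) = tpure (grp x : K) (grp x : K).
Proof. exact: (sum_grp (fun x => tpure (grp x : K) (grp x : K))). Qed.

Lemma grp_ant x : hant (grp x : K) = grp x^-1%g.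
Proof. exact: (sum_grp (fun x => grp x^-1%g : K)). Qed.

Lemma grp_cou x : hcou (grp x : K) = 1.
Proof.
rewrite -[RHS](sum_grp (fun x => 1 : k^o) x).
by apply: eq_bigr => y _; rewrite /GRing.scale /= mulr1.
Qed.

Lemma grp_sw2 (X : vectType k) (F : K -> K -> X) : bil F -> forall x,
  sw2 (grp x : K) F = F (grp x) (grp x).
Proof. by move=> bF x; rewrite /sw2 grp_cop tliftp. Qed.

Global Instance grp_laws : hopf_laws K.
Proof.
have bm := grp_mul_bil; have lc := grp_cop_lin; have le := grp_cou_lin.
have lS := grp_ant_lin.
split=> //.
- move=> x y z; move: x; apply: grp_ext; [by slin | by slin | move=> x].
  move: y; apply: grp_ext; [by slin | by slin | move=> y].
  move: z; apply: grp_ext; [by slin | by slin | move=> z].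
  by rewrite !grp_mul mulgA.
- by apply: grp_ext; [by slin | by slin | move=> x]; rewrite grp_mul mul1g.
- by apply: grp_ext; [by slin | by slin | move=> x]; rewrite grp_mul mulg1.
- apply: grp_ext; [by rewrite /sw2; slin | by rewrite /sw2; slin | move=> x].
  by do !(rewrite grp_sw2; last by rewrite /sw2; slin).
- apply: grp_ext; [by rewrite /sw2; slin | by slin | move=> x].
  by rewrite grp_sw2; [rewrite grp_cou scale1r | slin].
- apply: grp_ext; [by rewrite /sw2; slin | by slin | move=> x].
  by rewrite grp_sw2; [rewrite grp_cou scale1r | slin].
- exact: grp_cop.
- move=> x y; move: x; apply: grp_ext; [by slin | by rewrite /sw2; slin | move=> x].
  move: y; apply: grp_ext; [by slin | by rewrite /sw2; slin | move=> y].
  rewrite grp_sw2; last by rewrite /sw2; slin.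
  by rewrite grp_sw2; [rewrite !grp_mul grp_cop | slin].
- exact: grp_cou.
- move=> x y; suff : (fun x => hcou (hmul x y) : k^o) =1 (fun x => hcou x * hcou y : k^o) by apply.
  apply: grp_ext; [by slin | by slin | move=> {}x].
  suff : (fun y => hcou (hmul (grp x : K) y) : k^o) =1 (fun y => hcou (grp x : K) * hcou y : k^o) by apply.
  by apply: grp_ext; [by slin | by slin | move=> {}y]; rewrite grp_mul !grp_cou mulr1.
- apply: grp_ext; [by rewrite /sw2; slin | by slin | move=> x].
  by rewrite grp_sw2; [rewrite grp_ant grp_mul mulVg grp_cou scale1r | slin].
- apply: grp_ext; [by rewrite /sw2; slin | by slin | move=> x].
  by rewrite grp_sw2; [rewrite grp_ant grp_mul mulgV grp_cou scale1r | slin].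
Qed.

Global Instance grp_ant_surj : hopf_antipode_surj K.
Proof.
move=> y; exists (hant y); have lS := grp_ant_lin.
by move: y; apply: grp_ext; [by slin | by slin | move=> x]; rewrite !grp_ant invgK.
Qed.

(* delta_x in k^G; below, dg g x is g delta_x. *)
Definition dl (x : gT) : dualv K := functional (fun a : K => a x).

Lemma dlE x (a : K) : dl x a = a x.
Proof. by rewrite functional_lin //; slin. Qed.

Lemma dual_grp_dec (f : dualv K) : f = \sum_x (f (grp x) : k) *: dl x.
Proof.
apply/lfunP => a; rewrite sum_lfunE [in LHS](grp_dec a) linear_sum.
by apply: eq_bigr => x _; rewrite linearZ scale_lfunE dlE /GRing.scale /= mulrC.
Qed.

Definition dg (g x : gT) : dbl_group k gT := tpure (grp g : K) (dl x).

Lemma dev_dg g x y : dev (dg g x) (grp y : K) = ((x == y)%:R : k) *: grp g.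
Proof. by rewrite dev_pure dlE grpE. Qed.

Lemma dg_ext (X : lmodType k) (f f' : dbl_group k gT -> X) :
  lin f -> lin f' -> (forall g x, f (dg g x) = f' (dg g x)) -> f =1 f'.
Proof.
move=> lf lf' e; apply: tens_ext => // u w; move: u.
have lt (w' : dualv K) := @tpure_linl k K (dualv K) w'.
apply: grp_ext => [a u v|a u v|g]; rewrite ?lt ?lf ?lf' //.
rewrite [w]dual_grp_dec; have lr := @tpure_linr k K (dualv K) (grp g : K).
rewrite !(lin_bigsum lr) (lin_bigsum lf) (lin_bigsum lf'); apply: eq_bigr => x _.
by rewrite !(linZ lr) (linZ lf) (linZ lf') e.
Qed.

Lemma dg_dec (t : dbl_group k gT) :
  t = \sum_x \sum_g (dev t (grp x : K) g : k) *: dg g x.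
Proof.
move: t; apply: dg_ext => [//||g x]; first by slin.
rewrite (bigD1 x) //= [X in _ + X]big1 ?addr0 => [|y nyx]; last first.
  rewrite big1 // => h _; rewrite dev_dg eq_sym (negPf nyx) scale0r.
  by rewrite ffunE scale0r.
by rewrite dev_dg eqxx scale1r sum_grp.
Qed.

End Group.

Section GroupLike.
Context {k : fieldType} {H : hopf_data k} {HL : hopf_laws H}.

Lemma csw_grouplike (X : vectType k) (F : H -> H -> X) (u x : H) :
  bil F -> hcop u = tpure u u -> csw u x F = F (hmul (hmul u x) (hant u)) u.
Proof.
move=> bF cu; rewrite /csw {1}/sw2 cu tliftp; last by slin.
by rewrite /sw2 cu tliftp //; slin.
Qed.

Definition twist (f : dualv H) (u : H) : dualv H :=
  functional (fun x => f (hmul (hmul u x) (hant u))).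

Lemma twistE f u x : twist f u x = f (hmul (hmul u x) (hant u)).
Proof. by rewrite functional_lin //; slin. Qed.

Lemma fdfb_grouplike (f : dualv H) (u : H) : hcop u = tpure u u ->
  hmul (fd f) (fb u) = tpure u (twist f u).
Proof.
move=> cu; apply: dev_inj => x; rewrite dev_fdfb (csw_grouplike _ _ cu); last by slin.
by rewrite dev_pure twistE.
Qed.

End GroupLike.

(** * The inclusion of D(G) into the double of the bosonization *)

Section FromDoubleGroup.
Variables (k : fieldType) (gT : finGroupType) (V : vectType k).
Variables (Y : yd_struct gT V) (N : nichols_algebra Y).
Implicit Types (X : vectType k).

Local Notation H := (bosonization N).
Local Notation "b # x" := (at_grp b x : {ffun gT -> N}) (at level 38).
Local Notation e := (ncou N).

Local Notation K := (group_hopf k gT).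
Local Notation DG := (dbl_group k gT).
Local Notation D := (dbl N).
Local Notation grp := (@Defs.grp k gT).

Definition ginc (h : K) : H := \sum_x (h x : k) *: (1 # x : H).

Lemma ginc_lin : lin ginc. Proof. by rewrite /ginc; slin. Qed.

Lemma ginc_grp x : ginc (grp x) = 1 # x.
Proof. exact: (sum_grp (fun x => 1 # x : H)). Qed.

Lemma gincE h x : (ginc h : {ffun gT -> N}) x = (h x : k) *: 1.
Proof. exact: sum_at_grpE. Qed.

Lemma gincM (h h' : K) : ginc (hmul h h') = hmul (ginc h) (ginc h').
Proof.
have li := ginc_lin.
move: h; apply: grp_ext; [by slin | by slin | move=> x].
move: h'; apply: grp_ext; [by slin | by slin | move=> y].
by rewrite grp_mul !ginc_grp bos_mulE nact_one mulr1.
Qed.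

Lemma ginc_ant (h : K) : hant (ginc h) = ginc (hant h).
Proof.
have li := ginc_lin; move: h; apply: grp_ext; [by slin | by slin | move=> x].
by rewrite ginc_grp bos_antG grp_ant ginc_grp.
Qed.

Lemma bos_copG x : hcop (1 # x : H) = tpure (1 # x : H) (1 # x : H).
Proof.
rewrite bos_cop_pure ncop_one tliftp; last by slin.
rewrite (bigD1 1%g) // big1 => [|h nh]; rewrite nco_one.
  by rewrite eqxx mul1g; apply: addr0.
by rewrite (negPf nh); apply: (lin0 (f := fun c : N => tpure _ (c # _ : H))); slin.
Qed.

(* The inclusion of k^G in (N # kG)^* used in from_dbl_group. *)
Definition jf (f : dualv K) : dualv H :=
  functional (fun a : H => \sum_x (e ((a : {ffun gT -> N}) x) : k) * f (grp x)).

Lemma jfE (f : dualv K) (a : H) :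
  jf f a = \sum_x (e ((a : {ffun gT -> N}) x) : k) * f (grp x).
Proof. by rewrite functional_lin //; slin. Qed.

Lemma jf_pure (f : dualv K) (b : N) x : jf f (b # x : H) = (e b : k) * f (grp x).
Proof.
rewrite jfE (sum_at_grp (F := fun x b => (e b : k) * f (grp x))) // => y.
by rewrite linear0 mul0r.
Qed.

Lemma jf_lin : lin jf.
Proof. by rewrite /jf; slin. Qed.

Lemma dual_bos_ext (f f' : dualv H) :
  (forall (b : N) x, f (b # x : H) = f' (b # x : H)) -> f = f'.
Proof. by move=> ff'; apply/lfunP; apply: ffun_ext => //; slin. Qed.

Lemma jf1 : jf (hone (dual_hopf K)) = hone (dual_hopf H).
Proof.
by apply: dual_bos_ext => b x; rewrite jf_pure !doneE grp_cou mulr1 bos_cou_pure.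
Qed.

Lemma jfM (f f' : dual_hopf K) :
  jf (hmul f f') = hmul (jf f : dual_hopf H) (jf f' : dual_hopf H).
Proof.
apply: dual_bos_ext => b x; rewrite jf_pure !dmulE.
rewrite (grp_sw2 (X := k^o) (F := fun a b => (f : dualv K) a * (f' : dualv K) b : k^o)); last by slin.
rewrite (bos_sw2 (X := k^o) (F := fun a b => jf f a * jf f' b : k^o)); last by slin.
rewrite -[b in LHS]ncou_r.
pose c : k := (f : dualv K) (grp x) * (f' : dualv K) (grp x).
have l : lin (fun b : N => (e b : k) * c : k^o) by slin.
etransitivity; first exact: (lin_tlift _ _ l).
apply: eq_tlift => b1 b2; cbv beta.
rewrite (bigD1 1%g) //= big1 => [|h nh]; rewrite !jf_pure nco_cou.
  rewrite eqxx mul1g addr0 linearZ /= /c [in RHS]mulrACA; congr (_ * _).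
  by rewrite /GRing.scale /= mulrC.
by rewrite (negPf nh) mul0r mulr0.
Qed.

Lemma from_lin : lin (@from_dbl_group _ _ _ _ N).
Proof. exact: tlift_is_linear. Qed.

Lemma from_pure (h : K) (f : dualv K) :
  from_dbl_group N (tpure h f) = tpure (ginc h) (jf f).
Proof.
have li := ginc_lin; have lj := jf_lin.
by rewrite /from_dbl_group (tliftp (F := fun h f => tpure (ginc h) (jf f))) //; slin.
Qed.

Lemma from_fbfd (h : K) (f : dualv K) :
  from_dbl_group N (hmul (fb h) (fd f)) = hmul (fb (ginc h)) (fd (jf f)).
Proof. by rewrite !fbfd from_pure. Qed.

Lemma from_fb (h : K) : from_dbl_group N (fb h) = fb (ginc h).
Proof. by rewrite /fb from_pure jf1. Qed.

Lemma from_fd (f : dualv K) : from_dbl_group N (fd f) = fd (jf f).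
Proof. by rewrite /fd from_pure /= -[grp 1%g]/(grp 1%g) ginc_grp. Qed.

Lemma from1 : from_dbl_group N (hone DG) = hone D.
Proof. by rewrite -[hone DG]fb1 from_fb ginc_grp. Qed.

Lemma from_fdfb (h : K) (f : dualv K) :
  from_dbl_group N (hmul (fd f) (fb h)) = hmul (fd (jf f)) (fb (ginc h)).
Proof.
have li := ginc_lin; have lF := from_lin; have bm := @dbl_mul_bil k H (bos_laws N).
have bm' := @dbl_mul_bil k K (grp_laws k gT); have lb := @fb_lin k H; have lb' := @fb_lin k K.
move: h; apply: grp_ext; [by slin | by slin | move=> g].
rewrite ginc_grp (fdfb_grouplike _ (grp_cop k g)) (fdfb_grouplike _ (bos_copG g)).
rewrite from_pure ginc_grp; congr (tpure _ _); apply: dual_bos_ext => b x.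
rewrite jf_pure !twistE bos_antG !bos_mulE nact_one mul1r mulr1 jf_pure nact_cou grp_ant.
by rewrite !grp_mul.
Qed.

Lemma fromM (s t : DG) :
  from_dbl_group N (hmul s t) = hmul (from_dbl_group N s) (from_dbl_group N t).
Proof.
have lF := from_lin; have bm := @dbl_mul_bil k H (bos_laws N); have bm' := @dbl_mul_bil k K (grp_laws k gT).
have B1 h (r : DG) : from_dbl_group N (hmul (fb h) r) = hmul (fb (ginc h)) (from_dbl_group N r).
  move: r; apply: tens_ext; [by slin | by slin | move=> h' f'].
  by rewrite -fbfd dbl_mulA fbM !from_fbfd gincM -fbM dbl_mulA.
have B2 f (r : DG) : from_dbl_group N (hmul r (fd f)) = hmul (from_dbl_group N r) (fd (jf f)).
  move: r; apply: tens_ext; [by slin | by slin | move=> h' f'].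
  by rewrite -fbfd -dbl_mulA fdM !from_fbfd jfM -fdM dbl_mulA.
have B3 f (r : DG) : from_dbl_group N (hmul (fd f) r) = hmul (fd (jf f)) (from_dbl_group N r).
  move: r; apply: tens_ext; [by slin | by slin | move=> h' f'].
  by rewrite -fbfd dbl_mulA B2 from_fdfb from_fbfd dbl_mulA.
move: s; apply: tens_ext; [by slin | by slin | move=> h f].
by rewrite -fbfd -dbl_mulA B1 B3 from_fbfd dbl_mulA.
Qed.

Lemma ncou_ant (b : N) : e (nant N b) = e b.
Proof.
have le : lin (fun b : N => e b) by slin.
have := congr1 e (nant_l b); rewrite (linZ le) ncou_one /GRing.scale /= mulr1 => <-.
rewrite (lin_tlift _ _ le) -[b in LHS]ncou_r.
have l : lin (fun b : N => e (nant N b)) by slin.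
rewrite (lin_tlift _ _ l); apply: eq_tlift => b1 b2; rewrite (linZ l) ncou_mul.
by rewrite /GRing.scale /= mulrC.
Qed.

Lemma Vd_jf (f : dualv K) : Vd (jf f) = jf (Vd f).
Proof.
apply/lfunP => a; have [b <-] := hant_surj a; rewrite VdE hantK.
have lS := @hant_lin _ H (bos_laws N).
suff : (fun b => jf f b) =1 (fun b => jf (Vd f) (hant b)) by apply.
apply: ffun_ext; [by slin | by slin | move=> {}b x].
have l : lin (fun a => jf (Vd f) a) by slin.
rewrite jf_pure bos_ant_pure (lin_bigsum l) (bigD1 1%g) // big1 => [|h nh].
  rewrite bos_mulE jf_pure mul1r nact_cou mulg1 mul1g ncou_ant nco_cou eqxx.
  by rewrite VdE -grp_ant hantK /= addr0.
by rewrite bos_mulE jf_pure mul1r nact_cou ncou_ant nco_cou (negPf nh) mul0r.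
Qed.

(** With this, taking the dual of a module over the double commutes with restriction to D(G). *)
Lemma from_hant (t : DG) : from_dbl_group N (hant t) = hant (from_dbl_group N t).
Proof.
have lF := from_lin; have lS := @dblS_lin k H; have lS' := @dblS_lin k K.
move: t; apply: tens_ext; [by slin | by slin | move=> h f].
by rewrite from_pure !dblS_pure fromM from_fb from_fd Vd_jf ginc_ant.
Qed.

Lemma dev_from (t : DG) (b : N) x :
  dev (from_dbl_group N t) (b # x : H) = (e b : k) *: ginc (dev t (grp x : K)).
Proof.
have lF := from_lin; have li := ginc_lin.
move: t; apply: tens_ext; [by slin | by slin | move=> h f].
by rewrite from_pure !dev_pure jf_pure (linZ li) scalerA.
Qed.

End FromDoubleGroup.

(** * The grading of the Nichols algebra *)

Section Grading.
Variables (k : fieldType) (gT : finGroupType) (V : vectType k).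
Variables (Y : yd_struct gT V) (N : nichols_algebra Y).
Implicit Types (X : vectType k).

Local Notation cop := (ncop N).
Local Notation e := (ncou N).

Lemma ngr_bound_ex : exists m, [/\ forall n, (m <= n)%N -> ngr N n = 0%VS,
    directv (\sum_(n < m) ngr N n) & (\sum_(n < m) ngr N n)%VS = fullv].
Proof. exact: ngr_sum. Qed.

Definition nbound : nat := epsilon (inhabits 0) (fun m =>
  [/\ forall n, (m <= n)%N -> ngr N n = 0%VS,
    directv (\sum_(n < m) ngr N n) & (\sum_(n < m) ngr N n)%VS = fullv]).

Lemma nboundP : [/\ forall n, (nbound <= n)%N -> ngr N n = 0%VS,
    directv (\sum_(n < nbound) ngr N n) & (\sum_(n < nbound) ngr N n)%VS = fullv].
Proof. exact: epsilon_spec ngr_bound_ex. Qed.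

(** The default 0 for [i] beyond [nbound] is the right value, since [ngr N i] vanishes there; no
    range condition is carried along. *)
Definition npr (i : nat) : 'End(N) :=
  let: And3 _ _ def := nboundP in
  if insub i is Some j then sumv_pi_for (esym def) (j : 'I_nbound) else 0.

Lemma npr_mem i (b : N) : npr i b \in ngr N i.
Proof.
rewrite /npr; case: nboundP => _ _ def; case: insubP => [j _ <-|_].
  exact: memv_sum_pi.
by rewrite zero_lfunE mem0v.
Qed.

Lemma npr_sum (b : N) : \sum_(i < nbound) npr i b = b.
Proof.
rewrite /npr; case: nboundP => _ _ def.
under eq_bigr => i _ do rewrite valK.
by rewrite sumv_pi_sum ?memvf.
Qed.

Lemma npr_id i (b : N) : b \in ngr N i -> forall j, npr j b = if i == j then b else 0.
Proof.
move=> bN j; have [z dir _] := nboundP.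
case: (ltnP i nbound) => [li | /z ni0]; last first.
  by move: bN; rewrite ni0 memv0 => /eqP->; rewrite linear0 if_same.
case: (ltnP j nbound) => [lj | /z nj0]; last first.
  have := npr_mem j b; rewrite nj0 memv0 => /eqP->.
  by case: eqP => // eij; move: bN; rewrite eij nj0 memv0 => /eqP.
pose u (l : 'I_nbound) := npr l b.
pose v (l : 'I_nbound) := if i == l then b else 0.
have uv : \sum_l u l = \sum_l v l.
  rewrite npr_sum /v (bigD1 (Ordinal li)) //= eqxx big1 ?addr0 // => l.
  by rewrite -val_eqE /= eq_sym => /negPf->.
have /forallP/(_ (Ordinal lj)) : [forall l, (l \in predT) ==> (u l == v l)].
  rewrite -(directv_sum_unique dir) ?uv // => l _; first exact: npr_mem.
  by rewrite /v; case: eqP => [<-|_]; rewrite ?mem0v.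
by move=> /eqP.
Qed.

Lemma npr_eq0 (b : N) : (forall i, npr i b = 0) -> b = 0.
Proof. by move=> b0; rewrite -(npr_sum b) big1. Qed.

(** A homogeneous element of positive degree is nilpotent, because its powers leave the finite range
    of degrees, and the counit is multiplicative with values in a field. *)
Lemma ncou_deg i (b : N) : (0 < i)%N -> b \in ngr N i -> e b = 0.
Proof.
move=> i0 bN.
have powN n : b ^+ n \in ngr N (n * i)%N.
  elim: n => [|n IHn]; first by rewrite expr0 mul0n ngr0 memv_line.
  by rewrite exprS mulSn; apply: ngr_mul.
have pow_e n : e (b ^+ n) = (e b : k) ^+ n.
  elim: n => [|n IHn]; first by rewrite !expr0 ncou_one.
  by rewrite !exprS ncou_mul IHn.
have [z _ _] := nboundP.
have := powN nbound; rewrite z ?memv0; last by rewrite leq_pmulr.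
move=> /eqP bn; have := pow_e nbound; rewrite bn linear0 => /esym/eqP.
by rewrite expf_eq0 => /andP[_ /eqP].
Qed.

Lemma ngr0P (b : N) : b \in ngr N 0 -> b = (e b : k) *: 1.
Proof.
rewrite ngr0 => /vlineP[c ->]; rewrite linearZ /= ncou_one.
by rewrite /GRing.scale /= mulr1.
Qed.

Lemma npr0E (b : N) : npr 0 b = (e b : k) *: 1.
Proof.
rewrite (ngr0P (npr_mem 0 b)) -[in RHS](npr_sum b) linear_sum; congr (_ *: _).
have [z _ def] := nboundP.
case m0 : nbound => [|m].
  by rewrite big_ord0; have := npr_sum b; rewrite m0 big_ord0 => <-; rewrite !linear0.
rewrite big_ord_recl big1 ?addr0 // => i _.
exact: (ncou_deg _ (npr_mem _ _)).
Qed.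

(* The actions of N^* on N dual to left and right multiplication. *)
Definition lhit (xi : dualv N) (b : N) : N :=
  tlift (fun b1 b2 => (xi b1 : k) *: b2) (cop b).
Definition rhit (xi : dualv N) (b : N) : N :=
  tlift (fun b1 b2 => (xi b2 : k) *: b1) (cop b).

Lemma lhit_lin xi : lin (lhit xi). Proof. by rewrite /lhit; slin. Qed.
Lemma rhit_lin xi : lin (rhit xi). Proof. by rewrite /rhit; slin. Qed.
Lemma lhit_linl b : lin (fun xi => lhit xi b). Proof. by rewrite /lhit; slin. Qed.
Lemma rhit_linl b : lin (fun xi => rhit xi b). Proof. by rewrite /rhit; slin. Qed.

Lemma hitC xi eta (b : N) : rhit eta (lhit xi b) = lhit xi (rhit eta b).
Proof.
rewrite /lhit (lin_tlift _ _ (rhit_lin eta)).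
have ll : lin (lhit xi) := lhit_lin xi.
rewrite -/(lhit _ _) [in RHS]/rhit (lin_tlift _ _ ll).
transitivity (tlift (fun b1 b2 => tlift (fun c1 c2 =>
   (xi b1 : k) *: ((eta c2 : k) *: c1)) (cop b2)) (cop b)).
  apply: eq_tlift => b1 b2; rewrite (linZ (rhit_lin eta)) /rhit -tliftZ.
  exact: eq_tlift.
transitivity (tlift (fun b1 b2 => tlift (fun c1 c2 =>
   (xi c1 : k) *: ((eta b2 : k) *: c2)) (cop b1)) (cop b)).
  symmetry; apply: (tlift_coassoc (F := fun x y z => (xi x : k) *: ((eta z : k) *: y))).
    by slin.
  exact: ncoassoc.
apply: eq_tlift => b1 b2; rewrite (linZ ll) /lhit -tliftZ.
by apply: eq_tlift => c1 c2; rewrite !scalerA mulrC.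
Qed.

Lemma cop_deg_ind n (b : N) (X : vectType k) (F : N -> N -> X) (P : X -> Prop) :
  bil F -> subspace P -> b \in ngr N n ->
  (forall i x y, (i <= n)%N -> x \in ngr N i -> y \in ngr N (n - i)%N -> P (F x y)) ->
  P (tlift F (cop b)).
Proof.
move=> bF sP /ngr_cop/memv_sumP[t tN ->] PF.
have l : lin (tlift F) by slin.
rewrite (lin_bigsum l); apply: (big_ind P); first by case: sP.
  by move=> u v Pu Pv; rewrite -[u]scale1r; apply: sP.2.
move=> i _; move: (t i) (tN i isT); apply: spanned_ind.
  split=> [|a u v Pu Pv]; first by rewrite (lin0 l); case: sP.
  by rewrite l; apply: sP.2.
by move=> _ [x [y [xN yN ->]]]; rewrite tliftp //; apply: (PF i) => //; rewrite -ltnS.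
Qed.

Lemma subspace_mem (U : {vspace N}) : subspace (fun b => b \in U).
Proof. by split=> [|a u v uU vU]; rewrite ?mem0v ?memvD ?memvZ. Qed.

Definition degd (i : nat) (xi : dualv N) : Prop :=
  forall j b, b \in ngr N j -> j != i -> xi b = 0.

Lemma degd_npr i (xi : dualv N) : degd i (functional (fun b => xi (npr i b))).
Proof.
move=> j b bN ji; rewrite functional_lin; last by slin.
by rewrite (npr_id bN) (negPf ji) linear0.
Qed.

(** For n < i the truncated difference is 0 and membership says too little; hence the separate
    vanishing. *)
Lemma lhit_deg n i xi (b : N) : degd i xi -> b \in ngr N n ->
  ((n < i)%N -> lhit xi b = 0) /\ lhit xi b \in ngr N (n - i)%N.
Proof.
move=> dxi bN; have bF : bil (fun b1 b2 : N => (xi b1 : k) *: b2) by slin.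
split=> [ni|].
  apply: (cop_deg_ind (P := fun c => c = 0) bF) bN _ => [|j x y jn xN yN].
    by split=> // a u v -> ->; rewrite scaler0 addr0.
  by rewrite (dxi _ _ xN) ?scale0r // neq_ltn (leq_ltn_trans jn).
apply: (cop_deg_ind bF (subspace_mem _)) bN _ => j x y jn xN yN.
case: (eqVneq j i) => [<-|ji]; first exact: memvZ.
by rewrite (dxi _ _ xN) // scale0r mem0v.
Qed.

Lemma rhit_deg n i eta (b : N) : degd i eta -> b \in ngr N n ->
  ((n < i)%N -> rhit eta b = 0) /\ rhit eta b \in ngr N (n - i)%N.
Proof.
move=> dxi bN; have bF : bil (fun b1 b2 : N => (eta b2 : k) *: b1) by slin.
split=> [ni|].
  apply: (cop_deg_ind (P := fun c => c = 0) bF) bN _ => [|j x y jn xN yN].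
    by split=> // a u v -> ->; rewrite scaler0 addr0.
  by rewrite (dxi _ _ yN) ?scale0r // neq_ltn (leq_ltn_trans (leq_subr _ _)).
apply: (cop_deg_ind bF (subspace_mem _)) bN _ => j x y jn xN yN.
case: (eqVneq (n - j)%N i) => [<-|ji]; first by rewrite subKn // memvZ.
by rewrite (dxi _ _ yN) // scale0r mem0v.
Qed.

Lemma npr_rhit j eta (b : N) : degd 1 eta -> npr j (rhit eta b) = rhit eta (npr j.+1 b).
Proof.
move=> d1; rewrite -[in LHS](npr_sum b) (lin_bigsum (rhit_lin eta)) (lin_bigsum (lin_lfun (npr j))).
have hit i : npr j (rhit eta (npr i b)) = if i == j.+1 then rhit eta (npr j.+1 b) else 0.
  have [h0 h1] := rhit_deg d1 (npr_mem i b).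
  case: i h0 h1 => [h0 _|i _]; first by rewrite h0 // linear0.
  rewrite subn1 /= eqSS => h1; rewrite (npr_id h1).
  by case: eqP => [->|].
under eq_bigr => i _ do rewrite hit.
case: (ltnP j.+1 nbound) => [lj | gj].
  rewrite (bigD1 (Ordinal lj)) //= eqxx big1 ?addr0 // => i.
  by rewrite -val_eqE /= => /negPf->.
rewrite big1 => [|i _]; last first.
  by case: eqP => // ij; have := ltn_ord i; rewrite ij ltnNge gj.
have [z _ _] := nboundP; have := npr_mem j.+1 b.
by rewrite (z _ gj) memv0 => /eqP ->; rewrite (lin0 (rhit_lin _)).
Qed.

(* This is where the Nichols algebra differs from a pre-Nichols one: by induction
   on the degree, all left hits of such a [b] vanish except in the two extreme
   degrees, so [b] is primitive. *)
Lemma rhit_deg1_eq0_homog n (b : N) : (0 < n)%N -> b \in ngr N n ->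
  (forall eta, degd 1 eta -> rhit eta b = 0) -> b = 0.
Proof.
elim/ltn_ind: n b => n IHn b n0 bN bK.
have [n1 | n1] := eqVneq n 1%N.
  rewrite n1 in bN; apply: dual_sep => xi.
  have xb : xi b = functional (fun b => xi (npr 1 b)) b.
    by rewrite functional_lin ?(npr_id bN) //; slin.
  have := bK _ (@degd_npr 1 xi); rewrite /rhit.
  move: bN => /nprimitive ->; set eta := functional _ in xb *.
  have l : lin (tlift (fun b1 b2 : N => (eta b2 : k) *: b1)) by slin.
  rewrite (linD l) !tliftp; [ | by slin..].
  rewrite (@degd_npr 1 xi 0%N) ?ngr0 ?memv_line // scale0r add0r -xb => E.
  have le : lin (fun b : N => e b) by slin.
  by have := congr1 e E; rewrite (linZ le) ncou_one (lin0 le) /GRing.scale /= mulr1.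
suff pb : cop b = tpure b 1 + tpure 1 b.
  have /nprimitive b1 := pb.
  by have := npr_id bN 1%N; rewrite (npr_id b1) (negPf n1).
apply/eqP; rewrite -subr_eq0; apply/eqP; apply: tens_sepl => xi.
have l : lin (tlift (fun b1 b2 : N => (xi b1 : k) *: b2)) by slin.
rewrite (linB l) (linD l) !tliftp; [ | by slin..].
rewrite -/(lhit xi b); apply/eqP; rewrite subr_eq0; apply/eqP.
pose xid i : dualv N := functional (fun b => xi (npr i b)).
have xidE i c : xid i c = xi (npr i c) by rewrite functional_lin //; slin.
have xi_sum : xi = \sum_(i < nbound) xid i.
  apply/lfunP => c; rewrite sum_lfunE -[in LHS](npr_sum c) linear_sum.
  by apply: eq_bigr => i _; rewrite xidE.
have hit_n : lhit (xid n) b = (xi b : k) *: 1.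
  have [_] := lhit_deg (@degd_npr n xi) bN; rewrite subnn => /ngr0P ->.
  congr (_ *: _); have le : lin (fun b : N => e b) by slin.
  rewrite /lhit (lin_tlift _ _ le).
  transitivity (xid n b); last by rewrite xidE (npr_id bN) eqxx.
  have lx : lin (xid n) by slin.
  rewrite -[in RHS](ncou_r b) (lin_tlift _ _ lx); apply: (eq_tlift (X := k^o)) => b1 b2.
  by rewrite (linZ le) (linZ lx) /GRing.scale /= mulrC.
have hit_0 : lhit (xid 0) b = (xi 1 : k) *: b.
  rewrite -[in RHS](ncou_l b) -tliftZ; apply: eq_tlift => b1 b2.
  by rewrite xidE npr0E linearZ scalerA mulrC.
have hit_i i : i != 0%N -> i != n -> lhit (xid i) b = 0.
  move=> i0 ni; have [h0 h1] := lhit_deg (@degd_npr i xi) bN.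
  case: (ltnP n i) => [/h0 // | le_in].
  have lt_in : (i < n)%N by rewrite ltn_neqAle ni.
  apply: (IHn (n - i)%N) => //.
  - by rewrite ltn_subrL lt0n i0.
  - by rewrite subn_gt0.
  (* Left and right hits commute, so the hypothesis on [b] passes to its left hits, to which the
     induction hypothesis applies. *)
  by move=> eta d1; rewrite hitC bK // (lin0 (lhit_lin _)).
have ll := lhit_linl b; rewrite [in LHS]xi_sum (lin_bigsum ll).
have [z _ _] := nboundP.
case: (ltnP n nbound) => [ln | /z n_out]; last first.
  by move: bN; rewrite n_out memv0 => /eqP ->; rewrite !linear0 ?scaler0 ?scale0r big1 ?addr0 // => i _; apply: (lin0 (lhit_lin _)).
have l0 : (0 < nbound)%N by apply: leq_ltn_trans ln.
rewrite (bigD1 (Ordinal ln)) //= hit_n (bigD1 (Ordinal l0)) /=; last first.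
  by rewrite -val_eqE /= eq_sym -lt0n.
rewrite hit_0 big1 ?addr0 1?addrC // => i /andP[].
by rewrite -!val_eqE /= => ni i0; apply: hit_i.
Qed.

Lemma rhit_deg1_eq0 (b : N) : (forall eta, degd 1 eta -> rhit eta b = 0) -> b = (e b : k) *: 1.
Proof.
move=> bK; rewrite -npr0E -[LHS]npr_sum.
have npr_b i : i != 0%N -> npr i b = 0.
  case: i => // i _; apply: (rhit_deg1_eq0_homog (ltn0Sn i) (npr_mem _ _)) => eta d1.
  by rewrite -npr_rhit // bK // linear0.
case m0 : nbound => [|m].
  rewrite big_ord0; have [z _ _] := nboundP; have := npr_mem 0 b.
  by rewrite z ?m0 // memv0 => /eqP.
by rewrite big_ord_recl big1 ?addr0 // => i _; apply: npr_b.
Qed.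

End Grading.

(** * Generation of the dual, and vectors annihilated by positive degrees *)

Section Generation.
Variables (k : fieldType) (gT : finGroupType) (V : vectType k).
Variables (Y : yd_struct gT V) (N : nichols_algebra Y).
Implicit Types (X : vectType k).

Local Notation act := (yd_act (nyd N)).
Local Notation co := (yd_co (nyd N)).
Local Notation H := (bosonization N).
Local Notation "b # x" := (at_grp b x : {ffun gT -> N}) (at level 38).

Local Notation K := (group_hopf k gT).
Local Notation D := (dbl N).
Local Notation grp := (@Defs.grp k gT).

(* The element of \overline V with restriction eta to degree one. *)
Definition vb (eta : dualv N) : dualv H :=
  functional (fun a : H => \sum_x eta (npr N 1 ((a : {ffun gT -> N}) x)) : k^o).

Lemma vb_pure eta (b : N) x : vb eta (b # x : H) = eta (npr N 1 b).
Proof.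
rewrite functional_lin; last by slin.
rewrite (sum_at_grp (X := k^o) (F := fun _ b => eta (npr N 1 b))) // => y.
by rewrite !linear0.
Qed.

Lemma vb_Vbar eta : in_Vbar (vb eta).
Proof.
exists (functional (fun v => eta (nincl N v) : k)); split=> [v g|n b g n1 bN].
  rewrite vb_pure functional_lin; last by slin.
  by rewrite (npr_id (i := 1)) // -nincl_img memv_img ?memvf.
by rewrite vb_pure (npr_id bN) (introF eqP n1) linear0.
Qed.

(** If [A] is proper it annihilates some a <> 0. The annihilator [J] is stable under hits by [A]:
    those from k^G separate the components over the group, and those from \overline V lower the
    degree. So by induction the degree-one hits of a component vanish, [rhit_deg1_eq0] makes the
    component a scalar, and k^G shows that it is 0. *)
Lemma dual_generated (A : {vspace dualv H}) :
  (forall f, jf N f \in A) -> (forall eta, vb eta \in A) ->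
  (forall f f' : dual_hopf H, f \in A -> f' \in A -> (hmul f f' : dualv H) \in A) ->
  A = fullv.
Proof.
move=> Aj Av AM; apply/eqP; apply/negPn/negP => /annihilatedP[a a0 aA].
pose J (a : H) := forall f : dualv H, f \in A -> f a = 0.
have Jhit (c : H) (f : dualv H) : f \in A -> J c -> J (sw2 c (fun c1 c2 => (f c2 : k) *: c1)).
  move=> fA Jc f' f'A; have lf' : lin f' by slin.
  rewrite (sw2_lin lf') -[RHS](Jc _ (AM f' f f'A fA)) dmulE.
  by apply: (eq_sw2 (X := k^o)) => c1 c2; rewrite (linZ lf') mulrC.
have Jcomp (c : H) x : J c -> J ((c : {ffun gT -> N}) x # x).
  move=> /(Jhit _ _ (Aj (dl k x))); congr J; move: c.
  apply: ffun_ext; [by slin | by slin | move=> b y].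
  rewrite bos_sw2; last by slin.
  rewrite ffunE (eq_sym x y).
  have l : lin (fun b : N => b # y : H) by slin.
  transitivity ((y == x)%:R *: (b # y : H)); last first.
    case: eqP => [->|_]; rewrite ?scale1r // scale0r.
    by rewrite (lin0 (f := fun b : N => b # x)) //; slin.
  rewrite -[b in RHS](ncou_r b) (lin_tlift _ _ l) -tliftZ; apply: eq_tlift => b1 b2.
  rewrite (bigD1 1%g) // big1 => [|h nh]; rewrite jf_pure nco_cou.
    rewrite eqxx mul1g dlE grpE (eq_sym x y) (linZ l) scalerA [X in X *: _]mulrC; exact: addr0.
  by rewrite (negPf nh) mul0r scale0r.
have Jdeg n : forall (b : N) x, (forall i, (n <= i)%N -> npr N i b = 0) -> J (b # x) -> b = 0.
  elim: n => [|n IHn] b x bn Jb; first by apply: npr_eq0 => i; apply: bn.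
  (* In the coproduct of [b # x] the first leg records the coaction degree of the second, so the
     component at [p * x] isolates the hit by [eta] composed with [co p]. Summing over [p] in [bK]
     recovers every functional of degree one. *)
  have hit0 p eta : rhit (functional (fun b => vb eta (co p b # x : H))) b = 0.
    set eta' := functional _.
    have eta'E c : eta' c = eta (npr N 1 (co p c)).
      by rewrite functional_lin ?vb_pure //; slin.
    have d1 : degd (1 : nat) eta'.
      by move=> j c /(ngr_co p) cN /negPf j1; rewrite eta'E (npr_id cN) j1 linear0.
    apply: (IHn _ (p * x)%g) => [i ni|].
      by rewrite npr_rhit // bn ?(lin0 (@rhit_lin _ _ _ _ _ _)).
    have := Jcomp _ (p * x)%g (Jhit _ _ (Av eta) Jb); congr (J (_ # _)).
    rewrite bos_sw2; last by slin.
    have l : lin (fun a : {ffun gT -> N} => a (p * x)%g) by slin.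
    rewrite (lin_tlift _ _ l); apply: eq_tlift => b1 b2.
    rewrite sum_ffunE (bigD1 p) //= big1 ?addr0 => [|h hp].
      by rewrite !ffunE eqxx eta'E vb_pure.
    rewrite !ffunE; case: eqP => [/mulIg ph|_]; rewrite ?scaler0 //.
    by rewrite ph eqxx in hp.
  have bK eta : degd (1 : nat) eta -> rhit eta b = 0.
    move=> d1; have lr := @rhit_linl _ _ _ _ N b.
    rewrite (_ : eta = \sum_p functional (fun b => vb eta (co p b # x : H))).
      by rewrite (lin_bigsum lr) big1.
    apply/lfunP => c; rewrite sum_lfunE.
    have dE : eta (npr N 1 c) = eta c.
      rewrite -[in RHS](npr_sum c) linear_sum.
      have [z _ _] := nboundP N.
      case: (ltnP 1 (nbound N)) => [l1 | /z g1].
        rewrite (bigD1 (Ordinal l1)) //= big1 ?addr0 // => i.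
        rewrite -val_eqE /= => i1; exact: (d1 _ _ (npr_mem _ _) i1).
      have := npr_mem 1 c; rewrite g1 memv0 => /eqP ->; rewrite linear0 big1 // => i _.
      have [i1|i1] := eqVneq (i : nat) 1%N.
        by have := npr_mem i c; rewrite i1 g1 memv0 => /eqP ->; rewrite linear0.
      exact: (d1 _ _ (npr_mem _ _) i1).
    rewrite -dE -[in LHS](yd_counit (nyd N) c) !linear_sum; apply: eq_bigr => p _.
    by rewrite functional_lin ?vb_pure //; slin.
  have b0 := rhit_deg1_eq0 bK.
  have := Jb _ (Aj (dl k x)); rewrite jf_pure dlE grpE eqxx mulr1 => eb.
  by rewrite b0 eb scale0r.
case/eqP: a0; apply/ffunP => x; rewrite ffunE.
apply: (Jdeg (nbound N) _ x); last exact: Jcomp.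
by move=> i li; have [/(_ _ li) z _ _] := nboundP N; have := npr_mem i ((a : {ffun gT -> N}) x); rewrite z memv0 => /eqP.
Qed.

Lemma fd_ge0 (f : dualv H) : fd f \in dbl_ge0 N.
Proof.
apply/bigmeetP => U [U1 UM UP].
pose P (f : dualv H) := fd f \in U.
have sP : subspace P.
  split; rewrite /P; first by rewrite (lin0 (@fd_lin _ H)) mem0v.
  by move=> a u v Pu Pv; rewrite (@fd_lin _ H) memvD ?memvZ.
apply/(spannedP sP); rewrite (@dual_generated (spanned P)) ?memvf // => [f'|eta|f1 f2].
- by apply/(spannedP sP); rewrite /P -from_fd; apply: UP; left; eexists.
- by apply/(spannedP sP); apply: UP; right; exists (vb eta); first exact: vb_Vbar.
move=> /(spannedP sP) P1 /(spannedP sP) P2; apply/(spannedP sP).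
by rewrite /P -fdM; apply: UM.
Qed.

Lemma from_ge0 t : from_dbl_group N t \in dbl_ge0 N.
Proof. by apply/bigmeetP => U [_ _ UP]; apply: UP; left; exists t. Qed.

Lemma ge0_mul (a b : D) : a \in dbl_ge0 N -> b \in dbl_ge0 N -> hmul a b \in dbl_ge0 N.
Proof.
move=> /bigmeetP aU /bigmeetP bU; apply/bigmeetP => U CU; have [_ UM _] := CU.
by apply: UM; [apply: aU | apply: bU].
Qed.

Lemma tlift_ind (U W X : vectType k) (F : U -> W -> X) (P : X -> Prop) t :
  subspace P -> (forall a b, P (F a b)) -> P (tlift F t).
Proof.
move=> [P0 PL] PF; have PD u v : P u -> P v -> P (u + v).
  by move=> Pu Pv; rewrite -[u]scale1r; apply: PL.
rewrite /tlift; apply: (big_ind P) => // i _; apply: (big_ind P) => // j _.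
by rewrite -[_ *: _]addr0; apply: PL.
Qed.

Lemma ge0_ind (P : D -> Prop) : subspace P ->
  (forall a b, P a -> P b -> P (hmul a b)) ->
  (forall t, P (from_dbl_group N t)) -> (forall f, P (fd f)) ->
  forall a : D, a \in dbl_ge0 N -> P a.
Proof.
move=> sP PM Pt Pf a /bigmeetP aU; apply/(spannedP sP); apply: aU; split.
- by apply/(spannedP sP); rewrite -(from1 N).
- by move=> u v /(spannedP sP) Pu /(spannedP sP) Pv; apply/(spannedP sP); apply: PM.
by move=> u [[t ->]|[f _ ->]]; apply/(spannedP sP); [exact: Pt | exact: Pf].
Qed.

(** Under the identification of the double with endomorphisms of H, this is kG (x) H^*. The
    inclusion of [dbl_ge0] in it complements [fd_ge0]. *)
Definition valued0 (a : D) : Prop := forall x : H, exists h : K, dev a x = ginc N h.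

Lemma ge0_valued0 a : a \in dbl_ge0 N -> valued0 a.
Proof.
have li := @ginc_lin _ _ _ _ N.
pose P0 (x : H) := exists h : K, x = ginc N h.
have sP0 : subspace P0.
  split; first by exists 0; rewrite (lin0 li).
  by move=> c u v [h ->] [h' ->]; exists (c *: h + h'); rewrite li.
apply: ge0_ind => [|a' b Pa Pb x|t x|f x].
- split=> [x|c u v Pu Pv x].
    by exists 0; rewrite (lin0 li) (lin0 (@dbl_dev_lin _ H x)).
  by rewrite (@dbl_dev_lin _ H x); exact: (sP0.2 _ _ _ (Pu x) (Pv x)).
- rewrite dbl_mulE; apply: (tlift_ind (P := P0)) => // x1 x2.
  have [h ->] := Pb x1; rewrite /ginc.
  rewrite (lin_bigsum (f := fun u => csw u x2 (fun y u => hmul (dev a' y) u))); last by slin.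
  apply: (big_ind P0) => [|u v Pu Pv|g _]; first exact: sP0.1.
    by rewrite -[u]scale1r; apply: sP0.2.
  rewrite (linZ (f := fun u => csw u x2 (fun y u => hmul (dev a' y) u))); last by slin.
  rewrite (csw_grouplike _ _ (bos_copG N g)); last by slin.
  rewrite -[_ *: _]addr0; apply: (sP0.2); last exact: sP0.1.
  have [h' ->] := Pa (hmul (hmul (1 # g : H) x2) (hant (1 # g : H))).
  by exists (hmul h' (grp g)); rewrite gincM ginc_grp.
- rewrite -/(P0 _) (at_grp_dec x) (lin_bigsum (@dev_lin _ H _)).
  apply: (big_ind P0) => [|u v Pu Pv|y _]; first exact: sP0.1.
    by rewrite -[u]scale1r; apply: sP0.2.
  by rewrite dev_from; eexists; rewrite -(linZ li).
by exists ((f x : k) *: (grp 1%g : K)); rewrite dev_fd (linZ li) ginc_grp.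
Qed.

Lemma left_annihilated_top (ntop : nat) (b : N) : max_degree N ntop ->
  (forall i c, (0 < i)%N -> c \in ngr N i -> c * b = 0) -> b \in ngr N ntop.
Proof.
move=> [top0 topmax] bann.
(* This is the sum of all [1 # g], multiplied by [b # 1]: the group sum absorbs kG and the
   hypothesis on [b] handles positive degrees. The component at 1 gives back [b]. *)
pose Lam (b : N) : H := \sum_g act g b # g.
have LamP b' : (forall i c, (0 < i)%N -> c \in ngr N i -> c * b' = 0) ->
    forall x : H, hmul x (Lam b') = hcou x *: Lam b'.
  move=> b'ann; have le := @bos_cou_lin _ _ _ _ N.
  apply: ffun_ext; [by slin | by slin | move=> c x].
  have [_ lm] := @hmul_bil _ H _; rewrite (lin_bigsum (lm _)) bos_cou_pure.
  transitivity (\sum_g ((c * act g b') # g : H)).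
    rewrite [RHS](reindex_inj (mulgI x)); apply: eq_bigr => g _.
    by rewrite bos_mulE yd_actM.
  rewrite scaler_sumr; apply: eq_bigr => g _.
  have l : lin (fun b : N => b # g : H) by slin.
  rewrite -(linZ l); congr (_ # g); rewrite -[c in LHS]npr_sum mulr_suml.
  have [z _ _] := nboundP N.
  have hit i : i != 0%N -> npr N i c * act g b' = 0.
    rewrite -lt0n => i0; rewrite -[npr N i c](yd_act1 (nyd N)) -(mulgV g) yd_actM -nact_mul.
    by rewrite (b'ann i) ?linear0 // ngr_act // npr_mem.
  case m0 : (nbound N) => [|m].
    by rewrite big_ord0; have := npr_sum (act g b'); rewrite m0 big_ord0 => <-; rewrite scaler0.
  rewrite big_ord_recl big1 ?addr0 => [|i _]; last exact: hit.
  by rewrite npr0E -scalerAl mul1r.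
(* Products of positive degree with [b0] fall above the top degree, so [b0] yields the integral of
   reference. *)
pose b0 := vpick (ngr N ntop).
have b0N : b0 \in ngr N ntop by apply: memv_pick.
have LamE b' : (Lam b' : {ffun gT -> N}) 1%g = b'.
  rewrite sum_ffunE (bigD1 1%g) //= big1 ?addr0 => [|g ng]; rewrite ffunE ?eqxx ?yd_act1 //.
  by rewrite eq_sym (negPf ng).
have [||||c] := @integral_unique _ H _ (Lam b0) _ (Lam b).
- apply: LamP => i c i0 cN; have := ngr_mul cN b0N.
  by rewrite topmax ?memv0 => [/eqP //|]; rewrite -[X in (X < _)%N]add0n ltn_add2r.
- apply/eqP => /(congr1 (fun a : H => (a : {ffun gT -> N}) 1%g)); rewrite LamE ffunE => /eqP.
  by rewrite vpick0 => /eqP.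
- exact: hant_surj.
- exact: LamP.
move=> /(congr1 (fun a : H => (a : {ffun gT -> N}) 1%g)); rewrite !ffunE !LamE => ->.
exact: memvZ.
Qed.

End Generation.

(** * Simple modules over the double of the group *)

Section Quotients.
Variables (k : fieldType) (W : vectType k) (R : {vspace W}).

Lemma qproj_vsval (q : quotv R) : qproj R (vsval q) = q.
Proof.
apply/eqP; rewrite -subr_eq0; have [w <-] := qproj_surj q.
have l : lin (qproj R) := @qproj_linear _ _ R.
rewrite -(linB l) qproj_eq0.
have : qproj R w = vsproj (R^C)%VS (w - projv R w) by [].
move=> ->; rewrite vsprojK ?memv_projC // addrAC subrr add0r.
by rewrite memvN memv_proj.
Qed.

Lemma qproj_eq (u v : W) : qproj R u = qproj R v <-> u - v \in R.
Proof.
have l : lin (qproj R) := @qproj_linear _ _ R.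
by rewrite -qproj_eq0 (linB l) subr_eq0; split=> [->|/eqP].
Qed.

Lemma qproj_rep (w : W) : w - vsval (qproj R w) \in R.
Proof. by apply/qproj_eq; rewrite qproj_vsval. Qed.

End Quotients.

Class mod_laws (k : fieldType) (A : hopf_data k) (M : operators A) : Prop := ModLaws {
  mact_bil : bil (@mact k A M);
  mact_one : forall m : M, mact (hone A) m = m;
  mactM : forall (a b : A) (m : M), mact (hmul a b) m = mact a (mact b m) }.

Definition simple_mod (k : fieldType) (A : hopf_data k) (M : operators A) : Prop :=
  (exists m : M, m != 0) /\
  forall X : {vspace M}, submodule X -> X != 0%VS -> X = fullv.

Section WeightModule.
Variables (k : fieldType) (gT : finGroupType) (g : gT) (n : nat).
Variable rho : mx_representation k 'C[g]%G n.

Local Notation K := (group_hopf k gT).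
Local Notation DG := (dbl_group k gT).
Local Notation grp := (@Defs.grp k gT).
Local Notation W := {ffun gT -> 'cV[k]_n}.
Local Notation R := (ind_relations rho).
Local Notation M := (weight_mod rho).
Local Notation "u @ x" := (at_grp u x : {ffun gT -> 'cV[k]_n}) (at level 38).
Local Notation pr := (qproj R).

Definition wact (t : DG) (w : W) : W :=
  \sum_x \sum_y (dev t (grp (x * g * x^-1)%g : K) y : k) *: (w x @ (y * x)%g).

Lemma wact_linl w : lin (fun t => wact t w).
Proof. by rewrite /wact; slin. Qed.

Lemma wact_linr t : lin (wact t).
Proof. by rewrite /wact; slin. Qed.

Lemma pr_lin : lin pr. Proof. exact: qproj_linear. Qed.

Lemma wact_mact t (q : M) : mact t q = pr (wact t (vsval q)).
Proof.
have lp := pr_lin; have lw := wact_linl.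
move: t; apply: tens_ext; [exact: tlift_is_linear | by slin | move=> h f].
rewrite /= tliftp; last first.
  split=> [f'|h']; apply: lin_sum => y; apply: lin_sum => x; apply: lin_scalel; by slin.
rewrite exchange_big (lin_bigsum lp); apply: eq_bigr => x _.
rewrite (lin_bigsum lp); apply: eq_bigr => y _; rewrite (linZ lp); congr (_ *: _).
by rewrite dev_pure ffunE /GRing.scale /= mulrC.
Qed.

Lemma wact_pure t u x :
  wact t (u @ x) = \sum_y (dev t (grp (x * g * x^-1)%g : K) y : k) *: (u @ (y * x)%g).
Proof.
rewrite /wact (sum_at_grp (F := fun x u =>
  \sum_y (dev t (grp (x * g * x^-1)%g : K) y : k) *: (u @ (y * x)%g))) // => z.
rewrite big1 // => y _; rewrite (lin0 (f := fun u : 'cV[k]_n => u @ _)) ?scaler0 //.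
by slin.
Qed.

Lemma conj_cent x c : c \in 'C[g]%g -> (x * c * g * (x * c)^-1 = x * g * x^-1)%g.
Proof. by move=> /cent1P cg; rewrite invMg !mulgA -[(x * c * g)%g]mulgA cg mulgA mulgK. Qed.

Lemma wact_rel t w : w \in R -> wact t w \in R.
Proof.
apply: (spanned_ind (Q := fun w => wact t w \in R)) w => [|_ [x [c [u [cC ->]]]]].
  split=> [|a u v Pu Pv]; first by rewrite (lin0 (wact_linr t)) mem0v.
  by rewrite wact_linr memvD ?memvZ.
rewrite (linB (wact_linr t)) !wact_pure (conj_cent _ cC) -sumrB.
apply: memv_suml => y _; rewrite -scalerBr memvZ // mem_spanned //.
by exists (y * x)%g, c, u; rewrite mulgA.
Qed.

Lemma mact_pr t w : mact t (pr w : M) = pr (wact t w).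
Proof.
rewrite wact_mact; apply/qproj_eq; rewrite -(linB (wact_linr t)).
by apply: wact_rel; rewrite -memvN opprB qproj_rep.
Qed.

Lemma mact_pure t u x : mact t (pr (u @ x) : M) =
  \sum_y (dev t (grp (x * g * x^-1)%g : K) y : k) *: pr (u @ (y * x)%g).
Proof.
rewrite mact_pr wact_pure (lin_bigsum pr_lin); apply: eq_bigr => y _.
by rewrite (linZ pr_lin).
Qed.

Lemma weight_ext (X : lmodType k) (f f' : M -> X) : lin f -> lin f' ->
  (forall u x, f (pr (u @ x)) = f' (pr (u @ x))) -> f =1 f'.
Proof.
move=> lf lf' e q; have [w <-] := qproj_surj q; have lp := pr_lin; move: w.
by apply: ffun_ext => [||u x //]; apply: lin_comp.
Qed.

Lemma weight_bil : bil (@mact k DG M).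
Proof.
split=> [q|t]; first exact: tlift_is_linear.
move=> a u v; rewrite !wact_mact linearP /= (wact_linr t) (pr_lin a).
by [].
Qed.

Global Instance weight_laws : mod_laws M.
Proof.
have bm := weight_bil; split; [exact: bm | | move=> a b].
  apply: weight_ext => [||u x]; [exact: (bm.2 (hone DG)) | exact: lin_id | ].
  rewrite mact_pure -[RHS]addr0 (bigD1 1%g) //=; congr (_ + _).
    by rewrite dbl_oneE grp_cou scale1r grpE eqxx scale1r mul1g.
  by rewrite big1 // => y ny; rewrite dbl_oneE grp_cou scale1r grpE (negPf ny) scale0r.
apply: weight_ext => [||u x]; [exact: (bm.2 (hmul a b)) | exact: (lin_comp (bm.2 a) (bm.2 b)) | ].
rewrite mact_pure [mact b _]mact_pure (lin_bigsum (bm.2 a)).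
set z := (x * g * x^-1)%g.
have step y : mact a ((dev b (grp z : K) y : k) *: pr (u @ (y * x)%g) : M) =
    \sum_w ((dev b (grp z : K) y : k) * dev a (grp (y * z * y^-1)%g : K) (w * y^-1)%g) *: pr (u @ (w * x)%g).
  rewrite (linZ (bm.2 a)) mact_pure scaler_sumr.
  rewrite [RHS](reindex_inj (mulIg y)) /=; apply: eq_bigr => w _.
  by rewrite scalerA mulgK /z invMg !mulgA.
under [RHS]eq_bigr => y _ do rewrite step.
rewrite exchange_big /=; apply: eq_bigr => w _; rewrite -scaler_suml; congr (_ *: _).
have -> : dev (hmul a b) (grp z : K) = \sum_y (dev b (grp z : K) y : k) *:
    hmul (dev a (grp (y * z * y^-1)%g : K)) (grp y : K).
  rewrite dbl_mulE grp_sw2; last by slin.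
  rewrite [dev b _ in LHS]grp_dec.
  rewrite (lin_bigsum (f := fun c => csw c (grp z : K) (fun y u => hmul (dev a y) u))); last by slin.
  apply: eq_bigr => y _.
  rewrite (linZ (f := fun c => csw c (grp z : K) (fun y u => hmul (dev a y) u))); last by slin.
  by rewrite (csw_grouplike _ _ (grp_cop k y)) ?grp_ant ?grp_mul //; slin.
rewrite sum_ffunE; apply: eq_bigr => y _; rewrite ffunE; congr (_ * _).
move: (dev a _) => d; rewrite [d in LHS]grp_dec.
rewrite (lin_bigsum (f := fun d : K => hmul d (grp y : K))); last by slin.
rewrite sum_ffunE (bigD1 (w * y^-1)%g) // big1 ?addr0 => [|v nv].
  rewrite (linZ (f := fun d : K => hmul d (grp y : K))); last by slin.
  by rewrite grp_mul ffunE grpE mulgKV eqxx /GRing.scale /= mulr1 addr0.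
rewrite (linZ (f := fun d : K => hmul d (grp y : K))); last by slin.
rewrite grp_mul ffunE grpE (_ : (w == v * y)%g = false) ?/GRing.scale /= ?mulr0 //.
by apply: contraNF nv => /eqP->; rewrite mulgK.
Qed.

Lemma mact_dg h z u x : mact (dg k h z) (pr (u @ x) : M) =
  if z == (x * g * x^-1)%g then pr (u @ (h * x)%g) else 0.
Proof.
rewrite mact_pure; case: eqP => [->|nz].
  under eq_bigr => y _ do rewrite dev_dg eqxx scale1r.
  exact: (sum_grp (fun y => pr (u @ (y * x)%g))).
by rewrite big1 // => y _; rewrite dev_dg (introF eqP nz) scale0r ffunE scale0r.
Qed.

Lemma rel_move u x c : c \in 'C[g]%g -> pr (u @ (x * c)%g) = pr ((rho c *m u) @ x).
Proof. by move=> cC; apply/qproj_eq; apply: mem_spanned; exists x, c, u. Qed.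

(** [Psi] is the action map of the centralizer on its own coset and zero on the others; it kills the
    relations and maps [u @ 1] to [u]. *)
Lemma pr_at1_inj u : pr (u @ 1%g) = 0 -> u = 0.
Proof.
pose Psi (w : W) := \sum_(c in 'C[g]%g) rho c *m w c.
have lPsi : lin Psi.
  apply: lin_sum => c a v w; rewrite !ffunE mulmxDr -scalemxAr //.
move=> /eqP; rewrite qproj_eq0 => uR.
have : Psi (u @ 1%g) = 0.
  move: uR; apply: (spanned_ind (Q := fun w => Psi w = 0)) => [|_ [x [c [v [cC ->]]]]].
    split=> [|a v w Pv Pw]; first exact: lin0 lPsi.
    by rewrite lPsi Pv Pw scaler0 addr0.
  rewrite (linB lPsi) /Psi.
  have PsiE v' y : \sum_(c in 'C[g]%g) rho c *m (v' @ y) c =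
      if y \in 'C[g]%g then rho y *m v' else 0.
    case: ifP => yC.
      rewrite (bigD1 y) //= big1 ?addr0 => [|z /andP[_ /negPf zy]]; rewrite ffunE ?eqxx //.
      by rewrite zy mulmx0.
    rewrite big1 // => z zC; rewrite ffunE; case: eqP => [zy|]; last by rewrite mulmx0.
    by rewrite -zy zC in yC.
  rewrite !PsiE groupMr //; case: ifP => xC; last by rewrite subrr.
  by rewrite repr_mxM // mulmxA subrr.
rewrite /Psi (bigD1 1%g) ?group1 //= big1 ?addr0 => [|z /andP[_ /negPf zy]]; rewrite ffunE ?eqxx.
  by rewrite repr_mx1 mul1mx.
by rewrite zy mulmx0.
Qed.

(** A submodule [X] is controlled by its fibre at 1, a subrepresentation of the centralizer. The
    fibre is nonzero: some δ_z cuts a nonzero vector of [X] down to one coset of the centralizer,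
    with representative [x0], and x0^-1 moves the result to 1. *)
Lemma weight_simple : mx_irreducible rho -> simple_mod M.
Proof.
move=> [_ n0 irr]; split.
  case: (classic (forall u, pr (u @ 1%g) = 0)) => [h|/not_all_ex_not[u nu]]; last first.
    by exists (pr (u @ 1%g)); apply/eqP.
  case/eqP: n0; apply/matrixP => i j.
  have /(congr1 (fun A : 'cV_n => A i 0)) := pr_at1_inj (h (col j 1%:M)).
  by rewrite !mxE.
have lp := pr_lin; have bm := weight_bil.
move=> X sX nX.
pose P (u : 'cV[k]_n) := pr (u @ 1%g) \in X.
have sP : subspace P.
  split=> [|a u v Pu Pv]; rewrite /P.
    by rewrite (lin0 (f := fun u : 'cV[k]_n => pr (u @ 1%g))) ?mem0v //; slin.
  have l : lin (fun u : 'cV[k]_n => pr (u @ 1%g)) by slin.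
  by rewrite l memvD ?memvZ.
have PC c u : c \in 'C[g]%g -> P u -> P (rho c *m u).
  move=> cC Pu; rewrite /P -rel_move // mul1g.
  have := sX (dg k c g) _ Pu; rewrite mact_dg !mul1g invg1 mulg1 eqxx.
  by rewrite mulg1.
have [u Pu nu] : exists2 u, P u & u != 0.
  pose q := vpick X; have qX : q \in X by apply: memv_pick.
  have nq : q != 0 by rewrite vpick0.
  have [w wq] := qproj_surj q.
  have [z nz] : exists z, mact (dg k 1%g z) (q : M) != 0.
    apply: NNPP => nex; case/eqP: nq; rewrite -[LHS](mact_one (q : M)).
    have -> : hone DG = \sum_z dg k 1%g z.
      apply: dev_inj => x; rewrite dbl_oneE.
      rewrite (lin_bigsum (@dbl_dev_lin _ K x)); cbv beta.
      under eq_bigr => z _ do rewrite /dg dev_pure dlE.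
      by rewrite -scaler_suml.
    rewrite (lin_bigsum (bm.1 q)) big1 // => z _; apply/eqP.
    by apply: contra_notT nex => nz; exists z.
  pose u x0 := \sum_(x | (x * g * x^-1)%g == z) rho (x0^-1 * x)%g *m w x.
  have zq x0 : (x0 * g * x0^-1)%g = z -> mact (dg k 1%g z) (q : M) = pr (u x0 @ x0).
    move=> x0z; rewrite -wq [w in LHS]at_grp_dec (lin_bigsum lp) (lin_bigsum (bm.2 _)).
    have l : lin (fun u : 'cV[k]_n => pr (u @ x0)) by slin.
    rewrite (lin_bigsum l) [RHS]big_mkcond; apply: eq_bigr => x _; cbv beta.
    rewrite mact_dg mul1g eq_sym; case: ifP => // /eqP xz.
    rewrite -rel_move ?mulKVg //; apply/cent1P; rewrite /commute.
    have : (x * g * x^-1 = x0 * g * x0^-1)%g by rewrite xz x0z.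
    move=> /(congr1 (fun y => x0^-1 * y * x)%g); rewrite !mulgA mulgKV mulVg mul1g.
    by move=> ->; rewrite -?mulgA.
  have [x0 x0z] : exists x0, (x0 * g * x0^-1)%g = z.
    apply: NNPP => nex; case/eqP: nz; rewrite -wq [w]at_grp_dec (lin_bigsum lp).
    rewrite (lin_bigsum (bm.2 _)) big1 // => x _; rewrite mact_dg.
    by case: eqP => // xz; case: nex; exists x.
  exists (u x0).
    have := sX (dg k x0^-1%g z) _ (sX (dg k 1%g z) _ qX).
    by rewrite (zq _ x0z) mact_dg x0z eqxx mulVg.
  apply: contraNneq nz => u0; rewrite (zq _ x0z) u0.
  by rewrite (lin0 (f := fun u : 'cV[k]_n => pr (u @ x0))) //; slin.
pose C := spanned P; have CP v := spannedP sP v.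
pose B : 'M[k]_(n, \dim C) := \matrix_(i, j) ((vbasis C)`_j : 'cV[k]_n) i 0.
have BE (w : 'cV_(\dim C)) : B *m w = \sum_j w j 0 *: ((vbasis C)`_j : 'cV[k]_n).
  apply/matrixP => i j; rewrite ord1 mxE summxE; apply: eq_bigr => l _.
  by rewrite !mxE mulrC.
have BC (w : 'cV_(\dim C)) : B *m w \in C.
  rewrite BE; apply: memv_suml => j _; apply: memvZ; apply: vbasis_mem.
  by rewrite mem_nth // size_tuple.
have CB v : v \in C -> exists w, v = B *m w.
  move=> vC; exists (\col_j coord (vbasis C) j v); rewrite BE [LHS](coord_vbasis vC).
  by apply: eq_bigr => j _; rewrite mxE.
(* [mx_irreducible] is about row spaces, on which matrices act from the right, whereas [C] consists
   of columns. Irreducibility is therefore applied to the rows that annihilate [C]. *)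
have kerB : kermx B = 0.
  apply/eqP; apply/negPn/negP => nker; case/eqP: nu.
  have /CP/CB[w ->] := Pu; suff -> : B = 0 by rewrite mul0mx.
  have kmod : mxmodule rho (kermx B).
    apply/mxmoduleP => c cC; apply/sub_kermxP; rewrite -mulmxA.
    apply/matrixP => i j.
    have /CP Pb : ((vbasis C)`_j : 'cV[k]_n) \in C.
      by apply: vbasis_mem; rewrite mem_nth // size_tuple.
    have /CP/CB[w' w'E] := PC c _ cC Pb.
    have colE : col j (rho c *m B) = B *m w'.
      rewrite -w'E; apply/matrixP => a b; rewrite ord1 !mxE.
      by apply: eq_bigr => l _; rewrite !mxE.
    have -> : (kermx B *m (rho c *m B)) i j = (kermx B *m col j (rho c *m B)) i 0.
      by rewrite [LHS]mxE [RHS]mxE; apply: eq_bigr => l _; rewrite [col _ _ _ _]mxE.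
    by rewrite colE mulmxA mulmx_ker mul0mx !mxE.
  have := irr _ kmod (submx1 _) nker => /sub_kermxP; rewrite mul1mx //.
have Call v : v \in C.
  have /row_freeP[B' BB'] : row_free B.
    by rewrite -kermx_eq0 kerB.
  by rewrite -[v]mul1mx -BB' -mulmxA BC.
apply/eqP; rewrite eqEsubv subvf /=; apply/subvP => q _.
have [w <-] := qproj_surj q; rewrite [w]at_grp_dec (lin_bigsum lp).
apply: memv_suml => x _; have /CP Pw := Call (w x).
have := sX (dg k x g) _ Pw.
by rewrite mact_dg mul1g invg1 mulg1 eqxx mulg1.
Qed.

End WeightModule.

(** * Verma modules *)

Section DoubleGroupBasis.
Variables (k : fieldType) (gT : finGroupType).
Local Notation DG := (dbl_group k gT).
Local Notation K := (group_hopf k gT).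
Local Notation grp := (@Defs.grp k gT).

Lemma dbl_grp_inj (s t : DG) : (forall x, dev s (grp x : K) = dev t (grp x : K)) -> s = t.
Proof. by move=> st; apply: dev_inj; apply: grp_ext => //; exact: dev_lin. Qed.

Lemma dbl_grp_mulE (s t : DG) x : dev (hmul s t) (grp x : K) =
  \sum_y (dev t (grp x : K) y : k) *: hmul (dev s (grp (y * x * y^-1)%g : K)) (grp y : K).
Proof.
rewrite dbl_mulE grp_sw2; last by slin.
rewrite [dev t _ in LHS]grp_dec.
rewrite (lin_bigsum (f := fun c => csw c (grp x : K) (fun y u => hmul (dev s y) u))); last by slin.
apply: eq_bigr => y _.
rewrite (linZ (f := fun c => csw c (grp x : K) (fun y u => hmul (dev s y) u))); last by slin.
by rewrite (csw_grouplike _ _ (grp_cop k y)) ?grp_ant ?grp_mul //; slin.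
Qed.

Lemma dg_mul (z w g x : gT) :
  hmul (dg k z w) (dg k g x) = if w == (g * x * g^-1)%g then dg k (z * g)%g x else 0.
Proof.
apply: dbl_grp_inj => y; rewrite dbl_grp_mulE dev_dg.
transitivity ((x == y)%:R *: (if w == (g * y * g^-1)%g then grp (z * g)%g : K else 0)).
  rewrite -(sum_grp (fun y' => if w == (y' * y * y'^-1)%g then grp (z * y')%g : K else 0) g).
  rewrite scaler_sumr; apply: eq_bigr => y' _; rewrite ffunE -scalerA; congr (_ *: (_ *: _)).
  rewrite dev_dg; case: eqP => _; first by rewrite scale1r grp_mul.
  by rewrite scale0r; apply: (lin0 (f := fun d : K => hmul d (grp y' : K))); slin.
case: (eqVneq x y) => [->|xy]; last first.
  rewrite scale0r; case: ifP => _; last by rewrite (lin0 (@dbl_dev_lin _ K (grp y))).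
  by rewrite dev_dg (negPf xy) scale0r.
rewrite scale1r; case: ifP => _; last by rewrite (lin0 (@dbl_dev_lin _ K (grp y))).
by rewrite dev_dg eqxx scale1r.
Qed.

Lemma dg_one : hone DG = \sum_z dg k 1%g z.
Proof.
apply: dev_inj => x; rewrite dbl_oneE.
rewrite (lin_bigsum (@dbl_dev_lin _ K x)); cbv beta.
under eq_bigr => z _ do rewrite /dg dev_pure dlE.
by rewrite -scaler_suml.
Qed.

End DoubleGroupBasis.

Section VermaModel.
Variables (k : fieldType) (gT : finGroupType) (V : vectType k).
Variables (Y : yd_struct gT V) (N : nichols_algebra Y).
Implicit Types (X : vectType k).

Local Notation H := (bosonization N).
Local Notation "b # x" := (at_grp b x : {ffun gT -> N}) (at level 38).
Local Notation e := (ncou N).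

Local Notation K := (group_hopf k gT).
Local Notation DG := (dbl_group k gT).
Local Notation D := (dbl N).
Local Notation grp := (@Defs.grp k gT).

Variable M : operators DG.
Context {ML : mod_laws M}.
Local Notation RV := (verma_relations N M).
Local Notation VM := (verma N M).
Local Notation pi := (@dbl_ge0_proj _ _ _ _ N).
Local Notation pv := (qproj (verma_relations N M)).

Lemma bos_dec (b : N) x : (b # x : H) = hmul (b # 1%g : H) (1 # x : H).
Proof. by rewrite bos_mulE nact_one mulr1 mul1g. Qed.

Lemma bos_mulG (w : H) g y : (hmul w (1 # g : H) : {ffun gT -> N}) y = (w : {ffun gT -> N}) (y * g^-1)%g.
Proof.
move: w; apply: ffun_ext => [||b x].
- by apply: lin_ffun; exact: (@hmul_bil _ H _).1.
- by slin.
by rewrite bos_mulE nact_one mulr1 !ffunE eq_mulgV1 [in RHS]eq_mulgV1 invMg !mulgA.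
Qed.

Definition cohat (a : H) : K := [ffun x => e ((a : {ffun gT -> N}) x)].

Lemma cohat_lin : lin cohat.
Proof. by rewrite /cohat; slin. Qed.

Lemma cohat_ginc h : cohat (ginc N h) = h.
Proof.
by apply/ffunP => x; rewrite ffunE gincE linearZ /= ncou_one /GRing.scale /= mulr1.
Qed.

Lemma cohat_mulG (w : H) g : cohat (hmul w (1 # g : H)) = hmul (cohat w) (grp g : K).
Proof.
have lc := cohat_lin; move: w; apply: ffun_ext; [by slin | by slin | move=> b x].
have cb c y : cohat (c # y) = (e c : k) *: (grp y : K).
  apply/ffunP => z; rewrite !ffunE; case: eqP => _; rewrite /GRing.scale /=.
    by rewrite mulr1.
  by rewrite linear0 mulr0.
rewrite bos_mulE nact_one mulr1 !cb (linZ (f := fun d : K => hmul d (grp g : K))) ?grp_mul //.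
by slin.
Qed.

Lemma dev_pi (a : D) (h : K) : dev (pi a) h = cohat (dev a (ginc N h)).
Proof.
have lc := cohat_lin; have lp : lin pi by exact: tlift_is_linear.
move: a; apply: tens_ext; [by slin | by slin | move=> a f].
rewrite dbl_ge0_proj_pure !dev_pure (linZ lc); congr (_ *: _).
exact: restrict_functionalE.
Qed.

Lemma pi_lin : lin pi. Proof. exact: tlift_is_linear. Qed.

Lemma dbl_mul_valued0 (a b : D) x (h : K) : dev b (1 # x : H) = ginc N h ->
  dev (hmul a b) (1 # x : H) =
  \sum_g (h g : k) *: hmul (dev a (1 # (g * x * g^-1)%g : H)) (1 # g : H).
Proof.
move=> bx; rewrite dbl_mulE bos_sw2; last by slin.
rewrite ncop_one tliftp; last first.
  by split=> u; slin.
rewrite (bigD1 1%g) // big1 => [|y ny]; last first.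
  rewrite nco_one (negPf ny) (lin0 (f := fun c : N => csw _ (c # x : H) _)) //.
  by slin.
etransitivity; first exact: addr0.
rewrite mul1g nco_one eqxx bx /ginc.
rewrite (lin_bigsum (f := fun c => csw c (1 # x : H) (fun y u => hmul (dev a y) u))); last by slin.
apply: eq_bigr => g _.
rewrite (linZ (f := fun c => csw c (1 # x : H) (fun y u => hmul (dev a y) u))); last by slin.
rewrite (csw_grouplike _ _ (bos_copG N g)); last by slin.
by rewrite bos_antG !bos_mulE !nact_one !mulr1.
Qed.

(** At group elements [b] takes values in kG, and moving these past [a] merely conjugates the
    argument of [a] by group elements, as in D(G). No condition falls on [a]. *)
Lemma piM (a b : D) : b \in dbl_ge0 N -> pi (hmul a b) = hmul (pi a) (pi b).
Proof.
move=> /ge0_valued0 b0; apply: dbl_grp_inj => x; have [h bx] := b0 (1 # x : H).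
have lc := cohat_lin.
rewrite dev_pi ginc_grp (dbl_mul_valued0 _ bx) (lin_bigsum lc) dbl_grp_mulE.
rewrite dev_pi ginc_grp bx cohat_ginc; apply: eq_bigr => g _.
by rewrite (linZ lc) cohat_mulG dev_pi ginc_grp.
Qed.

Definition vpure (d : D) (m : M) : VM := pv (tpure d m).
Definition ve (b : N) (m : M) : VM := vpure (fb (b # 1%g : H)) m.

Lemma pv_lin : lin pv. Proof. exact: qproj_linear. Qed.

Lemma vpure_bil : bil vpure.
Proof. by have lp := pv_lin; rewrite /vpure; slin. Qed.

Lemma ve_bil : bil ve.
Proof.
have bv := vpure_bil; have lb := @fb_lin _ H; rewrite /ve.
by split=> [m|b]; [apply: (bil_l _ bv); slin | exact: (bv.2 _)].
Qed.

Lemma vpure_ge0 (d a : D) m : a \in dbl_ge0 N -> vpure (hmul d a) m = vpure d (mact (pi a) m).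
Proof. by move=> aG; apply/qproj_eq; apply: mem_spanned; exists d, a, m. Qed.

Lemma verma_act_rel (d : D) t : t \in RV ->
  tlift (fun (d' : D) (m : M) => tpure (hmul d d') m) t \in RV.
Proof.
have bm := @dbl_mul_bil k H (bos_laws N); set L := tlift _.
have lL : lin L by exact: tlift_is_linear.
have LE d' m : L (tpure d' m) = tpure (hmul d d') m.
  rewrite /L tliftp //; split=> u; last exact: (bil_tpure _ _).2.
  by apply: (bil_l _ (bil_tpure _ _)); apply: dbl_mul_bil.2.
apply: (spanned_ind (Q := fun t => L t \in RV)) t => [|_ [d' [a [m [aG ->]]]]].
  split=> [|c u v Pu Pv]; first by rewrite (lin0 lL) mem0v.
  by rewrite lL memvD ?memvZ.
rewrite (linB lL) !LE dbl_mulA; apply: mem_spanned.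
by exists (hmul d d'), a, m.
Qed.

Lemma verma_act (d d' : D) m : mact d (vpure d' m) = vpure (hmul d d') m.
Proof.
have bF : bil (fun (d' : D) (m : M) => tpure (hmul d d') m).
  split=> u; last exact: (bil_tpure _ _).2.
  by apply: (bil_l _ (bil_tpure _ _)); apply: dbl_mul_bil.2.
rewrite /vpure -(tliftp d' m bF); apply/qproj_eq.
rewrite -(linB (f := tlift (fun (d' : D) (m : M) => tpure (hmul d d') m))).
  by apply: verma_act_rel; rewrite -memvN opprB qproj_rep.
exact: tlift_is_linear.
Qed.

Lemma verma_bil : bil (@mact k D VM).
Proof.
split=> [v|d].
  apply: (lin_comp pv_lin); apply: lin_tlift_fun => d' m.
  by apply: (bil_l _ (bil_tpure _ _)); apply: dbl_mul_bil.1.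
apply: (lin_comp pv_lin); apply: lin_tlift_arg => a u v; exact: linearP.
Qed.

Lemma vpure_ext (X : lmodType k) (f f' : VM -> X) : lin f -> lin f' ->
  (forall d m, f (vpure d m) = f' (vpure d m)) -> f =1 f'.
Proof.
move=> lf lf' ff v; have [t <-] := qproj_surj v; move: t.
by apply: tens_ext; [exact: (lin_comp lf pv_lin) | exact: (lin_comp lf' pv_lin) | exact: ff].
Qed.

Global Instance verma_laws : mod_laws VM.
Proof.
have bm := verma_bil; split; [exact: bm | | move=> a b].
  apply: vpure_ext; [exact: (bm.2 (hone D)) | exact: lin_id | move=> d m].
  by rewrite verma_act dbl_mul1l.
apply: vpure_ext; [exact: (bm.2 (hmul a b)) | exact: (lin_comp (bm.2 a) (bm.2 b)) | move=> d m].
by rewrite !verma_act dbl_mulA.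
Qed.

(** Everything to the right of [b] is transferred to the module, since all functionals on H lie in
    [dbl_ge0]. Hence the vectors [ve b m] span. *)
Lemma vpure_ve (b : N) x (f : dualv H) m :
  vpure (hmul (fb (b # x : H)) (fd f)) m =
  ve b (mact (pi (hmul (fb (1 # x : H)) (fd f))) m).
Proof.
rewrite bos_dec -fbM -dbl_mulA /ve vpure_ge0 //.
by apply: ge0_mul; [rewrite -ginc_grp -from_fb; apply: from_ge0 | apply: fd_ge0].
Qed.

Lemma ve_span (v : VM) : exists t, v = tlift ve t.
Proof.
pose P v := exists t, v = tlift ve t.
have lt : lin (tlift ve) by exact: tlift_is_linear.
have PD u w : P u -> P w -> P (u + w).
  by move=> [t ->] [s ->]; exists (t + s); rewrite (linD lt).
have PZ c u : P u -> P (c *: u) by move=> [t ->]; exists (c *: t); rewrite (linZ lt).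
have P0 : P 0 by exists 0; rewrite (lin0 lt).
have bv := vpure_bil; have lb := @fb_lin _ H.
have Ppure d m : P (vpure d m).
  rewrite (tens_pureE d) /tlift (lin_bigsum (bv.1 m)); apply: (big_ind P) => // i _.
  rewrite (lin_bigsum (bv.1 m)); apply: (big_ind P) => // j _.
  rewrite (linZ (bv.1 m)); apply: PZ; move: (cbasis i) (cbasis j) => a f.
  rewrite -fbfd (at_grp_dec (a : {ffun gT -> N})) (lin_bigsum lb).
  have lm : lin (fun d => vpure (hmul d (fd f)) m).
    by apply: (bil_l _ bv); apply: dbl_mul_bil.1.
  rewrite (lin_bigsum lm); apply: (big_ind P) => // x _.
  rewrite vpure_ve; exists (tpure ((a : {ffun gT -> N}) x) (mact (pi (hmul (fb (1 # x : H)) (fd f))) m)).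
  by rewrite tliftp //; exact: ve_bil.
have [t <-] := qproj_surj v; rewrite (tens_pureE t) /tlift (lin_bigsum pv_lin).
apply: (big_ind P) => // i _; rewrite (lin_bigsum pv_lin); apply: (big_ind P) => // j _.
by rewrite (linZ pv_lin); apply: PZ; apply: Ppure.
Qed.

(* On D (x) M, the inverse Phi of b (x) m |-> ve b m: modulo the Verma relations,
   d is the sum over x and g of b_(x,g) g delta_x, where d (1 # x) is the sum over
   g of b_(x,g) # g. *)
Definition phi1 (d : D) (m : M) : tens N M :=
  \sum_x \sum_g tpure ((dev d (1 # x : H) : {ffun gT -> N}) g) (mact (dg k g x) m).

Lemma phi1_bil : bil phi1.
Proof. by have bm := @mact_bil _ _ M ML; rewrite /phi1; slin. Qed.

(** The values of [a] at group elements lie in kG and are those of [pi a]. Expanding [pi a] over the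
    basis [dg], both sides become the same sum over products of basis elements, of which [dg_mul]
    keeps one [w] for each [g] and [x]. *)
Lemma phi1_rel (d a : D) m : a \in dbl_ge0 N ->
  phi1 (hmul d a) m = phi1 d (mact (pi a) m).
Proof.
move=> /ge0_valued0 a0; have [bm1 bm2] := @mact_bil _ _ M ML.
have piE x g : dev (pi a) (grp x : K) g = cohat (dev a (1 # x : H)) g.
  by rewrite dev_pi ginc_grp.
have aE x : dev a (1 # x : H) = ginc N (cohat (dev a (1 # x : H))).
  by have [h ->] := a0 (1 # x : H); rewrite cohat_ginc.
set c := fun x => cohat (dev a (1 # x : H)) in piE aE.
have lt2 (n : N) : lin (@tpure k N M n) := (bil_tpure N M).2 n.
have lt1 (m' : M) : lin (fun n : N => tpure n m') := (bil_tpure N M).1 m'.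
transitivity (\sum_x \sum_g \sum_z (c x g : k) *:
    tpure ((dev d (1 # (g * x * g^-1)%g : H) : {ffun gT -> N}) z) (mact (dg k (z * g)%g x) m)).
  apply: eq_bigr => x _; rewrite [RHS]exchange_big /=.
  transitivity (\sum_y \sum_g (c x g : k) *:
    tpure ((dev d (1 # (g * x * g^-1)%g : H) : {ffun gT -> N}) (y * g^-1)%g) (mact (dg k y x) m)).
    apply: eq_bigr => y _; rewrite (dbl_mul_valued0 _ (aE x)) sum_ffunE (lin_bigsum (lt1 _)).
    by apply: eq_bigr => g _; rewrite ffunE (linZ (lt1 _)) bos_mulG.
  rewrite exchange_big [RHS]exchange_big /=; apply: eq_bigr => g _.
  rewrite (reindex_inj (mulIg g)) /=; apply: eq_bigr => z _.
  by rewrite mulgK.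
transitivity (\sum_w \sum_z \sum_x \sum_g (c x g : k) *:
    tpure ((dev d (1 # w : H) : {ffun gT -> N}) z) (mact (hmul (dg k z w) (dg k g x)) m)); last first.
  apply: eq_bigr => w _; apply: eq_bigr => z _.
  rewrite (dg_dec (pi a)) (lin_bigsum (bm1 m)) (lin_bigsum (bm2 _)) (lin_bigsum (lt2 _)).
  apply: eq_bigr => x _.
  rewrite (lin_bigsum (bm1 m)) (lin_bigsum (bm2 _)) (lin_bigsum (lt2 _)).
  apply: eq_bigr => g _.
  by rewrite (linZ (bm1 m)) (linZ (bm2 _)) (linZ (lt2 _)) -mactM piE.
symmetry; under eq_bigr => w _ do rewrite exchange_big /=.
rewrite exchange_big /=; apply: eq_bigr => x _.
under eq_bigr => w _ do rewrite exchange_big /=.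
rewrite exchange_big /=; apply: eq_bigr => g _.
rewrite exchange_big /=; apply: eq_bigr => z _.
rewrite (bigD1 (g * x * g^-1)%g) // big1 => [|w nw]; cbv beta; rewrite [double_mul _ _]dg_mul.
  by rewrite eqxx; apply: addr0.
by rewrite (negPf nw) (lin0 (bm1 m)) (lin0 (lt2 _)) scaler0.
Qed.

Definition Phi (v : VM) : tens N M := tlift phi1 (vsval v).

Lemma Phi_lin : lin Phi.
Proof. by apply: lin_tlift_arg => a u v; exact: linearP. Qed.

Lemma Phi_vpure d m : Phi (vpure d m) = phi1 d m.
Proof.
have l1 : lin (tlift phi1) by exact: tlift_is_linear.
rewrite -(tliftp d m phi1_bil) /Phi; apply/eqP; rewrite -subr_eq0 -(linB l1); apply/eqP.
have : vsval (vpure d m) - tpure d m \in RV by rewrite -memvN opprB qproj_rep.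
apply: (spanned_ind (Q := fun t => tlift phi1 t = 0)) => [|_ [d' [a [m' [aG ->]]]]].
  split=> [|c u v Pu Pv]; first exact: lin0 l1.
  by rewrite l1 Pu Pv scaler0 addr0.
by rewrite (linB l1) !(tliftp _ _ phi1_bil) phi1_rel // subrr.
Qed.

Lemma Phi_ve b m : Phi (ve b m) = tpure b m.
Proof.
have [bm1 bm2] := @mact_bil _ _ M ML.
have lt2 (n : N) : lin (@tpure k N M n) := (bil_tpure N M).2 n.
rewrite Phi_vpure /phi1 -[in RHS](mact_one m) dg_one (lin_bigsum (bm1 m)) (lin_bigsum (lt2 b)).
apply: eq_bigr => x _; rewrite (bigD1 1%g) //= big1 ?addr0 => [|g ng].
  by rewrite dev_fb bos_cou_pure ncou_one scale1r ffunE eqxx.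
rewrite dev_fb bos_cou_pure ncou_one scale1r ffunE (negPf ng).
exact: (lin0 ((bil_tpure N M).1 _)).
Qed.

Lemma Phi_tlift t : Phi (tlift ve t) = t.
Proof.
rewrite (lin_tlift _ _ Phi_lin) -[RHS]tlift_id; apply: eq_tlift => b m.
exact: Phi_ve.
Qed.

Lemma PhiK v : tlift ve (Phi v) = v.
Proof. by have [t ->] := ve_span v; rewrite Phi_tlift. Qed.

Lemma ve_ext (X : lmodType k) (f f' : VM -> X) : lin f -> lin f' ->
  (forall b m, f (ve b m) = f' (ve b m)) -> f =1 f'.
Proof.
move=> lf lf' ff v; rewrite -(PhiK v); move: (Phi v) => t.
have lt : lin (tlift ve) by exact: tlift_is_linear.
move: t; apply: tens_ext; [exact: (lin_comp lf lt) | exact: (lin_comp lf' lt) | move=> b m].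
by rewrite (tliftp _ _ ve_bil).
Qed.

End VermaModel.

(** * Degrees on the bosonization and on its dual *)

Section Degrees.
Variables (k : fieldType) (gT : finGroupType) (V : vectType k).
Variables (Y : yd_struct gT V) (N : nichols_algebra Y).
Implicit Types (X : vectType k).

Local Notation act := (yd_act (nyd N)).
Local Notation H := (bosonization N).
Local Notation "b # x" := (at_grp b x : {ffun gT -> N}) (at level 38).

Definition Hdeg (n : nat) (a : H) : Prop := forall x, (a : {ffun gT -> N}) x \in ngr N n.

Lemma Hdeg_sub n : subspace (Hdeg n).
Proof.
split=> [x|c u v Pu Pv x]; first by rewrite ffunE mem0v.
by rewrite !ffunE memvD ?memvZ ?Pu ?Pv.
Qed.

Lemma Hdeg_pure n (b : N) x : b \in ngr N n -> Hdeg n (b # x).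
Proof. by move=> bN y; rewrite ffunE; case: eqP => _; rewrite ?mem0v. Qed.

Lemma Hdeg_ind n (P : H -> Prop) : subspace P ->
  (forall (b : N) x, b \in ngr N n -> P (b # x)) -> forall a, Hdeg n a -> P a.
Proof.
move=> [P0 PL] Pb a aN; rewrite (at_grp_dec a); apply: (big_ind P) => // [u v Pu Pv|x _].
  by rewrite -[u]scale1r; apply: PL.
exact: Pb.
Qed.

Lemma HdegM i j a b : Hdeg i a -> Hdeg j b -> Hdeg (i + j) (hmul a b).
Proof.
have [bm1 bm2] := @hmul_bil _ H (bos_laws N).
move=> aN; move: b; apply: Hdeg_ind => [|c y cN].
  split=> [|c u v Pu Pv]; first by rewrite (lin0 (bm2 a)); apply: (Hdeg_sub _).1.
  by rewrite bm2; apply: (Hdeg_sub _).2.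
move: a aN; apply: Hdeg_ind => [|b x bN].
  split=> [|a u v Pu Pv]; first by rewrite (lin0 (bm1 _)); apply: (Hdeg_sub _).1.
  by rewrite bm1; apply: (Hdeg_sub _).2.
by rewrite bos_mulE; apply: Hdeg_pure; apply: ngr_mul => //; apply: ngr_act.
Qed.

Lemma Hdeg_G x : Hdeg 0 (1 # x).
Proof. by apply: Hdeg_pure; rewrite ngr0 memv_line. Qed.

Lemma Hdeg_sw2 n (X : vectType k) (F : H -> H -> X) (P : X -> Prop) :
  bil F -> subspace P ->
  (forall i u v, (i <= n)%N -> Hdeg i u -> Hdeg (n - i)%N v -> P (F u v)) ->
  forall a, Hdeg n a -> P (sw2 a F).
Proof.
move=> bF sP PF; have l : lin (fun a => sw2 a F) by slin.
apply: Hdeg_ind => [|b x bN].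
  split=> [|c u v Pu Pv]; first by rewrite (lin0 l); case: sP.
  by rewrite l; apply: sP.2.
rewrite bos_sw2 //; apply: (cop_deg_ind _ sP bN) => [|i b1 b2 ni b1N b2N]; first by slin.
apply: (big_ind P) => [|u v Pu Pv|h _]; first by case: sP.
  by rewrite -[u]scale1r; apply: sP.2.
by apply: (PF i) => //; apply: Hdeg_pure => //; apply: ngr_co.
Qed.

Lemma Hdeg_S1 (v : N) : v \in ngr N 1 -> Hdeg 1 (hant (v # 1%g : H)).
Proof.
move=> vN; rewrite bos_ant_pure; apply: (big_ind (Hdeg 1)) => [|a b Pa Pb|h _].
- exact: (Hdeg_sub 1).1.
- by rewrite -[a]scale1r; apply: (Hdeg_sub 1).2.
apply: (@HdegM 0 1); first exact: Hdeg_G.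
apply: Hdeg_pure; rewrite nant_deg1 ?rpredN; exact: ngr_co.
Qed.

Lemma npr_mul1 (v b : N) n : v \in ngr N 1 -> npr N n.+1 (v * b) = v * npr N n b.
Proof.
move=> vN; rewrite -[in LHS](npr_sum b) mulr_sumr (lin_bigsum (lin_lfun (npr N n.+1))).
have hit i : npr N n.+1 (v * npr N i b) = if i == n then v * npr N n b else 0.
  by rewrite (npr_id (ngr_mul vN (npr_mem i b))) add1n eqSS; case: eqP => [->|].
under eq_bigr => i _ do rewrite hit.
have [z _ _] := nboundP N.
case: (ltnP n (nbound N)) => [ln | gn].
  rewrite (bigD1 (Ordinal ln)) //= eqxx big1 ?addr0 // => i.
  by rewrite -val_eqE /= => /negPf->.
rewrite big1 => [|i _]; last by case: eqP => // ni; have := ltn_ord i; rewrite ni ltnNge gn.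
by have := npr_mem n b; rewrite (z _ gn) memv0 => /eqP ->; rewrite mulr0.
Qed.

Lemma npr0_mul1 (v b : N) : v \in ngr N 1 -> npr N 0 (v * b) = 0.
Proof. by move=> vN; rewrite npr0E ncou_mul (ncou_deg1 vN) mul0r scale0r. Qed.

Lemma Hdeg_S n a : Hdeg n a -> Hdeg n (hant a).
Proof.
have lS := @hant_lin _ H (bos_laws N).
have at1 : lin (fun b : N => b # 1%g : H) by slin.
(* The claim is made for all components of [b], because generation in degree one provides products
   [v * b] in which [b] is not homogeneous. *)
pose P (b : N) := forall n, Hdeg n (hant (npr N n b # 1%g : H)).
have sP : subspace P.
  split=> [|c u v Pu Pv] m.
    by rewrite linear0 (lin0 at1) (lin0 lS); apply: (Hdeg_sub m).1.
  by rewrite linearP at1 lS; apply: (Hdeg_sub m).2; [apply: Pu | apply: Pv].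
have PT b : P b.
  apply/(spannedP sP); move: b (memvf b); apply/subvP.
  rewrite -(ngenerated N); apply: agenv_sub_modl.
    rewrite -memvE; apply/(spannedP sP) => m.
    rewrite (npr_id (i := 0)); last by rewrite ngr0 memv_line.
    case: eqP => [<-|_]; first by rewrite bos_antG; apply: Hdeg_G.
    by rewrite (lin0 at1) (lin0 lS); apply: (Hdeg_sub m).1.
  apply/prodvP => v b vN /(spannedP sP) Pb; apply/(spannedP sP) => m.
  case: m => [|m].
    by rewrite npr0_mul1 // (lin0 at1) (lin0 lS); apply: (Hdeg_sub _).1.
  have -> : npr N m.+1 (v * b) # 1%g = hmul (v # 1%g : H) (npr N m b # 1%g : H).
    by rewrite npr_mul1 // bos_mulE yd_act1 mulg1.
  by rewrite hantM -addn1; apply: HdegM; [apply: Pb | apply: Hdeg_S1].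
move: a; apply: Hdeg_ind => [|b x bN].
  split=> [|c u v Pu Pv]; first by rewrite (lin0 lS); apply: (Hdeg_sub n).1.
  by rewrite lS; apply: (Hdeg_sub n).2.
rewrite bos_dec hantM bos_antG -[n]add0n; apply: HdegM; first exact: Hdeg_G.
by have := PT b n; rewrite (npr_id bN) eqxx.
Qed.

Definition Hpr i (a : H) : H := [ffun x => npr N i ((a : {ffun gT -> N}) x)].

Lemma Hpr_deg i a : Hdeg i (Hpr i a).
Proof. by move=> x; rewrite ffunE npr_mem. Qed.

Lemma Hpr_id i a j : Hdeg i a -> Hpr j a = if i == j then a else 0.
Proof.
move=> aN; apply/ffunP => x; rewrite ffunE (npr_id (aN x)).
by case: ifP => _ //; rewrite ffunE.
Qed.

Lemma Hpr_sum a : a = \sum_(i < nbound N) Hpr i a.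
Proof.
apply/ffunP => x; rewrite sum_ffunE -[LHS]npr_sum; apply: eq_bigr => i _.
by rewrite ffunE.
Qed.

Lemma Hpr_lin i : lin (Hpr i).
Proof. by move=> c u v; apply/ffunP => x; rewrite !ffunE linearP. Qed.

(** The antipode preserves degrees, so it commutes with the projections [Hpr n], and by injectivity
    so does its inverse. *)
Lemma Hdeg_V n a : Hdeg n a -> Hdeg n (hantV a).
Proof.
have lS := @hant_lin _ H (bos_laws N); move=> aN.
suff <- : Hpr n (hantV a) = hantV a by apply: Hpr_deg.
apply: (@hant_inj _ H); rewrite hantVK.
have aE : a = Hpr n (hant (hantV a)) by rewrite hantVK (Hpr_id _ aN) eqxx.
rewrite [RHS]aE [in RHS](Hpr_sum (hantV a)) (lin_bigsum lS) (lin_bigsum (Hpr_lin n)).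
have hit i : Hpr n (hant (Hpr i (hantV a))) = if i == n then hant (Hpr n (hantV a)) else 0.
  by rewrite (Hpr_id _ (Hdeg_S (Hpr_deg i _))); case: eqP => [->|].
under [RHS]eq_bigr => i _ do rewrite hit.
have [z _ _] := nboundP N.
case: (ltnP n (nbound N)) => [ln | gn].
  move: (hant _) => c; rewrite (bigD1 (Ordinal ln)) //= eqxx big1 ?addr0 // => i.
  by rewrite -val_eqE /= => /negPf->.
rewrite [RHS]big1 => [|i _]; last by case: eqP => // ni; have := ltn_ord i; rewrite ni ltnNge gn.
have -> : Hpr n (hantV a) = 0; last exact: lin0 lS.
by apply/ffunP => x; rewrite !ffunE; have := npr_mem n ((hantV a : {ffun gT -> N}) x); rewrite (z _ gn) memv0 => /eqP.
Qed.

Definition degH j (phi : dualv H) : Prop := forall i a, Hdeg i a -> i != j -> phi a = 0.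

Lemma degH_jf f : degH 0 (jf N f).
Proof.
move=> i a aN i0; have lj : lin (jf N f) := lin_lfun _.
apply: (Hdeg_ind (n := i) (P := fun a => jf N f a = 0)) aN => [|b x bN].
  split=> [|c u v Pu Pv]; first exact: lin0 lj.
  by rewrite lj Pu Pv scaler0 addr0.
by rewrite jf_pure (ncou_deg _ bN) ?mul0r // lt0n.
Qed.

Lemma degH_Vbar f : in_Vbar f -> degH 1 (Vd f).
Proof.
move=> [y [_ f0]] i a aN i1; rewrite VdE.
have lf : lin f := lin_lfun _.
apply: (Hdeg_ind (n := i) (P := fun a => f a = 0)) (Hdeg_V aN) => [|b x bN].
  split=> [|c u v Pu Pv]; first exact: lin0 lf.
  by rewrite lf Pu Pv scaler0 addr0.
by apply: (f0 i) => //; apply/eqP.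
Qed.

Lemma npr_act i g (b : N) : npr N i (act g b) = act g (npr N i b).
Proof.
rewrite -[in LHS](npr_sum b) linear_sum (lin_bigsum (lin_lfun (npr N i))).
have hit j : npr N i (act g (npr N j b)) = if j == i then act g (npr N i b) else 0.
  by rewrite (npr_id (ngr_act g (npr_mem j b))); case: eqP => [->|].
under eq_bigr => j _ do rewrite hit.
have [z _ _] := nboundP N.
case: (ltnP i (nbound N)) => [ln | gn].
  rewrite (bigD1 (Ordinal ln)) //= eqxx big1 ?addr0 // => j.
  by rewrite -val_eqE /= => /negPf->.
rewrite big1 => [|j _]; last by case: eqP => // ni; have := ltn_ord j; rewrite ni ltnNge gn.
by have := npr_mem i b; rewrite (z _ gn) memv0 => /eqP ->; rewrite linear0.
Qed.

End Degrees.

(** * The grading of the Verma module *)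

Section VermaDegrees.
Variables (k : fieldType) (gT : finGroupType) (V : vectType k).
Variables (Y : yd_struct gT V) (N : nichols_algebra Y).
Implicit Types (X : vectType k).

Local Notation act := (yd_act (nyd N)).
Local Notation H := (bosonization N).
Local Notation "b # x" := (at_grp b x : {ffun gT -> N}) (at level 38).

Local Notation K := (group_hopf k gT).
Local Notation DG := (dbl_group k gT).
Local Notation D := (dbl N).
Local Notation grp := (@Defs.grp k gT).

Variable M : operators DG.
Context {ML : mod_laws M}.
Local Notation VM := (verma N M).
Local Notation pi := (@dbl_ge0_proj _ _ _ _ N).

Lemma ve_nact (c b : N) m : mact (fb (c # 1%g : H) : D) (ve b m : VM) = ve (c * b) m.
Proof. by rewrite /ve verma_act fbM bos_mulE yd_act1 mulg1. Qed.

Lemma ve_gact x (b : N) m :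
  mact (fb (1 # x : H) : D) (ve b m : VM) = ve (act x b) (mact (fb (grp x : K) : DG) m).
Proof.
rewrite /ve verma_act fbM bos_mulE mul1r mulg1 (bos_dec _ x) -fbM.
rewrite -(ginc_grp N x) -(from_fb N) vpure_ge0 ?from_ge0 //.
have E : pi (from_dbl_group N (fb (grp x : K))) = fb (grp x : K) by exact: from_dbl_groupK.
by rewrite E.
Qed.

(** A functional of degree [j] lowers degrees by [j]: in the cross relation it is evaluated on the
    two outer legs of [b], whose degrees must add up to [j], and the middle leg remains. The premise
    [j <= n] guards the truncated subtraction. *)
Lemma ve_fd j (phi : dualv H) n (b : N) m (Q : VM -> Prop) :
  degH j phi -> b \in ngr N n -> subspace Q ->
  (forall c m', (j <= n)%N -> c \in ngr N (n - j) -> Q (ve c m')) ->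
  Q (mact (fd phi : D) (ve b m : VM)).
Proof.
move=> dphi bN sQ Qve; have bv := ve_bil N M.
rewrite -[mact _ _]PhiK /ve verma_act Phi_vpure /phi1.
have lt : lin (tlift (@ve _ _ _ _ N M)) by exact: tlift_is_linear.
have QD u w : Q u -> Q w -> Q (u + w) by move=> Qu Qw; rewrite -[u]scale1r; apply: sQ.2.
have Q0 := sQ.1.
pose R (w : H) := forall g m', Q (ve ((w : {ffun gT -> N}) g) m').
have sR : subspace R.
  split=> [g m'|c u v Ru Rv g m']; first by rewrite ffunE (lin0 (bv.1 m')).
  by rewrite !ffunE (bv.1 m'); apply: sQ.2; [apply: Ru | apply: Rv].
have Rdev x : R (dev (hmul (fd phi : D) (fb (b # 1%g : H))) (1 # x : H)).
  rewrite dev_fdfb /csw.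
  apply: (Hdeg_sw2 _ sR _ (Hdeg_pure 1%g bN)) => [|i u1 v ni u1N vN]; first by slin.
  apply: (Hdeg_sw2 _ sR _ vN) => [|i2 u2 u3 ni2 u2N u3N]; first by slin.
  have dN : Hdeg (i + (n - i - i2))%N (hmul (hmul u1 (1 # x : H)) (hant u3)).
    by apply: HdegM; [rewrite -[i]addn0; apply: HdegM => //; apply: Hdeg_G | apply: Hdeg_S].
  have [dj|nj] := eqVneq (i + (n - i - i2))%N j; last first.
    by rewrite (dphi _ _ dN nj) scale0r; apply: sR.1.
  rewrite -[_ *: _]addr0; apply: sR.2; last exact: sR.1.
  have jn : (j <= n)%N by rewrite -dj -subnDA -leq_subRL ?leq_sub2l ?leq_addr.
  have i2E : i2 = (n - j)%N.
    by rewrite -dj subnDA subnBA // addnC addnK.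
  by move=> g m'; apply: Qve => //; rewrite -i2E.
rewrite (lin_bigsum lt); apply: (big_ind Q) => // x _.
rewrite (lin_bigsum lt); apply: (big_ind Q) => // g _.
by rewrite tliftp //; apply: Rdev.
Qed.

Definition Pr i (v : VM) : VM := tlift (fun b m => ve (npr N i b) m) (Phi v).

Lemma Pr_lin i : lin (Pr i).
Proof. by move=> a u v; rewrite /Pr Phi_lin tlift_is_linear. Qed.

Lemma Pr_ve i b m : Pr i (ve b m) = ve (npr N i b) m.
Proof.
have bv := ve_bil N M; rewrite /Pr Phi_ve tliftp //.
by split=> u; [apply: (bil_l _ bv); slin | exact: bv.2].
Qed.

Lemma Pr_sum v : v = \sum_(i < nbound N) Pr i v.
Proof.
have bv := ve_bil N M; move: v; apply: ve_ext => [||b m]; first exact: lin_id.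
  by apply: lin_sum => i; apply: Pr_lin.
rewrite -[b in LHS]npr_sum (lin_bigsum (bv.1 m)); apply: eq_bigr => i _.
by rewrite Pr_ve.
Qed.

Lemma ve_deg_ext (X : lmodType k) (f f' : VM -> X) : lin f -> lin f' ->
  (forall n b m, b \in ngr N n -> f (ve b m) = f' (ve b m)) -> f =1 f'.
Proof.
move=> lf lf' ff; apply: ve_ext => // b m; have bv := ve_bil N M.
rewrite -(npr_sum b) (lin_bigsum (bv.1 m)) (lin_bigsum lf) (lin_bigsum lf').
by apply: eq_bigr => i _; apply: (ff i); apply: npr_mem.
Qed.

Lemma Pr_Pr i j v : Pr i (Pr j v) = if j == i then Pr i v else 0.
Proof.
move: v; apply: ve_ext => [||b m].
- exact: (lin_comp (Pr_lin i) (Pr_lin j)).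
- by apply: lin_if; [apply: Pr_lin | apply: lin_zero].
rewrite !Pr_ve (npr_id (npr_mem j b)); case: eqP => [->//|_].
by rewrite (lin0 ((ve_bil N M).1 m)).
Qed.

Lemma Pr_gact i x v : Pr i (mact (fb (1 # x : H) : D) v) = mact (fb (1 # x : H) : D) (Pr i v).
Proof.
have bm := verma_bil N M; move: v; apply: ve_ext => [||b m].
- exact: (lin_comp (Pr_lin i) (bm.2 _)).
- exact: (lin_comp (bm.2 _) (Pr_lin i)).
by rewrite !ve_gact !Pr_ve ve_gact npr_act.
Qed.

Lemma Pr_fd0 i (phi : dualv H) v : degH 0 phi ->
  Pr i (mact (fd phi : D) v) = mact (fd phi : D) (Pr i v).
Proof.
move=> dphi; have bm := verma_bil N M; have bv := ve_bil N M.
move: v; apply: ve_deg_ext => [||n b m bN].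
- exact: (lin_comp (Pr_lin i) (bm.2 _)).
- exact: (lin_comp (bm.2 _) (Pr_lin i)).
transitivity (if n == i then mact (fd phi : D) (ve b m : VM) else 0).
  apply: (ve_fd (Q := fun v => Pr i v = if n == i then v else 0) _ dphi bN).
    split=> [|c u v Pu Pv]; first by rewrite (lin0 (Pr_lin i)) if_same.
    by rewrite (Pr_lin i) Pu Pv; case: eqP => // _; rewrite scaler0 addr0.
  move=> c m' _; rewrite subn0 => cN; rewrite Pr_ve (npr_id cN); case: eqP => // _.
  exact: lin0 (bv.1 m').
rewrite Pr_ve (npr_id bN); case: eqP => // _.
by rewrite (lin0 (bv.1 m)) (lin0 (bm.2 _)).
Qed.

Lemma Pr_from i (t : DG) v :
  Pr i (mact (from_dbl_group N t) v) = mact (from_dbl_group N t) (Pr i v).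
Proof.
have bm := verma_bil N M; have lF := @from_lin _ _ _ _ N.
move: t; apply: dg_ext => [||h x].
- exact: (lin_comp (Pr_lin i) (lin_comp (bm.1 v) lF)).
- exact: (lin_comp (bm.1 _) lF).
rewrite /dg -fbfd from_fbfd ginc_grp !mactM Pr_gact Pr_fd0 //.
exact: degH_jf.
Qed.

(** The antipode stands here because dual modules act through it. It keeps \overline V in degree
    one, and a vector could only be lowered into the top degree from above. *)
Lemma Pr_top_Vbar ntop f v : max_degree N ntop -> in_Vbar f ->
  Pr ntop (mact (hant (fd f : D)) v) = 0.
Proof.
move=> [_ top] fV; have bm := verma_bil N M; have bv := ve_bil N M.
rewrite dblS_fd; move: v; apply: ve_deg_ext => [||n b m bN].
- exact: (lin_comp (Pr_lin ntop) (bm.2 _)).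
- exact: lin_zero.
case: (ltnP ntop n) => [/top n0 | ntn].
  by move: bN; rewrite n0 memv0 => /eqP ->; rewrite (lin0 (bv.1 m)) (lin0 (bm.2 _)) (lin0 (Pr_lin _)).
apply: (ve_fd (Q := fun v => Pr ntop v = 0) _ (degH_Vbar fV) bN).
  split=> [|c u v Pu Pv]; first exact: lin0 (Pr_lin _).
  by rewrite (Pr_lin ntop) Pu Pv scaler0 addr0.
move=> c m' n1 cN; rewrite Pr_ve (npr_id cN); case: eqP => [ntE|_]; last exact: lin0 (bv.1 m').
by move: ntn; rewrite -ntE leqNgt ltn_subrL n1.
Qed.

End VermaDegrees.

Lemma tens_sepr (k : fieldType) (U W : vectType k) (t : tens U W) :
  (forall xi : dualv W, tlift (fun a b => (xi b : k) *: a) t = 0) -> t = 0.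
Proof.
move=> t0; apply: tens_sepl => eta; apply: dual_sep => xi.
have l : lin xi := lin_lfun xi; have l' : lin eta := lin_lfun eta.
rewrite (lin_tlift _ _ l).
have := congr1 eta (t0 xi); rewrite (lin_tlift _ _ l') linear0 => <-.
apply: (eq_tlift (X := k^o)) => a b; rewrite (linZ l) (linZ l').
by rewrite /GRing.scale /= mulrC.
Qed.

(** * The adjoint action of D(G) on the Nichols algebra *)

Section DoubleGroupCop.
Variables (k : fieldType) (gT : finGroupType).
Local Notation DG := (dbl_group k gT).
Local Notation K := (group_hopf k gT).
Local Notation grp := (@Defs.grp k gT).

Lemma sw2_dual_grp (X : vectType k) (G : dualv K -> dualv K -> X) (f : dual_hopf K) :
  bil G ->
  sw2 (H := dual_hopf K) f (G : dual_hopf K -> dual_hopf K -> X) =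
  \sum_x \sum_y ((f : dualv K) (grp (x * y)%g) : k) *: G (dl k x) (dl k y).
Proof.
move=> bG; have [g1 g2] := bG.
have l f1 f2 : G f1 f2 = \sum_x \sum_y ((f1 (grp x) : k) * f2 (grp y)) *: G (dl k x) (dl k y).
  rewrite {1}(dual_grp_dec f1) (lin_bigsum (g1 f2)); apply: eq_bigr => x _.
  rewrite (linZ (g1 f2)) {1}(dual_grp_dec f2) (lin_bigsum (g2 _)) scaler_sumr.
  by apply: eq_bigr => y _; rewrite (linZ (g2 _)) scalerA.
transitivity (sw2 (H := dual_hopf K) f (fun f1 f2 : dual_hopf K => \sum_x \sum_y
   (((f1 : dualv K) (grp x) : k) * (f2 : dualv K) (grp y)) *: G (dl k x) (dl k y))).
  by apply: eq_sw2 => f1 f2; exact: l.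
rewrite /sw2 tlift_bigsum; apply: eq_bigr => x _.
rewrite tlift_bigsum; apply: eq_bigr => y _.
have lz : lin (fun c : k^o => (c : k) *: G (dl k x) (dl k y)) by slin.
rewrite -grp_mul -sw2_dualE; exact/esym/(lin_tlift _ _ lz).
Qed.

Lemma dg_sw2 (X : vectType k) (F : DG -> DG -> X) h z : bil F ->
  sw2 (dg k h z) F = \sum_p F (dg k h p) (dg k h (p^-1 * z)%g).
Proof.
move=> bF; have ld := @dcop_lin _ K; have lc := @grp_cop_lin k gT.
rewrite /sw2 /dg /= tliftp; last by rewrite /sw2; slin.
rewrite -/(sw2 _ _) grp_sw2; last by rewrite /sw2; slin.
have lF : lin (tlift F) by exact: tlift_is_linear.
rewrite /sw2 (lin_tlift _ _ lF).
pose G (f1 f2 : dualv K) := F (tpure (grp h : K) f1) (tpure (grp h : K) f2).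
have bG : bil G by rewrite /G; slin.
transitivity (sw2 (H := dual_hopf K) (dl k z : dual_hopf K) (G : dual_hopf K -> dual_hopf K -> X)).
  by apply: eq_tlift => f1 f2; rewrite tliftp.
rewrite (sw2_dual_grp _ bG); apply: eq_bigr => p _.
rewrite (bigD1 (p^-1 * z)%g) // big1 => [|y ny]; rewrite dlE grpE.
  by rewrite mulKVg eqxx scale1r; apply: addr0.
rewrite (_ : (z == p * y)%g = false) ?scale0r //.
by apply: contraNF ny => /eqP->; rewrite mulKg.
Qed.

Lemma hant_dg h r : hant (dg k h r : DG) = hmul (fd (dl k r^-1%g) : DG) (fb (grp h^-1%g : K)).
Proof.
rewrite /dg dblS_pure grp_ant; congr (hmul (fd _ : DG) _); apply/lfunP => a.
rewrite VdE dlE dlE; have lV := @hantV_lin _ K; move: a.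
apply: grp_ext => [||x]; [by apply: lin_ffun | by apply: lin_ffun | ].
have -> : hantV (grp x : K) = grp x^-1%g by apply: (@hant_inj _ K); rewrite hantVK grp_ant invgK.
by rewrite !grpE -(inj_eq invg_inj) invgK.
Qed.

End DoubleGroupCop.

Section AdjointAction.
Variables (k : fieldType) (gT : finGroupType) (V : vectType k).
Variables (Y : yd_struct gT V) (N : nichols_algebra Y).
Implicit Types (X : vectType k).

Local Notation act := (yd_act (nyd N)).
Local Notation co := (yd_co (nyd N)).
Local Notation H := (bosonization N).
Local Notation "b # x" := (at_grp b x : {ffun gT -> N}) (at level 38).
Local Notation e := (ncou N).

Local Notation K := (group_hopf k gT).
Local Notation DG := (dbl_group k gT).
Local Notation D := (dbl N).
Local Notation grp := (@Defs.grp k gT).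

Lemma cohatM (u v : H) : cohat (hmul u v) = hmul (cohat u) (cohat v).
Proof.
have lc := @cohat_lin _ _ _ _ N.
have cb c y : cohat (c # y) = (e c : k) *: (grp y : K).
  apply/ffunP => z; rewrite !ffunE; case: eqP => _; rewrite /GRing.scale /=.
    by rewrite mulr1.
  by rewrite linear0 mulr0.
move: u; apply: ffun_ext; [by slin | by slin | move=> b x].
move: v; apply: ffun_ext; [exact: (lin_comp lc ((@hmul_bil _ H (bos_laws N)).2 _)) | by slin | move=> c y].
have [m1 m2] := @hmul_bil _ K (grp_laws k gT).
by rewrite bos_mulE !cb (linZ (m1 _)) (linZ (m2 _)) grp_mul scalerA ncou_mul nact_cou.
Qed.

Lemma jf_cohat f (a : H) : jf N f a = f (cohat a).
Proof.
rewrite jfE [cohat a]grp_dec linear_sum; apply: eq_bigr => x _.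
by rewrite linearZ ffunE.
Qed.

Lemma cohat_pure (b : N) x : cohat (b # x) = (e b : k) *: (grp x : K).
Proof.
apply/ffunP => z; rewrite !ffunE; case: eqP => _; rewrite /GRing.scale /=.
  by rewrite mulr1.
by rewrite linear0 mulr0.
Qed.

Lemma sw2_cohatl (X : vectType k) (G : K -> H -> X) (b : N) x : bil G ->
  sw2 (b # x : H) (fun u v => G (cohat u) v) = \sum_h G (grp (h * x)%g) (co h b # x).
Proof.
move=> bG; have lc := @cohat_lin _ _ _ _ N; rewrite bos_sw2; last by slin.
rewrite tlift_bigsum; apply: eq_bigr => h _.
have l : lin (fun b : N => G (grp (h * x)%g) (co h b # x)) by slin.
rewrite -[in RHS](ncou_l b) (lin_tlift _ _ l); apply: eq_tlift => b1 b2.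
by rewrite cohat_pure (linZ l) (linZ (bG.1 _)).
Qed.

Lemma sw2_cohatr (X : vectType k) (G : H -> K -> X) (b : N) x : bil G ->
  sw2 (b # x : H) (fun u v => G u (cohat v)) = G (b # x) (grp x).
Proof.
move=> bG; have lc := @cohat_lin _ _ _ _ N; rewrite bos_sw2; last by slin.
have l : lin (fun b : N => G (b # x) (grp x)) by slin.
rewrite -[in RHS](ncou_r b) (lin_tlift _ _ l); apply: eq_tlift => b1 b2.
rewrite (bigD1 1%g) // big1 => [|h nh]; rewrite cohat_pure nco_cou.
  by rewrite eqxx mul1g (linZ (bG.2 _)) (linZ l); apply: addr0.
by rewrite (negPf nh) scale0r (lin0 (bG.2 _)).
Qed.

Lemma cohat_ant (u : H) : cohat (hant u) = hant (cohat u).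
Proof.
have lc := @cohat_lin _ _ _ _ N; have lS := @hant_lin _ H (bos_laws N).
have lS' := @hant_lin _ K (grp_laws k gT).
move: u; apply: ffun_ext; [by slin | by slin | move=> b x].
rewrite bos_ant_pure (lin_bigsum lc) (bigD1 1%g) // big1 => [|h nh]; rewrite cohatM !cohat_pure ncou_ant nco_cou.
  rewrite eqxx ncou_one scale1r (linZ ((@hmul_bil _ K (grp_laws k gT)).2 _)) grp_mul mulg1 mul1g (linZ lS') grp_ant.
  exact: addr0.
by rewrite (negPf nh) scale0r (lin0 ((@hmul_bil _ K (grp_laws k gT)).2 _)).
Qed.

Definition shift (f : dualv K) (p : gT) : dualv K :=
  functional (fun a => f (hmul (grp p : K) a)).

Lemma shiftE f p a : shift f p a = f (hmul (grp p : K) a).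
Proof. by rewrite functional_lin //; slin. Qed.

(** An element of k^G sees only the group parts of the outer legs of [b # 1]: the left one carries
    the coaction degree [p], the right one is trivial. *)
Lemma jf_fb (f : dualv K) (b : N) :
  hmul (fd (jf N f) : D) (fb (b # 1%g : H)) =
  \sum_p hmul (fb (co p b # 1%g : H) : D) (fd (jf N (shift f p))).
Proof.
have lc := @cohat_lin _ _ _ _ N.
apply: dev_inj => a; rewrite dev_fdfb (lin_bigsum (@dbl_dev_lin _ H a)) /csw.
transitivity (sw2 (b # 1%g : H) (fun u1 v => sw2 v (fun u2 u3 =>
   (f (hmul (hmul (cohat u1) (cohat a)) (hant (cohat u3))) : k) *: u2))).
  by do 2!apply: eq_sw2 => ? ?; rewrite jf_cohat !cohatM cohat_ant.
rewrite (sw2_cohatl (G := fun w v => sw2 v (fun u2 u3 =>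
   (f (hmul (hmul w (cohat a)) (hant (cohat u3))) : k) *: u2))); last by slin.
apply: eq_bigr => p _; rewrite mulg1.
rewrite (sw2_cohatr (G := fun u2 w =>
   (f (hmul (hmul (grp p : K) (cohat a)) (hant w)) : k) *: u2)); last by slin.
by rewrite fbfd dev_pure jf_cohat shiftE grp_ant invg1 -[grp 1%g]/(hone K) hmul1r.
Qed.

Lemma dl_mul (x y : gT) : (hmul (dl k x : dual_hopf K) (dl k y : dual_hopf K) : dualv K) =
  if x == y then dl k x else 0.
Proof.
apply/lfunP; apply: grp_ext => [||z]; [exact: lin_lfun | exact: lin_lfun | ].
rewrite dmulE (grp_sw2 (X := k^o) (F := fun a b => dl k x a * dl k y b : k^o)); last by slin.
rewrite !dlE !grpE; case: (eqVneq x y) => [->|nxy].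
  by rewrite dlE grpE; case: eqP => _; rewrite ?mulr1 ?mulr0.
rewrite zero_lfunE; case: (eqVneq x z) => [xz|_]; last by rewrite mul0r.
by rewrite -xz eq_sym (negPf nxy) mulr0.
Qed.

Lemma shift_dl q p : shift (dl k q) p = dl k (p^-1 * q)%g.
Proof.
apply/lfunP; apply: grp_ext => [||z]; [exact: lin_lfun | exact: lin_lfun | ].
rewrite shiftE grp_mul !dlE !grpE; congr (_%:R); congr nat_of_bool.
by apply/eqP/eqP => [->|<-]; rewrite ?mulKg ?mulKVg.
Qed.

Lemma sum_dl : \sum_q dl k q = hone (dual_hopf K) :> dualv K.
Proof.
apply/lfunP => a; rewrite sum_lfunE doneE.
by apply: eq_bigr => q _; rewrite dlE.
Qed.

Lemma adj_dg h z (x : D) : @mact _ _ (adjoint_mod N) (dg k h z) x =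
  \sum_q hmul (hmul (from_dbl_group N (dg k h q) : D) x)
    (from_dbl_group N (hant (dg k h (q^-1 * z)%g : DG))).
Proof.
have lF := @from_lin _ _ _ _ N; have bm := @dbl_mul_bil k H (bos_laws N).
have lS := @dblS_lin _ K.
by rewrite /= dg_sw2 //; split=> u; slin.
Qed.

(** The adjoint action is the Yetter-Drinfeld structure. Moving δ_q past [b] shifts it by the
    coaction degree, so the δ on the other side keeps only degree [z]; the sum over q of the
    remaining δ is 1, and conjugation by [h] is the group action. *)
Lemma adj_fb h z (b : N) : @mact _ _ (adjoint_mod N) (dg k h z) (fb (b # 1%g : H) : D) =
  (fb (act h (co z b) # 1%g : H) : D).
Proof.
have [bm1 bm2] := @dbl_mul_bil k H (bos_laws N).
have lj := @jf_lin _ _ _ _ N; have lfd := @fd_lin _ H.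
rewrite adj_dg.
transitivity (\sum_q hmul (hmul (fb (1 # h : H) : D) (hmul (fb (co z b # 1%g : H) : D)
    (fd (jf N (dl k (z^-1 * q)%g))))) (fb (1 # h^-1%g : H))).
  apply: eq_bigr => q _.
  rewrite hant_dg fromM from_fd from_fb ginc_grp invMg invgK.
  rewrite /dg -fbfd from_fbfd ginc_grp -!dbl_mulA; congr (hmul _ _).
  rewrite !dbl_mulA; congr (hmul _ _); rewrite jf_fb (lin_bigsum (bm1 _)).
  rewrite (bigD1 z) // big1 => [|p np]; rewrite -dbl_mulA fdM -jfM shift_dl dl_mul.
    by rewrite eqxx; apply: addr0.
  rewrite (inj_eq (mulIg q)) (inj_eq invg_inj) eq_sym (negPf np).
  by rewrite (lin0 lj) (lin0 lfd) (lin0 (bm2 _)).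
rewrite -(lin_bigsum (bm1 (fb (1 # h^-1%g : H)))) -(lin_bigsum (bm2 _)) -(lin_bigsum (bm2 _)).
rewrite -(lin_bigsum lfd) -(lin_bigsum lj).
have -> : \sum_i dl k (z^-1 * i)%g = \sum_q dl k q by rewrite [RHS](reindex_inj (mulgI z^-1%g)).
rewrite sum_dl jf1 fd1 dbl_mul1r !fbM !bos_mulE mul1r mulg1 nact_one mulr1 mulgV.
by [].
Qed.

Lemma nichols_partP n (x : D) : x \in nichols_part N n <->
  exists2 b : N, b \in ngr N n & x = fb (b # 1%g : H).
Proof.
have lfb := @fb_lin _ H; have l : lin (fun b : N => fb (b # 1%g : H)) by slin.
apply: (@spannedP _ _ (fun x : D => exists2 b, b \in ngr N n & x = from_bos (at_grp b 1%g : H))).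
split=> [|c u v [b bN ->] [b' b'N ->]].
  by exists 0; rewrite ?mem0v //; symmetry; exact: (lin0 l).
exists (c *: b + b'); first by rewrite memvD ?memvZ.
by symmetry; exact: (l c b b').
Qed.

End AdjointAction.

Lemma tens_mod_pure (k : fieldType) (A : hopf_data k) (M1 M2 : operators A)
    (b1 : bil (@mact _ _ M1)) (b2 : bil (@mact _ _ M2)) (t : A) (x : M1) (m : M2) :
  @mact _ _ (tens_mod M1 M2) t (tpure x m) =
  sw2 t (fun a1 a2 => tpure (mact a1 x) (mact a2 m)).
Proof. by rewrite /= tliftp //; split=> u; slin. Qed.

(** * Submodules of the Verma module *)

Section VermaSubmodules.
Variables (k : fieldType) (gT : finGroupType) (V : vectType k).
Variables (Y : yd_struct gT V) (N : nichols_algebra Y).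
Implicit Types (X : vectType k).

Local Notation act := (yd_act (nyd N)).
Local Notation co := (yd_co (nyd N)).
Local Notation H := (bosonization N).
Local Notation "b # x" := (at_grp b x : {ffun gT -> N}) (at level 38).
Local Notation e := (ncou N).

Local Notation K := (group_hopf k gT).
Local Notation DG := (dbl_group k gT).
Local Notation D := (dbl N).
Local Notation grp := (@Defs.grp k gT).

Variable M : operators DG.
Context {ML : mod_laws M}.
Local Notation VM := (verma N M).
Local Notation pi := (@dbl_ge0_proj _ _ _ _ N).

Lemma vpure_from (d : D) (t : DG) m :
  vpure (N := N) (M := M) (hmul d (from_dbl_group N t)) m = vpure d (mact t m).
Proof.
rewrite vpure_ge0 ?from_ge0 //.
by have -> : pi (from_dbl_group N t) = t by exact: from_dbl_groupK.
Qed.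

Lemma ve1E (m : M) : ve 1 m = vpure (hone D) m :> VM.
Proof. by []. Qed.

Lemma from_ve1 (t : DG) m : mact (from_dbl_group N t) (ve 1 m : VM) = ve 1 (mact t m).
Proof. by rewrite !ve1E verma_act dbl_mul1r -[from_dbl_group N t]dbl_mul1l vpure_from. Qed.

Lemma Pr0E v : exists m, Pr 0 v = ve (1 : N) m :> VM.
Proof.
have bv := ve_bil N M; exists (tlift (fun b m => (e b : k) *: m) (Phi v)).
rewrite (lin_tlift _ _ (bv.2 1)); apply: eq_tlift => b m.
by rewrite npr0E (linZ (bv.1 m)) (linZ (bv.2 1)).
Qed.

Lemma Pr_nact i j l (c : N) v : c \in ngr N j -> j + l != i ->
  Pr i (mact (fb (c # 1%g : H) : D) (Pr l v)) = 0 :> VM.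
Proof.
move=> cN jl; have bm := verma_bil N M; move: v; apply: ve_ext => [||b m].
- exact: (lin_comp (@Pr_lin _ _ _ _ N M i) (lin_comp (bm.2 _) (@Pr_lin _ _ _ _ N M l))).
- exact: lin_zero.
rewrite Pr_ve ve_nact Pr_ve (npr_id (ngr_mul cN (npr_mem l b))) (negPf jl).
exact: lin0 ((ve_bil N M).1 m).
Qed.

Lemma Pr_nact_lt i j d (c : N) (v : VM) : c \in ngr N j -> (forall l, (l < d)%N -> Pr l v = 0) ->
  (i < j + d)%N -> Pr i (mact (fb (c # 1%g : H) : D) v) = 0.
Proof.
move=> cN v0 ij; have bm := verma_bil N M.
rewrite (Pr_sum v) (lin_bigsum (bm.2 _)) (lin_bigsum (@Pr_lin _ _ _ _ N M i)) big1 // => l _.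
case: (ltnP l d) => [/v0 ->|dl].
  by rewrite (lin0 (bm.2 _)) (lin0 (@Pr_lin _ _ _ _ N M i)).
apply: (Pr_nact _ cN); rewrite neq_ltn (leq_trans ij) ?orbT //.
by rewrite leq_add2l.
Qed.

Lemma Pr_all_eq0 (v : VM) : (forall i, (i < nbound N)%N -> Pr i v = 0) -> v = 0.
Proof. by move=> v0; rewrite (Pr_sum v) big1 // => i _; apply: v0. Qed.

(** Acting by an element of positive degree raises the lowest degree in which a vector may live.
    Degrees are bounded, so the process ends at a nonzero vector that every such element kills. *)
Lemma submodule_killed (X : {vspace VM}) : submodule X -> X != 0%VS ->
  exists v, [/\ v \in X, v != 0 & forall i (c : N), (0 < i)%N -> c \in ngr N i ->
    mact (fb (c # 1%g : H) : D) v = 0].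
Proof.
move=> sX nX; pose good d := exists v, [/\ v \in X, v != 0 & forall i, (i < d)%N -> Pr i v = 0].
have step n : forall d, (nbound N - d < n)%N -> good d ->
   exists v, [/\ v \in X, v != 0 & forall i (c : N), (0 < i)%N -> c \in ngr N i ->
    mact (fb (c # 1%g : H) : D) v = 0].
  elim: n => // n IHn d dn [v [vX nv v0]].
  case: (classic (forall i (c : N), (0 < i)%N -> c \in ngr N i ->
    mact (fb (c # 1%g : H) : D) v = 0)) => [h|nk]; first by exists v.
  have [i [c [i0 cN nz]]] : exists i (c : N), [/\ (0 < i)%N, c \in ngr N i &
      mact (fb (c # 1%g : H) : D) v != 0].
    apply: NNPP => nex; apply: nk => i c i0 cN; apply/eqP.
    by apply: contra_notT nex => nz; exists i, c.
  apply: (IHn d.+1).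
    rewrite subnS -ltnS prednK // subn_gt0 ltnNge; apply: contraNN nv => nd.
    by apply/eqP/Pr_all_eq0 => j jn; apply: v0; apply: leq_trans jn nd.
  exists (mact (fb (c # 1%g : H) : D) v); split=> //; first exact: sX.
  move=> j jd; apply: (Pr_nact_lt cN v0); apply: leq_trans jd _.
  by rewrite -add1n leq_add2r.
apply: (step _ 0%N (ltnSn _)); exists (vpick X); split=> //; first exact: memv_pick.
by rewrite vpick0.
Qed.

(** Evaluating the M-side of [v] at functionals reduces the claim to [N]: each evaluation [b_xi] is
    annihilated on the left by positive degrees, so [left_annihilated_top] places it in the top
    degree. *)
Lemma killed_top ntop (v : VM) : max_degree N ntop ->
  (forall i (c : N), (0 < i)%N -> c \in ngr N i -> mact (fb (c # 1%g : H) : D) v = 0) ->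
  Pr ntop v = v.
Proof.
move=> mtop vk; have bm := verma_bil N M; have bv := ve_bil N M.
rewrite -[RHS](PhiK v) /Pr.
set t := Phi v.
have tk i (c : N) : (0 < i)%N -> c \in ngr N i ->
    tlift (fun b m => tpure (c * b) m) t = 0 :> tens N M.
  move=> i0 cN; have := congr1 (@Phi _ _ _ _ N M) (vk i c i0 cN).
  rewrite (lin0 (@Phi_lin _ _ _ _ N M)) => <-.
  rewrite -[in RHS](PhiK v) (lin_tlift _ _ (bm.2 _)) (lin_tlift _ _ (@Phi_lin _ _ _ _ N M)).
  by apply: eq_tlift => b m; rewrite ve_nact Phi_ve.
have l1 : lin (fun t : tens N M => tlift (fun b m => tpure (npr N ntop b) m) t : tens N M) by slin.
have E : tlift (fun b m => tpure (npr N ntop b) m) t = t.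
  apply/eqP; rewrite -subr_eq0; apply/eqP; apply: tens_sepr => xi.
  have lx : lin (fun t : tens N M => tlift (fun b m => (xi m : k) *: b) t) by slin.
  rewrite (linB lx); pose b_xi := tlift (fun (b : N) (m : M) => (xi m : k) *: b) t.
  have -> : tlift (fun (b : N) (m : M) => (xi m : k) *: b)
      (tlift (fun b m => tpure (npr N ntop b) m) t) = npr N ntop b_xi.
    rewrite (lin_tlift _ _ lx) (lin_tlift _ _ (lin_lfun (npr N ntop))); apply: eq_tlift => b m.
    by rewrite tliftp ?linearZ //; slin.
  have bN : b_xi \in ngr N ntop.
    apply: (left_annihilated_top mtop) => i c i0 cN.
    have lc : lin (fun b : N => c * b) by slin.
    rewrite (lin_tlift _ _ lc).
    transitivity (tlift (fun b m => (xi m : k) *: b) (tlift (fun b m => tpure (c * b) m) t : tens N M)).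
      rewrite (lin_tlift _ _ lx); apply: eq_tlift => b m.
      by rewrite tliftp ?(linZ lc) //; slin.
    by rewrite (tk i) // (lin0 lx).
  by rewrite -/b_xi (npr_id bN) eqxx subrr.
rewrite -[in RHS]E tlift_tlift; apply: eq_tlift => b m.
by rewrite tliftp.
Qed.

(** The degree-zero components of vectors of [X] form a nonzero D(G)-submodule of [M], hence all of
    it. A vector of [X] with component [ve 1 m] may have a higher tail; descending induction on the
    lowest degree ([low]) takes care of it. *)
Lemma submodule_full (X : {vspace VM}) : simple_mod M -> submodule X ->
  (exists2 v, v \in X & Pr 0 v != 0) -> X = fullv.
Proof.
move=> [_ simM] sX [v vX nv]; have bm := verma_bil N M; have bv := ve_bil N M.
have lP i : lin (@Pr _ _ _ _ N M i) := @Pr_lin _ _ _ _ N M i.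
pose P m := exists2 v, v \in X & Pr 0 v = ve 1 m.
have sP : subspace P.
  split; first by exists 0; rewrite ?mem0v // (lin0 (lP 0%N)) (lin0 (bv.2 1)).
  move=> c m m' [u uX um] [u' u'X um']; exists (c *: u + u'); first by rewrite memvD ?memvZ.
  by rewrite (lP 0%N) um um' (bv.2 1).
have Pall m : P m.
  apply/(spannedP sP); rewrite (simM (spanned P)) ?memvf //.
    move=> t u /(spannedP sP)[w wX wu]; apply/(spannedP sP).
    by exists (mact (from_dbl_group N t) w); [exact: sX | rewrite Pr_from wu from_ve1].
  have [m0 m0E] := Pr0E v.
  have m0P : m0 \in spanned P by apply/(spannedP sP); exists v.
  apply: contraNneq nv => P0; move: m0P; rewrite P0 memv0 m0E => /eqP ->.
  by rewrite (lin0 (bv.2 1)).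
have low n : forall i, (nbound N - i < n)%N -> forall w : VM, (forall l, (l < i)%N -> Pr l w = 0) -> w \in X.
  elim: n => // n IHn i di w w0.
  case: (leqP (nbound N) i) => [ni | ni].
    by rewrite (Pr_all_eq0 (v := w)) ?mem0v // => j jn; apply: w0; apply: leq_trans jn ni.
  have IH : forall u : VM, (forall l, (l < i.+1)%N -> Pr l u = 0) -> u \in X.
    by apply: (IHn i.+1); rewrite subnS -ltnS prednK // subn_gt0.
  rewrite -[w](subrK (Pr i w)); apply: memvD.
    apply: IH => l; rewrite ltnS leq_eqVlt (linB (lP l)) => /orP[/eqP-> | li].
      by rewrite Pr_Pr eqxx subrr.
    by rewrite Pr_Pr (w0 l li) if_same subr0.
  rewrite /Pr /tlift; apply: memv_suml => a _; apply: memv_suml => b _; apply: memvZ.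
  move: (cbasis b) (npr_mem i (cbasis a)) => m; move: (npr N i _) => c cN.
  have [u uX um] := Pall m.
  (* The vector [u] of [X] begins with [ve 1 m], so acting by [c] gives [ve c m] up to terms of
     degree above [i], which lie in [X] by induction. *)
  rewrite -[ve c m](subKr (mact (fb (c # 1%g : H) : D) u)).
  apply: memvB; first exact: sX.
  have -> : ve c m = mact (fb (c # 1%g : H) : D) (ve 1 m : VM) by rewrite ve_nact mulr1.
  rewrite -(linB (bm.2 _)); apply: IH => l li.
  apply: (Pr_nact_lt cN (d := 1)); last by rewrite addn1.
  move=> l'; rewrite ltnS leqn0 => /eqP->; rewrite (linB (lP 0%N)) um Pr_ve.
  by rewrite (npr_id (i := 0)) ?eqxx ?subrr // ngr0 memv_line.
apply/eqP; rewrite eqEsubv subvf /=; apply/subvP => w _.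
exact: (low _ 0%N (ltnSn _)).
Qed.

Section TopComponent.
Variable ntop : nat.
Hypothesis mtop : max_degree N ntop.
Local Notation NM := (nichols_mod N ntop).

Definition theta (t : tens_mod NM M) : VM :=
  tlift (fun (x : NM) (m : M) => vpure (vsval x : D) m) t.

Lemma theta_lin : lin theta. Proof. exact: tlift_is_linear. Qed.

Lemma theta_pure (x : NM) m : theta (tpure x m) = vpure (vsval x : D) m.
Proof.
have bv := vpure_bil N M; rewrite /theta tliftp //; split=> [m'|x']; last exact: bv.2.
have lv : lin (fun x : NM => vsval x : D) by move=> a u v; exact: linearP.
exact: (lin_comp (bv.1 m') lv).
Qed.

Lemma adj_lin (t : DG) : lin (@mact _ _ (adjoint_mod N) t).
Proof.
move: t; have bm := @dbl_mul_bil k H (bos_laws N).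
by move=> t; apply: lin_tlift_fun => a b; slin.
Qed.

Lemma adj_linl (x : D) : lin (fun t : DG => @mact _ _ (adjoint_mod N) t x).
Proof. by apply: lin_tlift_arg; exact: tlift_is_linear. Qed.

Lemma adj_stable t (x : D) : x \in nichols_part N ntop ->
  @mact _ _ (adjoint_mod N) t x \in nichols_part N ntop.
Proof.
move=> /nichols_partP[b bN ->]; rewrite (dg_dec t) (lin_bigsum (@adj_linl _)).
apply: memv_suml => z _; rewrite (lin_bigsum (@adj_linl _)); apply: memv_suml => h _.
rewrite (linZ (@adj_linl _)) memvZ // adj_fb; apply/nichols_partP.
by exists (act h (co z b)) => //; rewrite ngr_act // ngr_co.
Qed.

Lemma nm_act t (x : NM) : vsval (mact t x) = @mact _ _ (adjoint_mod N) t (vsval x).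
Proof. by rewrite /= vsprojK //; apply: adj_stable; apply: subvsP. Qed.

Lemma nm_bil : bil (@mact _ _ NM).
Proof.
have lv : lin (fun x : NM => vsval x : D) by move=> a u v; exact: linearP.
have lp : lin (fun x : D => vsproj (nichols_part N ntop) x : NM).
  by move=> a u v; exact: linearP.
by split=> [x|t]; [exact: (lin_comp lp (adj_linl (vsval x))) | exact: (lin_comp lp (lin_comp (adj_lin t) lv))].
Qed.

Lemma tens_act_pure t (x : NM) m :
  @mact _ _ (tens_mod NM M) t (tpure x m) =
  sw2 t (fun a1 a2 => tpure (mact a1 x) (mact a2 m)).
Proof. exact: tens_mod_pure nm_bil (@mact_bil _ _ M ML) t x m. Qed.

Lemma tens_act_lin t : lin (@mact _ _ (tens_mod NM M) t).
Proof. exact: tlift_is_linear. Qed.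

Lemma tens_act_linl u : lin (fun t => @mact _ _ (tens_mod NM M) t u).
Proof.
apply: lin_tlift_fun => x m; apply: lin_tlift_arg; exact: tlift_is_linear.
Qed.

Lemma hant_dgM h q r : hmul (hant (dg k h q : DG)) (dg k h r : DG) =
  if q^-1%g == r then fd (dl k r) else 0 :> DG.
Proof.
have [d1 d2] := @dbl_mul_bil k K (grp_laws k gT).
rewrite hant_dg /dg -fbfd dbl_mulA -[hmul (hmul (fd _) _) _]dbl_mulA fbM grp_mul mulVg.
rewrite -[grp 1%g]/(hone K) fb1 dbl_mul1r fdM dl_mul eq_sym.
by case: eqP => // _; rewrite (lin0 (@fd_lin _ K)).
Qed.

(** This is the identity h x = (ad h_(1) x) h_(2). On basis elements, [hant_dgM] leaves one term of
    the double sum for each part of the coproduct, and the remaining δ add up to 1. *)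
Lemma theta_act t u : theta (mact t u) = mact (from_dbl_group N t) (theta u).
Proof.
have lF := @from_lin _ _ _ _ N; have bm := verma_bil N M.
have bn := nm_bil; have bM := @mact_bil _ _ M ML; have bv := vpure_bil N M.
have [d1 d2] := @dbl_mul_bil k H (bos_laws N).
move: u; apply: tens_ext => [||x m].
- exact: (lin_comp theta_lin (tens_act_lin t)).
- exact: (lin_comp (bm.2 _) theta_lin).
move: t; apply: dg_ext => [||h z].
- exact: (lin_comp theta_lin (tens_act_linl _)).
- exact: (lin_comp (bm.1 _) lF).
rewrite tens_act_pure dg_sw2; last first.
  split=> [a2|a1].
    by apply: (bil_l _ (bil_tpure _ _)); exact: bn.1.
  by apply: (bil_r _ (bil_tpure _ _)); exact: bM.1.
rewrite (lin_bigsum theta_lin) theta_pure verma_act.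
move: (vsval x : D) (nm_act ^~ x) => X XE.
transitivity (\sum_p vpure (N := N) (M := M) (hmul (hmul (from_dbl_group N (dg k h z)) X)
    (fd (jf N (dl k (p^-1 * z)%g)) : D)) m).
  apply: eq_bigr => p _; rewrite theta_pure XE adj_dg (lin_bigsum (bv.1 _)).
  rewrite (bigD1 z) // big1 => [|q nq]; rewrite -vpure_from -dbl_mulA -fromM hant_dgM.
    rewrite invMg invgK eqxx from_fd; apply: addr0.
  rewrite invMg invgK (inj_eq (mulgI _)) (negPf nq).
  by rewrite (lin0 lF) (lin0 (d2 _)) (lin0 (bv.1 _)).
rewrite -(lin_bigsum (bv.1 m)) -(lin_bigsum (d2 _)) -(lin_bigsum (@fd_lin _ H)) -(lin_bigsum (@jf_lin _ _ _ _ N)).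
have -> : \sum_i dl k (i^-1 * z)%g = \sum_q dl k q.
  by rewrite [RHS](reindex_inj (mulIg z)) [RHS](reindex_inj invg_inj).
by rewrite sum_dl jf1 fd1 dbl_mul1r.
Qed.

Variable Mh : operators DG.
Hypothesis simMh : simple_mod Mh.
Hypothesis iso_hat : mod_iso Mh (tens_mod NM M).

(** Injectivity follows from simplicity of [Mh]: the kernel is 0 or everything, and the latter is
    refuted by a nonzero [ve b m] with [b] of top degree, which lies in the image. *)
Lemma top_embedding : exists j : 'Hom(Mh, VM),
  [/\ injective j, forall t q, j (mact t q) = mact (from_dbl_group N t) (j q) &
      forall v, Pr ntop v = v <-> exists q, v = j q].
Proof.
have [f [kf imf ef]] := iso_hat; have bv := ve_bil N M; have bm := verma_bil N M.
have lj : lin (fun q => theta (f q)) by apply: (lin_comp theta_lin); apply: lin_lfun.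
pose j := linfun (fun q => theta (f q)).
have jE q : j q = theta (f q) by rewrite linfun_lin.
have jact t q : j (mact t q) = mact (from_dbl_group N t) (j q).
  by rewrite !jE ef theta_act.
have jve b m : b \in ngr N ntop -> exists q, ve b m = j q.
  move=> bN; have xP : (fb (b # 1%g : H) : D) \in nichols_part N ntop.
    by apply/nichols_partP; exists b.
  have : (tpure (vsproj (nichols_part N ntop) (fb (b # 1%g : H) : D) : NM) m : tens_mod NM M) \in limg f.
    by rewrite imf memvf.
  move=> /memv_imgP[q _ qE]; exists q.
  by rewrite jE -qE theta_pure vsprojK.
exists j; split=> //.
- have sk : submodule (lker j).
    by move=> t q; rewrite !memv_ker => /eqP jq; rewrite jact jq (lin0 (bm.2 _)).
  apply/lker0P; apply/negPn/negP => /(simMh.2 _ sk) kfull.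
  have [top0 _] := mtop; apply: top0; apply/eqP; rewrite -vpick0; set b := vpick _.
  have [q qE] : exists q : Mh, q != 0 by exact: simMh.1.
  (* If [M] were 0, so would be the tensor product, in which the nonzero [Mh] embeds. *)
  have [m nm] : exists m : M, m != 0.
    apply: NNPP => nex; have M0 (m : M) : m = 0.
      by apply/eqP; apply: contra_notT nex => nm; exists m.
    have injf : injective f by apply/lker0P/eqP.
    case/eqP: qE; apply: injf.
    rewrite linear0; apply: tens_sepr => xi; apply: tlift_eq0 => a m.
    by rewrite (M0 m) linear0 scale0r.
  have [q' q'E] := jve b m (memv_pick _).
  have j0 : j q' = 0 by apply/eqP; rewrite -memv_ker kfull memvf.
  have := congr1 (@Phi _ _ _ _ N M) q'E; rewrite j0 (lin0 (@Phi_lin _ _ _ _ N M)) Phi_ve => bm0.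
  have [xi xim] : exists xi : dualv M, xi m = 1.
    apply: NNPP => nex; case/eqP: nm; apply: dual_sep => f'; apply/eqP.
    apply: contra_notT nex => nf'.
    by exists ((f' m)^-1 *: f'); rewrite scale_lfunE /GRing.scale /= mulVf.
  have := congr1 (tlift (fun (a : N) m => (xi m : k) *: a)) bm0.
  rewrite tliftp; last by slin.
  by rewrite xim scale1r (lin0 (tlift_is_linear _)) => b0; apply/eqP.
move=> v; split=> [<-|[q ->]].
  rewrite /Pr; pose Q v := exists q, v = j q.
  apply: (tlift_ind (P := Q)) => [|b m]; last by apply: jve; apply: npr_mem.
  split=> [|c u w [q ->] [q' ->]]; first by exists 0; rewrite linear0.
  by exists (c *: q + q'); rewrite linearP.
rewrite jE; move: (f q); apply: tens_ext => [||x m].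
- exact: (lin_comp (@Pr_lin _ _ _ _ N M ntop) theta_lin).
- exact: theta_lin.
rewrite theta_pure; have /nichols_partP[b bN ->] := subvsP x.
by rewrite -/(ve b m) Pr_ve (npr_id bN) eqxx.
Qed.

End TopComponent.

End VermaSubmodules.

(** * Socles, heads and duals *)

Section Modules.
Context {k : fieldType} {A : hopf_data k}.
Implicit Type M : operators A.

Lemma gen_submoduleP M (U : {vspace M}) :
  [/\ submodule (gen_submodule U), (U <= gen_submodule U)%VS &
      forall X : {vspace M}, submodule X -> (U <= X)%VS -> (gen_submodule U <= X)%VS].
Proof.
split=> [a u /bigmeetP uG||X sX UX].
- by apply/bigmeetP => X CX; apply: CX.1; apply: uG.
- by apply/subvP => u uU; apply/bigmeetP => X [_ /subvP UX]; apply: UX.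
by apply/subvP => u /bigmeetP; apply.
Qed.

Lemma gen_submodule_simple M (U : {vspace M}) :
  simple_mod M -> U != 0%VS -> gen_submodule U = fullv.
Proof.
move=> [_ simM] nU; have [sG UG _] := gen_submoduleP U; apply: simM => //.
by apply: contraNneq nU => G0; rewrite -subv0 -G0.
Qed.

(** [T] is a mere subspace; in the application it is stable under D(G). The submodule it generates
    lies in every nonzero one, so it is the only simple submodule. *)
Lemma socle_least M (T : {vspace M}) : T != 0%VS ->
  (forall X : {vspace M}, submodule X -> X != 0%VS -> (T <= X)%VS) ->
  [/\ submodule (socle M), (T <= socle M)%VS &
      forall X : {vspace M}, submodule X -> X != 0%VS -> (socle M <= X)%VS].
Proof.
move=> nT minT; have [sG TG minG] := gen_submoduleP T; set G := gen_submodule T in sG TG minG.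
have least (X : {vspace M}) : submodule X -> X != 0%VS -> (G <= X)%VS.
  by move=> sX nX; apply: minG => //; apply: minT.
have simG : simple_submodule G.
  split=> [||X sX XG]; [exact: sG | |].
    by apply: contraNneq nT => G0; rewrite -subv0 -G0.
  case: (eqVneq X 0%VS) => [->|nX]; [by left | right].
  by apply/eqP; rewrite eqEsubv XG least.
suff -> : socle M = G by split.
apply/eqP; rewrite eqEsubv; apply/andP; split; apply/subvP => u.
  move=> /bigmeetP; apply => U [sU nU minU].
  by case: (minU G sG (least U sU nU)) => [G0|->]; [case: simG => _; rewrite G0 eqxx | ].
by move=> uG; apply/bigmeetP => X /(_ G simG)/subvP; apply.
Qed.

Lemma sub_mod_act M (U : {vspace M}) a (u : sub_mod U) : submodule U ->
  vsval (mact a u) = mact a (vsval u).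
Proof. by move=> sU; rewrite /= vsprojK //; apply: sU; apply: subvsP. Qed.

Lemma vsval_lin (W : vectType k) (U : {vspace W}) :
  lin (fun u : subvs_of U => vsval u).
Proof. by move=> a u v; exact: linearP. Qed.

Lemma sub_mod_laws M (U : {vspace M}) : mod_laws M -> submodule U ->
  mod_laws (sub_mod U).
Proof.
move=> ML sU; have [bM M1 MM] := ML; have lv := @vsval_lin M U.
have lp : lin (vsproj U) by move=> a u v; exact: linearP.
split=> [|u|a b u]; first split=> [u|a].
- exact: (lin_comp lp (bM.1 (vsval u))).
- exact: (lin_comp lp (lin_comp (bM.2 a) lv)).
- by apply: val_inj; rewrite [LHS]sub_mod_act // M1.
by apply: val_inj; rewrite [LHS]sub_mod_act // [RHS]sub_mod_act // [X in mact a X]sub_mod_act // MM.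
Qed.

Lemma sub_mod_simple M (U : {vspace M}) : submodule U -> U != 0%VS ->
  (forall X : {vspace M}, submodule X -> X != 0%VS -> (U <= X)%VS) ->
  simple_mod (sub_mod U).
Proof.
move=> sU nU minU; split.
  exists (vsproj U (vpick U)); apply: contraNneq nU => /(congr1 vsval).
  by rewrite vsprojK ?memv_pick // (lin0 (@vsval_lin M U)) => /eqP; rewrite vpick0.
move=> X sX nX; pose v := linfun (fun u : subvs_of U => vsval u).
have vE u : v u = vsval u by rewrite linfun_lin //; exact: vsval_lin.
have sI : submodule (v @: X)%VS.
  move=> a _ /memv_imgP[u uX ->]; rewrite vE -(sub_mod_act a u sU) -vE.
  by apply: memv_img; apply: sX.
have /(minU _ sI)/subvP UI : (v @: X)%VS != 0%VS.
  apply: contraNneq nX => I0; rewrite -subv0; apply/subvP => u uX.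
  have : v u \in (v @: X)%VS by apply: memv_img.
  rewrite I0 memv0 vE memv0 => /eqP u0; apply/eqP/val_inj.
  by rewrite [LHS]u0; exact: esym (lin0 (@vsval_lin M U)).
apply/eqP; rewrite eqEsubv subvf; apply/subvP => u _.
have /UI/memv_imgP[w wX] := subvsP u.
by rewrite vE => /val_inj ->.
Qed.

Section Dual.
Hypothesis antL : lin (@hant k A).
Hypothesis ant1 : hant (hone A) = hone A.
Hypothesis antM : forall a b : A, hant (hmul a b) = hmul (hant b) (hant a).

Lemma dual_actE M : mod_laws M -> forall a (f : dual_mod M) m,
  (mact a f : dualv M) m = (f : dualv M) (mact (hant a) m).
Proof.
move=> ML a f m; have [bM _ _] := ML.
apply: (functionalE (f := fun m => (f : dualv M) (mact (hant a) m))).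
exact: (lin_comp (lin_lfun (f : dualv M)) (bM.2 _)).
Qed.

Lemma dual_mod_laws M : mod_laws M -> mod_laws (dual_mod M).
Proof.
move=> ML; have [bM M1 MM] := ML; split=> [|f|a b f].
- split=> [f|a] c u v; apply/lfunP => m; rewrite add_lfunE scale_lfunE !dual_actE //.
    by rewrite antL (bM.1 m) linearP.
  by rewrite add_lfunE scale_lfunE.
- by apply/lfunP => m; rewrite dual_actE // ant1 M1.
by apply/lfunP => m; rewrite !dual_actE // antM MM.
Qed.

(** The common zeros of a submodule of the dual are stable under all [hant b], that is under every
    operator once the antipode is surjective. A proper submodule has a nonzero common zero, hence
    vanishes everywhere. *)
Lemma dual_mod_simple M : (forall a : A, exists b, hant b = a) ->
  mod_laws M -> simple_mod M -> simple_mod (dual_mod M).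
Proof.
move=> antS ML [[m nm] simM]; split.
  apply: NNPP => nex; case/eqP: nm; apply: dual_sep => f; apply/eqP.
  by apply: contra_notT nex => nf; exists f; apply: contraNneq nf => ->; rewrite zero_lfunE.
move=> X sX; apply: contraNeq => /annihilatedP[u nu Xu].
pose Z := spanned (fun u => forall f, f \in X -> (f : dualv M) u = 0).
have sP : subspace (fun u => forall f, f \in X -> (f : dualv M) u = 0).
  split=> [f _|a v w Pv Pw f fX]; first exact: linear0.
  by rewrite (lin_lfun (f : dualv M) a v w) (Pv f fX) (Pw f fX) scaler0 addr0.
have Zf : Z = fullv.
  apply: simM; last first.
    apply: contraNneq nu => Z0; rewrite -memv0 -Z0; exact/(spannedP sP).
  move=> a v /(spannedP sP) Pv; apply/(spannedP sP) => f fX.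
  by have [b <-] := antS a; rewrite -dual_actE //; apply: Pv; apply: sX.
rewrite -subv0; apply/subvP => f fX; rewrite memv0; apply/eqP/lfunP => v.
have /(spannedP sP)/(_ f fX) : v \in Z by rewrite Zf memvf.
by rewrite zero_lfunE.
Qed.

End Dual.

(** The subspace [W] contains every proper submodule, so the sum of two of them is again proper. A
    maximal submodule therefore contains the kernel of [F], which is itself maximal as [L] is
    simple; the radical is this kernel. *)
Lemma head_mod_iso M (L : operators A) (W : {vspace M}) (F : 'Hom(M, L)) :
  mod_laws M -> mod_laws L -> simple_mod L -> limg F = fullv ->
  (forall a m, F (mact a m) = mact a (F m)) -> W != fullv ->
  (forall X : {vspace M}, submodule X -> X != fullv -> (X <= W)%VS) ->
  mod_iso L (head_mod M).
Proof.
move=> ML LL [[l0 nl0] simL] surF Fact nW properW.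
have [bM _ _] := ML; have [bL _ _] := LL.
have FK l : F (F^-1%VF l) = l by apply: limg_lfunVK; rewrite surF memvf.
have sK : submodule (lker F).
  by move=> a m; rewrite !memv_ker => /eqP Fm; rewrite Fact Fm (lin0 (bL.2 a)).
have nK : lker F != fullv.
  apply: contraNneq nl0 => Kf; rewrite -(FK l0) -memv_ker Kf; exact: memvf.
have maxK : maximal_submodule (lker F).
  split=> // X sX KX; case: (eqVneq (F @: X)%VS 0%VS) => [X0|nX].
    left; apply/eqP; rewrite eqEsubv KX andbT; apply/subvP => x xX.
    by rewrite memv_ker -memv0 -X0 memv_img.
  right; have FX : (F @: X)%VS = fullv.
    apply: simL => // a _ /memv_imgP[x xX ->]; rewrite -Fact.
    by apply: memv_img; apply: sX.
  apply/eqP; rewrite eqEsubv subvf; apply/subvP => w _.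
  have : F w \in (F @: X)%VS by rewrite FX memvf.
  move=> /memv_imgP[x xX Fwx]; rewrite -[w](subrK x); apply: memvD => //.
  by apply: (subvP KX); rewrite memv_ker linearB /= Fwx subrr.
have radK : radical M = lker F.
  apply/eqP; rewrite eqEsubv; apply/andP; split; apply/subvP => x.
    by move=> /bigmeetP; apply.
  move=> xK; apply/bigmeetP => X [sX nX maxX]; have [_ _ maxK'] := maxK.
  have sXK : submodule (X + lker F)%VS.
    move=> a _ /memv_addP[u uX [v vK ->]]; rewrite (linD (bM.2 a)).
    by apply: memv_add; [exact: sX | exact: sK].
  case: (maxX _ sXK (addvSl _ _)) => E.
    by rewrite -E; apply: (subvP (addvSr X _)).
  case/eqP: nW; apply/eqP; rewrite eqEsubv subvf -E subv_add.
  by rewrite !properW.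
have inR x : x \in radical M = (F x == 0) by rewrite radK memv_ker.
have lq : lin (qproj (radical M)) by exact: qproj_linear.
(* The linear section of [F] respects the action modulo the kernel, which suffices in the
   quotient. *)
pose f := linfun (fun l => qproj (radical M) (F^-1%VF l)).
have fE l : f l = qproj (radical M) (F^-1%VF l).
  by rewrite linfun_lin //; apply: (lin_comp lq); apply: lin_lfun.
exists f; split=> [||a l].
- apply/eqP/lker0P => l l'; rewrite !fE => /qproj_eq.
  by rewrite inR linearB /= !FK subr_eq0 => /eqP.
- apply/eqP; rewrite eqEsubv subvf; apply/subvP => q _.
  have [w <-] := qproj_surj q; apply/memv_imgP; exists (F w); first exact: memvf.
  by rewrite fE; apply/qproj_eq; rewrite inR linearB /= FK subrr.
rewrite !fE; apply/qproj_eq; rewrite inR linearB /= FK Fact subr_eq0.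
have := qproj_rep (radical M) (F^-1%VF l).
by rewrite inR linearB /= FK subr_eq0 => /eqP <-.
Qed.

End Modules.

(** * The dual of the socle and its highest weight *)

Section SocleDual.
Variables (k : fieldType) (gT : finGroupType) (V : vectType k).
Variables (Y : yd_struct gT V) (N : nichols_algebra Y).
Local Notation DG := (dbl_group k gT).
Local Notation D := (dbl N).
Local Notation pi := (@dbl_ge0_proj _ _ _ _ N).

Section FromVerma.
Variables (Ms : operators DG) (L : operators D) (th : 'Hom(Ms, L)).
Context {MLs : mod_laws Ms} {LL : mod_laws L}.
Hypothesis th_act : forall t m, th (mact t m) = mact (from_dbl_group N t) (th m).
Hypothesis th_Vbar : forall f m, in_Vbar f -> mact (from_dual f : D) (th m) = 0.

Lemma ge0_head (a : D) : a \in dbl_ge0 N ->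
  forall m, mact a (th m) = th (mact (pi a) m).
Proof.
have [bL L1 LM] := LL; have [bs s1 sM] := MLs.
(* Membership is part of the induction because [piM] asks for it on the right factor of a
   product. *)
pose P (a : D) := a \in dbl_ge0 N /\ forall m, mact a (th m) = th (mact (pi a) m).
have piK t : pi (from_dbl_group N t) = t by exact: from_dbl_groupK.
have sP : subspace P.
  split; first by rewrite /P mem0v; split=> // m; rewrite (lin0 (bL.1 _)) (lin0 (@pi_lin _ _ _ _ N)) (lin0 (bs.1 m)) linear0.
  move=> c u v [uG uE] [vG vE]; split=> [|m]; first by rewrite memvD ?memvZ.
  by rewrite (bL.1 (th m)) uE vE (@pi_lin _ _ _ _ N) (bs.1 m) linearP.
have inU t : from_dbl_group N t \in spanned P.
  by apply/(spannedP sP); split=> [|m]; [exact: from_ge0 | rewrite piK th_act].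
move=> aG; suff /(spannedP sP)[] : a \in spanned P by [].
move/bigmeetP: aG; apply; split.
- by rewrite -(from1 N).
- move=> u v /(spannedP sP)[uG uE] /(spannedP sP)[vG vE]; apply/(spannedP sP).
  by split=> [|m]; [exact: ge0_mul | rewrite LM vE uE piM // sM].
move=> u [[t ->] // | [f fV ->]]; apply/(spannedP sP); split=> [|m].
  by apply/bigmeetP => X [_ _]; apply; right; exists f.
by rewrite th_Vbar // dbl_ge0_proj_Vbar // (lin0 (bs.1 m)) linear0.
Qed.

(** The universal property of induction from [dbl_ge0]: by [ge0_head] the Verma relations are
    killed. *)
Lemma verma_hom : exists F : 'Hom(verma N Ms, L),
  (forall d v, F (mact d v) = mact d (F v)) /\ forall m, F (vpure (hone D) m) = th m.
Proof.
have [bL L1 LM] := LL.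
pose F0 (t : tens D Ms) := tlift (fun (d : D) m => mact d (th m)) t.
have l0 : lin F0 by exact: tlift_is_linear.
have bF : bil (fun (d : D) m => mact d (th m)).
  split=> u; first exact: (bL.1 (th u)).
  exact: (lin_comp (bL.2 u) (lin_lfun th)).
have F0_rel t : t \in verma_relations N Ms -> F0 t = 0.
  apply: (spanned_ind (Q := fun t => F0 t = 0)) => [|_ [d [a [m [aG ->]]]]].
    by split=> [|c u v Fu Fv]; [exact: (lin0 l0) | rewrite l0 Fu Fv scaler0 addr0].
  by rewrite (linB l0) /F0 !tliftp // LM ge0_head // subrr.
pose F := linfun (fun q : verma N Ms => F0 (vsval q)).
have FE q : F q = F0 (vsval q).
  by rewrite linfun_lin //; apply: (lin_comp l0); exact: vsval_lin.
have Fpure d m : F (vpure d m) = mact d (th m).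
  rewrite FE; transitivity (F0 (tpure d m)); last by rewrite /F0 tliftp.
  apply/esym/eqP; rewrite -subr_eq0 -(linB l0); apply/eqP/F0_rel.
  exact: qproj_rep.
have bm := verma_bil N Ms.
exists F; split=> [d|m]; last by rewrite Fpure L1.
apply: vpure_ext => [||d' m].
- exact: (lin_comp (lin_lfun F) (bm.2 d)).
- exact: (lin_comp (bL.2 d) (lin_lfun F)).
by rewrite verma_act !Fpure LM.
Qed.

Lemma highest_weight_intro : injective th -> simple_mod Ms -> simple_mod L ->
  highest_weight L Ms.
Proof.
move=> injth simMs simL.
have thK : cancel th th^-1%VF by apply: lker0_lfunK; apply/lker0P.
pose R := restrict (from_dbl_group N) L.
pose U : {vspace R} := limg th.
have sU : submodule U.
  move=> t _ /memv_imgP[m _ ->].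
  have -> : mact (o := R) t (th m) = th (mact t m) by rewrite th_act.
  by rewrite memv_img ?memvf.
have nU : U != 0%VS.
  have [[m nm] _] := simMs; apply: contraNneq nm => U0.
  by apply/eqP/injth/eqP; rewrite linear0 -memv0 -U0 memv_img ?memvf.
have UP (X : {vspace R}) : submodule X -> (X <= U)%VS -> X = 0%VS \/ X = U.
  move=> sX XU; case: (eqVneq X 0%VS) => [->|nX]; [by left | right].
  apply/eqP; rewrite eqEsubv XU; apply/subvP => _ /memv_imgP[m _ ->].
  have full : (th @^-1: X)%VS = fullv.
    apply: simMs.2 => [t u|].
      by rewrite -!memv_preim th_act => uX; exact: (sX t).
    apply: contraNneq nX => X0; rewrite -subv0; apply/subvP => x xX.
    have /memv_imgP[u _ xu] := subvP XU _ xX.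
    have : u \in (th @^-1: X)%VS by rewrite -memv_preim -xu.
    by rewrite X0 !memv0 xu => /eqP ->; rewrite linear0.
  by rewrite memv_preim full memvf.
exists U; split=> [||f u fV /memv_imgP[m _ ->]|]; [by split | | exact: th_Vbar |].
  pose f := linfun (fun u : sub_mod U => th^-1%VF (vsval u)).
  have fE u : f u = th^-1%VF (vsval u).
    by rewrite linfun_lin //; apply: (lin_comp (lin_lfun _)); exact: vsval_lin.
  have fth u : th (f u) = vsval u.
    by rewrite fE; have /memv_imgP[m _ ->] := subvsP u; rewrite thK.
  exists f; split=> [||t u].
  - by apply/eqP/lker0P => u u' uu; apply: val_inj; rewrite -[LHS]fth -[RHS]fth uu.
  - apply/eqP; rewrite eqEsubv subvf; apply/subvP => m _; apply/memv_imgP.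
    exists (vsproj U (th m)); rewrite ?memvf // fE vsprojK ?thK //.
    by rewrite memv_img ?memvf.
  by apply: injth; rewrite th_act !fth sub_mod_act.
exact: gen_submodule_simple.
Qed.

End FromVerma.

Variables (ntop : nat) (mtop : max_degree N ntop).
Variables M Mh Ms : operators DG.
Context {ML : mod_laws M} {MLh : mod_laws Mh} {MLs : mod_laws Ms}.
Hypotheses (simMh : simple_mod Mh) (simMs : simple_mod Ms).
Hypothesis iso_hat : mod_iso Mh (tens_mod (nichols_mod N ntop) M).
Hypothesis iso_star : mod_iso Ms (dual_mod Mh).
Local Notation VM := (verma N M).

Lemma verma_socle_simple :
  [/\ submodule (socle VM), simple_mod (sub_mod (socle VM)) &
   exists j : 'Hom(Mh, VM), [/\ injective j, (limg j <= socle VM)%VS,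
     forall t q, j (mact t q) = mact (from_dbl_group N t) (j q) &
     forall v, Pr ntop v = v <-> exists q, v = j q]].
Proof.
have [j [injj jact jP]] := top_embedding mtop simMh iso_hat.
have nT : limg j != 0%VS.
  have [[q nq] _] := simMh; apply: contraNneq nq => j0.
  by apply/eqP/injj/eqP; rewrite linear0 -memv0 -j0 memv_img ?memvf.
have least (X : {vspace VM}) : submodule X -> X != 0%VS -> (limg j <= X)%VS.
  move=> sX nX; have [v [vX nv vk]] := submodule_killed sX nX.
  have [q vq] := (jP v).1 (killed_top mtop vk).
  (* The preimage of [X] is a D(G)-submodule of the simple [Mh], nonzero since it contains [q];
     hence it is everything and [X] contains the whole top component. *)
  have -> : limg j = (j @: (j @^-1: X))%VS.
    rewrite (_ : j @^-1: X = fullv)%VS //; apply: simMh.2 => [t u|].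
      by rewrite -!memv_preim jact => uX; apply: sX.
    apply: contraNneq nv => X0; rewrite vq.
    have : q \in (j @^-1: X)%VS by rewrite -memv_preim -vq.
    by rewrite X0 memv0 => /eqP ->; rewrite linear0.
  by apply/subvP => _ /memv_imgP[u uX ->]; rewrite memv_preim.
have [sS TS minS] := socle_least nT least.
split=> //; last by exists j.
apply: sub_mod_simple => //.
by apply: contraNneq nT => S0; rewrite -subv0 -S0.
Qed.

Local Notation S := (sub_mod (socle VM)).

Lemma dual_socle_laws : mod_laws (dual_mod S).
Proof.
have [sS _ _] := verma_socle_simple.
apply: dual_mod_laws; [exact: dblS_lin | exact: dblS1 | exact: dblSM |].
exact: sub_mod_laws.
Qed.

Lemma dual_socle_simple : simple_mod (dual_mod S).
Proof.
have [sS simS _] := verma_socle_simple.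
apply: dual_mod_simple => //; last exact: sub_mod_laws.
exact: dblS_surj.
Qed.

Lemma highest_weight_embedding : exists th : 'Hom(Ms, dual_mod S),
  [/\ injective th, forall t m, th (mact t m) = mact (from_dbl_group N t) (th m) &
      forall f m, in_Vbar f -> mact (from_dual f : D) (th m) = 0].
Proof.
have [sS _ [j [injj jS jact jP]]] := verma_socle_simple.
have [g [g0 gf gact]] := iso_star.
have SL : mod_laws S by exact: sub_mod_laws.
have lS : lin (@hant k D) by exact: dblS_lin.
have jK : cancel j j^-1%VF by apply: lker0_lfunK; apply/lker0P.
have lv := @vsval_lin k VM (socle VM).
(* The projection of the socle onto its top component, read in [Mh]. Pulling back along it sends
   functionals on [Mh] to functionals on the socle that vanish below the top degree. *)
pose r (s : S) : Mh := j^-1%VF (Pr ntop (vsval s)).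
have lr : lin r by apply: (lin_comp (lin_lfun _)); apply: (lin_comp (@Pr_lin _ _ _ _ N M ntop)).
have lth0 m : lin (fun s : S => (g m : dualv Mh) (r s)) by apply: (lin_comp (lin_lfun (g m : dualv Mh))).
pose th0 m : dualv S := functional (fun s : S => (g m : dualv Mh) (r s)).
have th0E m s : th0 m s = (g m : dualv Mh) (r s).
  exact: (functionalE (f := fun s : S => (g m : dualv Mh) (r s)) (lth0 m)).
have lth : lin th0.
  move=> c u v; apply/lfunP => s; rewrite add_lfunE scale_lfunE !th0E linearP.
  by rewrite add_lfunE scale_lfunE.
pose th : 'Hom(Ms, dual_mod S) := linfun th0.
have thE m s : (th m : dualv S) s = (g m : dualv Mh) (r s) by rewrite linfun_lin // th0E.
have Sact a s : vsval (mact a s : S) = mact a (vsval s) by exact: sub_mod_act.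
exists th; split.
- have injg : injective g by apply/lker0P/eqP.
  move=> m m' mm; apply: injg; apply/lfunP => q.
  (* The top component lies in the socle, so its vectors are available to separate functionals. *)
  have jqS : j q \in socle VM by apply: (subvP jS); rewrite memv_img ?memvf.
  have := congr1 (fun f : dualv S => f (vsproj (socle VM) (j q) : S)) mm.
  rewrite !thE /r vsprojK // (_ : Pr ntop (j q) = j q) ?jK //.
  by apply: (jP _).2; exists q.
- move=> t m; apply/lfunP => s.
  rewrite (dual_actE SL (from_dbl_group N t)) !thE gact (dual_actE MLh).
  congr ((g m : dualv Mh) _); rewrite /r Sact -from_hant Pr_from.
  (* The inverse of [j] is meaningful on the image of [j]; the projection, being idempotent, lands
     there. *)
  have [|q ->] := (jP (Pr ntop (vsval s))).1; first by rewrite Pr_Pr eqxx.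
  by rewrite -jact !jK.
move=> f m fV; apply/lfunP => s.
rewrite (dual_actE SL (from_dual f : D)) thE zero_lfunE /r Sact.
by rewrite (Pr_top_Vbar _ mtop fV) !linear0.
Qed.

Lemma dual_socle_highest_weight : highest_weight (dual_mod S) Ms.
Proof.
have [th [injth thact thV]] := highest_weight_embedding.
exact: (highest_weight_intro thact thV injth simMs dual_socle_simple).
Qed.

Lemma dual_socle_head : mod_iso (dual_mod S) (head_mod (verma N Ms)).
Proof.
have [th [injth thact thV]] := highest_weight_embedding.
have SL := dual_socle_laws; have simS := dual_socle_simple.
have [F [Fact F1]] := verma_hom thact thV.
have lP := @Pr_lin _ _ _ _ N Ms 0%N.
have [[m nm] _] := simMs.
have nth : th m != 0 by apply: contraNneq nm => m0; apply/eqP/injth; rewrite m0 linear0.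
pose W := spanned (fun v : verma N Ms => Pr 0 v = 0).
have sW : subspace (fun v : verma N Ms => Pr 0 v = 0).
  by split=> [|c u v u0 v0]; [exact: (lin0 lP) | rewrite lP u0 v0 scaler0 addr0].
apply: (head_mod_iso (W := W) (F := F)) => //.
- apply: simS.2 => [a _ /memv_imgP[v _ ->]|].
    by rewrite -Fact memv_img ?memvf.
  by apply: contraNneq nth => I0; rewrite -memv0 -I0 -F1 memv_img ?memvf.
- apply: contraNneq nth => Wf; rewrite -F1 -(ve1E N m).
  have /(spannedP sW) : ve 1 m \in W by rewrite Wf memvf.
  rewrite Pr_ve (npr_id (i := 0)) ?ngr0 ?memv_line // eqxx => ->.
  by rewrite linear0.
move=> X sX; apply: contraNT => /subvPn[v vX nv]; apply/eqP.
apply: submodule_full => //; exists v => //; apply: contraNneq nv => v0.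
exact/(spannedP sW).
Qed.

End SocleDual.

Theorem theorem5 (k : closedFieldType) (char0 : [pchar k] =i pred0)
    (gT : finGroupType) (nonabelian : ~~ abelian [set: gT])
    (V : vectType k) (Y : yd_struct gT V) (N : nichols_algebra Y)
    (ntop : nat) (ntop_max : max_degree N ntop)
    (* the simple module M(g, rho) *)
    (g : gT) (n : nat) (rho : mx_representation k 'C[g]%G n)
    (irr_rho : mx_irreducible rho)
    (* the weight (hat g, hat rho) of B^{ntop}(V) (x) M(g, rho) *)
    (gh : gT) (nh : nat) (rhoh : mx_representation k 'C[gh]%G nh)
    (irr_rhoh : mx_irreducible rhoh)
    (iso_hat : mod_iso (weight_mod rhoh)
                       (tens_mod (nichols_mod N ntop) (weight_mod rho)))
    (* the weight of the dual of M(hat g, hat rho) *)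
    (gs : gT) (ns : nat) (rhos : mx_representation k 'C[gs]%G ns)
    (irr_rhos : mx_irreducible rhos)
    (iso_star : mod_iso (weight_mod rhos) (dual_mod (weight_mod rhoh))) :
  let S := sub_mod (socle (verma N (weight_mod rho))) in
  highest_weight (dual_mod S) (weight_mod rhos) /\
  mod_iso (dual_mod S) (head_mod (verma N (weight_mod rhos))).
Proof.
have simMh := weight_simple irr_rhoh; have simMs := weight_simple irr_rhos.
split; first exact: (dual_socle_highest_weight ntop_max simMh simMs iso_hat iso_star).
exact: (dual_socle_head ntop_max simMh simMs iso_hat iso_star).
Qed.
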